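(* Let $k$ be an infinite field of characteristic $p>0$, let $n\geq 1$ be an integer, and for $0\leq i\leq \min(n-1,p-1)$ let $\lambda^i=(p-i,1^i)$. For all $0\leq i<\min(n-1,p-1)$ the Weyl module $\Delta(\lambda^i)$ for $\mathrm{GL}_n(k)$ has exactly two composition factors, $L(\lambda^i)$ and $L(\lambda^{i+1})$ (each occurring with multiplicity one). If $i=\min(n-1,p-1)$, then $\Delta(\lambda^i)$ is simple.
   Context: $k$ is an infinite field of characteristic $p>0$ and $G=\mathrm{GL}_n(k)$, regarded as an algebraic group (all modules are rational). $T\subset G$ is the subgroup of diagonal matrices; its character group $X(T)$ is identified with $\mathbb{Z}^n$ via $\lambda=\sum_i\lambda_i\varepsilon_i\leftrightarrow(\lambda_1,\dots,\lambda_n)$, where $\varepsilon_i$ is the $i$-th diagonal coordinate function. The positive roots are $\varepsilon_i-\varepsilon_j$ ($i<j$), so $\lambda$ is dominant iff $\lambda_1\geq\cdots\geq\lambda_n$. $B$ is the Borel subgroup corresponding to the negative roots. For dominant $\lambda$: $\nabla(\lambda)=\mathrm{ind}_B^G k_\lambda$, where $k_\lambda$ is the one-dimensional $B$-module on which $T$ acts via $\lambda$ and the unipotent radical of $B$ acts trivially; $\Delta(\lambda)$ is the Weyl module, $\Delta(\lambda)\simeq\nabla(-w_0\lambda)^*$ with $w_0$ the longest element of the Weyl group $\Sigma_n$; $L(\lambda)$ is the simple $G$-module of highest weight $\lambda$. The $p$-hook partitions are $\lambda^i=(p-i,1^i)$, $0\leq i\leq p-1$, a partition of $p$ with $i+1$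 parts; a partition with at most $n$ parts is regarded as a dominant weight by appending zeros. *)

(* Defs.v *)
From HB Require Import structures.
From mathcomp Require Import all_boot all_order all_algebra.
From mathcomp Require Import mpoly.
From mathcomp Require Import boolp classical_sets functions cardinality.

Set Implicit Arguments.
Unset Strict Implicit.
Unset Printing Implicit Defensive.

Import GRing.Theory.
Local Open Scope ring_scope.

Section GeneralLinearGroup.
Variables (k : fieldType) (n : nat).

Definition GL := {g : 'M[k]_n | g \in unitmx}.
HB.instance Definition _ := Choice.on GL.

Definition GL_mx (g : GL) : 'M[k]_n := sval g.

Lemma GL_unit (g : GL) : GL_mx g \in unitmx.
Proof. by case: g. Qed.

Definition GL_one : GL := exist _ 1%:M (unitmx1 k n).

Lemma GL_mul_subproof (g h : GL) : GL_mx g *m GL_mx h \in unitmx.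
Proof. by rewrite unitmx_mul !GL_unit. Qed.
Definition GL_mul (g h : GL) : GL :=
  exist (fun x => x \in unitmx) _ (GL_mul_subproof g h).

Lemma GL_inv_subproof (g : GL) : invmx (GL_mx g) \in unitmx.
Proof. by rewrite unitmx_inv GL_unit. Qed.
Definition GL_inv (g : GL) : GL :=
  exist (fun x => x \in unitmx) _ (GL_inv_subproof g).

Lemma GL_mulA : associative GL_mul.
Proof. by move=> f g h; apply: val_inj; apply: mulmxA. Qed.
Lemma GL_mul1g : left_id GL_one GL_mul.
Proof. by move=> g; apply: val_inj; apply: mul1mx. Qed.
Lemma GL_mulg1 : right_id GL_one GL_mul.
Proof. by move=> g; apply: val_inj; apply: mulmx1. Qed.
Lemma GL_mulVg : left_inverse GL_one GL_inv GL_mul.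
Proof. by move=> g; apply: val_inj; apply: mulVmx; apply: GL_unit. Qed.
Lemma GL_mulgV : right_inverse GL_one GL_inv GL_mul.
Proof. by move=> g; apply: val_inj; apply: mulmxV; apply: GL_unit. Qed.

HB.instance Definition _ :=
  isGroup.Build GL GL_mulA GL_mul1g GL_mulg1 GL_mulVg GL_mulgV.

Lemma GL_mxM (g h : GL) : GL_mx (g * h)%g = GL_mx g *m GL_mx h.
Proof. by []. Qed.

(* k[G] = k[x_ij][1/det], as functions on the k-points; since k is infinite
   the k-points are Zariski dense, so nothing is lost.  The indeterminates are
   numbered as the entries of mxvec. *)
Definition regular (f : GL -> k) : Prop :=
  exists (P : {mpoly k[n * n]}) (r : nat), forall g : GL,
    f g = P.@[fun l => mxvec (GL_mx g) 0 l] / \det (GL_mx g) ^+ r.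

End GeneralLinearGroup.

Section Modules.
Variables (k : fieldType) (n : nat).
Local Notation G := (GL k n).

Record gmodule := GModule {
  gm_sort :> lmodType k;
  gact : G -> gm_sort -> gm_sort;
  gact_linear : forall g, linear (gact g);
  gact1 : forall v, gact 1%g v = v;
  gactM : forall g h v, gact (g * h)%g v = gact g (gact h v) }.

(* V is a union of finite-dimensional submodules with regular matrix
   coefficients: for each v, g |-> g v comes from an element of V (x) k[G]. *)
Definition rational (V : gmodule) : Prop :=
  forall v : V, exists (m : nat) (w : 'I_m -> V) (c : 'I_m -> G -> k),
    (forall i, regular (c i)) /\
    forall g, gact g v = \sum_(i < m) c i g *: w i.

Record submodule (V : gmodule) := Submodule {
  sm_set :> V -> Prop;
  sm0 : sm_set 0;
  smP : forall (a : k) (u v : V), sm_set u -> sm_set v -> sm_set (a *: u + v);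
  smG : forall (g : G) (v : V), sm_set v -> sm_set (gact g v) }.

Section SubmoduleAsModule.
Variables (V : gmodule) (U : submodule V).

Definition sm_pred : {pred V} := fun v => `[< U v >].

Lemma sm_pred_closed : GRing.subsemimod_closed sm_pred.
Proof.
have U0 : sm_pred 0 by apply/asboolP; exact: sm0.
split; first split=> // u v /asboolP Uu /asboolP Uv; last move=> a u /asboolP Uu;
  apply/asboolP.
- by rewrite -[u]scale1r; apply: smP.
- by rewrite -[a *: u]addr0; apply: smP => //; apply/asboolP.
Qed.
HB.instance Definition _ := GRing.isSubmodClosed.Build k V sm_pred sm_pred_closed.

Definition sm_sort := {v : V | sm_pred v}.
HB.instance Definition _ := SubChoice.on sm_sort.
HB.instance Definition _ := [SubChoice_isSubLmodule of sm_sort by <:].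

Lemma sm_act_subproof (g : G) (v : sm_sort) : sm_pred (gact g (val v)).
Proof. by case: v => v Uv; apply/asboolP; apply: smG; apply/asboolP. Qed.
Definition sm_act (g : G) (v : sm_sort) : sm_sort :=
  exist sm_pred _ (sm_act_subproof g v).

Lemma sm_act_linear g : linear (sm_act g).
Proof. by move=> a u v; apply: val_inj; apply: (gact_linear g). Qed.
Lemma sm_act1 v : sm_act 1%g v = v.
Proof. by apply: val_inj; apply: gact1. Qed.
Lemma sm_actM g h v : sm_act (g * h)%g v = sm_act g (sm_act h v).
Proof. by apply: val_inj; apply: gactM. Qed.

Definition gmodule_of_sub : gmodule := GModule sm_act_linear sm_act1 sm_actM.

End SubmoduleAsModule.

Section FunctionModule.
Variables (X : Type) (act : G -> X -> X).
Hypothesis act1 : forall x, act 1%g x = x.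
Hypothesis actM : forall g h x, act (g * h)%g x = act g (act h x).

Definition fun_act (g : G) (f : X -> k^o) : X -> k^o := fun x => f (act g^-1%g x).

Lemma fun_act_linear g : linear (fun_act g).
Proof. by []. Qed.
Lemma fun_act1 f : fun_act 1%g f = f.
Proof. by apply/funext => x; rewrite /fun_act invg1 act1. Qed.
Lemma fun_actM g h f : fun_act (g * h)%g f = fun_act g (fun_act h f).
Proof. by apply/funext => x; rewrite /fun_act invgM actM. Qed.

Definition fun_gmodule : gmodule := GModule fun_act_linear fun_act1 fun_actM.

End FunctionModule.

Section Dual.
Variable V : gmodule.

Definition dual_fun := fun_gmodule (@gact1 V) (@gactM V).

Definition dual_set : dual_fun -> Prop := fun phi : V -> k^o => linear phi.

Lemma dual_set0 : dual_set 0.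
Proof. by move=> a u v; rewrite scaler0 addr0. Qed.
Lemma dual_setP (a : k) (phi psi : dual_fun) :
  dual_set phi -> dual_set psi -> dual_set (a *: phi + psi).
Proof.
move=> lphi lpsi b u v.
rewrite /= !fctE lphi lpsi !scalerDr !scalerA [a * b]mulrC.
by rewrite addrACA.
Qed.
Lemma dual_setG (g : G) (phi : dual_fun) : dual_set phi -> dual_set (gact g phi).
Proof.
by move=> lphi a u v; rewrite /= /fun_act gact_linear lphi.
Qed.

Definition dual : gmodule :=
  gmodule_of_sub (Submodule dual_set0 dual_setP dual_setG).

End Dual.

Definition simple (V : gmodule) : Prop :=
  (exists v : V, v <> 0) /\
  forall U : submodule V, (forall v, U v -> v = 0) \/ (forall v, U v).

(* L is isomorphic to W / U, through the map W -> L with kernel U. *)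
Definition quotient_iso (V : gmodule) (W U : submodule V) (L : gmodule) : Prop :=
  (forall v, U v -> W v) /\
  exists f : gmodule_of_sub W -> L,
    [/\ linear f,
        forall g w, f (gact g w) = gact g (f w),
        forall x, exists w, f w = x
      & forall w, f w = 0 <-> U (\val w)].

End Modules.

Section Weights.
Variables (k : fieldType) (n : nat).
Local Notation G := (GL k n).

Definition weight := 'rV[int]_n.

(* The character t |-> prod_i t_i^(lambda_i) of the diagonal torus; on a
   triangular matrix it is the extension that is trivial on the unipotent
   radical. *)
Definition character (lambda : weight) (g : G) : k :=
  \prod_(i < n) GL_mx g i i ^ lambda 0 i.

Definition torus (g : G) : Prop := is_diag_mx (GL_mx g).
(* The Borel subgroup of the negative roots: lower triangular matrices. *)
Definition borel (g : G) : Prop := is_trig_mx (GL_mx g).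

Definition weight_vector (V : gmodule k n) (mu : weight) (v : V) : Prop :=
  v <> 0 /\ forall t, torus t -> gact t v = character mu t *: v.

Definition positive_root (i j : 'I_n) : weight := delta_mx 0 i - delta_mx 0 j.

(* mu <= lambda: lambda - mu is a sum of positive roots. *)
Definition weight_le (mu lambda : weight) : Prop :=
  exists c : 'I_n -> 'I_n -> nat,
    lambda - mu = \sum_(i < n) \sum_(j < n | (i < j)%N) positive_root i j *+ c i j.

Definition highest_weight (V : gmodule k n) (lambda : weight) : Prop :=
  (exists v : V, weight_vector lambda v) /\
  forall (mu : weight) (v : V), weight_vector mu v -> weight_le mu lambda.

(* L is a copy of L(lambda) (unique up to isomorphism). *)
Definition is_simple_hw (L : gmodule k n) (lambda : weight) : Prop :=
  [/\ rational L, simple L & highest_weight L lambda].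

(* The composition factors of V are the L(lambda), lambda in s, counted with
   multiplicity: V has a composition series 0 = U 0 < ... < U m = V whose
   successive quotients are, in some order t, the L(lambda) for lambda in s.
   By the Jordan-Hoelder theorem the multiset s does not depend on U. *)
Definition composition_factors (V : gmodule k n) (s : seq weight) : Prop :=
  exists (t : seq weight) (U : nat -> submodule V),
    [/\ perm_eq t s,
        forall v, U 0%N v <-> v = 0,
        forall v, U (size t) v
      & forall j, (j < size t)%N ->
          exists L : gmodule k n,
            is_simple_hw L t`_j /\ quotient_iso (U j.+1) (U j) L].

End Weights.

Section InducedAndWeylModules.
Variables (k : fieldType) (n : nat).
Local Notation G := (GL k n).

Definition left_regular : gmodule k n :=
  fun_gmodule (act := fun g h : G => (g * h)%g) (@mul1g G)
              (fun g h x => esym (mulgA g h x)).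

(* ind_B^G k_lambda, as a submodule of k[G] under left translation. *)
Definition nabla_set (lambda : weight n) : left_regular -> Prop :=
  fun f : G -> k^o => regular f /\
    forall g b : G, borel b -> f (g * b)%g = (character lambda b)^-1 * f g.

Lemma nabla_set0 lambda : nabla_set lambda 0.
Proof.
split=> [|g b _]; last by rewrite mulr0.
by exists 0, 0%N => g; rewrite meval0 mul0r.
Qed.

Lemma regularP (a : k) (f h : G -> k) :
  regular f -> regular h -> regular (fun g => a * f g + h g).
Proof.
move=> [P [r Pf]] [Q [s Qh]].
pose D : {mpoly k[n * n]} := \det (vec_mx (\row_l 'X_l)).
have DE (g : G) : D.@[fun l => mxvec (GL_mx g) 0 l] = \det (GL_mx g).
  rewrite /D -det_map_mx; congr (\det _); apply/matrixP => i j.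
  by rewrite !mxE; apply: etrans (mevalXU _ _) (mxvecE _ _ _).
exists (a *: P * D ^+ s + Q * D ^+ r), (r + s)%N => g.
have dg : \det (GL_mx g) != 0 by rewrite -unitfE; apply: GL_unit.
have drN m : \det (GL_mx g) ^+ m != 0 by rewrite expf_neq0.
rewrite Pf Qh mevalD !mevalM mevalZ !rmorphXn /= !DE exprD mulrDl.
congr (_ + _); last by rewrite (mulrC (_ ^+ r) (_ ^+ s)) -mulf_div divff // mulr1.
by rewrite -mulf_div divff // mulr1 mulrA.
Qed.

Lemma regular_left_translate (h : G) (f : G -> k) :
  regular f -> regular (fun g => f (h * g)%g).
Proof.
move=> [P [r Pf]].
pose X : 'M[{mpoly k[n * n]}]_n := vec_mx (\row_l 'X_l).
pose S := mxvec (map_mx (mpolyC (n * n) (R := k)) (GL_mx h) *m X).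
exists ((\det (GL_mx h))^- r *: (P \mPo [tuple S 0 l | l < n * n])), r => g.
rewrite Pf mevalZ comp_mpoly_meval GL_mxM det_mulmx exprMn invfM.
rewrite mulrCA !mulrA; congr (_ * _ * _).
apply: meval_eq => l; rewrite tnth_mktuple /S.
case/mxvec_indexP: l => i j; rewrite !mxvecE !mxE raddf_sum /=.
by apply: eq_bigr => q _; rewrite !mxE mevalM mevalC mevalXU mxvecE.
Qed.

Lemma nabla_setP lambda (a : k) (f h : left_regular) :
  nabla_set lambda f -> nabla_set lambda h -> nabla_set lambda (a *: f + h).
Proof.
move=> [rf Bf] [rh Bh]; split; first exact: regularP.
by move=> g b Bb; rewrite !fctE Bf // Bh // mulrDr [a *: _]mulrCA.
Qed.

Lemma nabla_setG lambda (g : G) (f : left_regular) :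
  nabla_set lambda f -> nabla_set lambda (gact g f).
Proof.
move=> [rf Bf]; split; first exact: regular_left_translate.
by move=> x b Bb; rewrite /= /fun_act mulgA; apply: Bf.
Qed.

Definition nabla (lambda : weight n) : gmodule k n :=
  gmodule_of_sub
    (Submodule (@nabla_set0 lambda) (@nabla_setP lambda) (@nabla_setG lambda)).

(* - w_0 lambda *)
Definition dual_weight (lambda : weight n) : weight n :=
  \row_i - lambda 0 (rev_ord i).

Definition weyl (lambda : weight n) : gmodule k n := dual (nabla (dual_weight lambda)).

End InducedAndWeylModules.

(* A partition as a weight, padded with zeros (parts beyond the n-th are lost). *)
Definition weight_of_partition (n : nat) (s : seq nat) : weight n :=
  \row_(i < n) (nth 0%N s i)%:Z.

Definition hook (p i : nat) : seq nat := (p - i)%N :: nseq i 1%N.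
Definition hook_weight (n p i : nat) : weight n := weight_of_partition n (hook p i).

(* Main.v *)
(** The Weyl module Delta(lambda^i) is the dual of the module V_i induced from
    the dual weight -w_0 lambda^i.  After right translation by w_0, V_i is
    spanned by the functions F(first column) * (minor of order i + 1 on the first
    columns) with F homogeneous of degree p - i - 1 < p; by polarization F may
    be taken to be a power of a linear form.  The Koszul (de Rham) differential
    D : V_i -> V_(i+1), l^q M_L |-> q l^(q-1) M_(l, L), is G-equivariant, being a
    combination of right translations.  Its kernel and its image are the
    submodules S_i and S_(i+1) generated by the highest weight vectors v_i and
    v_(i+1): exactness is checked one weight alpha at a time, since a contraction
    satisfies the homotopy identity with factor alpha_m, and if alpha_m = 0 in k
    for every m then alpha is p times a unit vector.  So Delta(lambda^i) is
    filtered by the annihilator of v_i, and each factor embeds into functions on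
    G by phi |-> (g |-> phi (g w)), with w = v_i, respectively w a preimage of
    v_(i+1) under D; the image is the span of the functions
    g |-> v_j (g^-1 x), which is simple of highest weight lambda^j because the
    torus projects every element onto the highest weight line.  In the last
    module of the complex, S_i is all of V_i. *)

Require Import Defs.
From HB Require Import structures.
From mathcomp Require Import all_boot all_order all_algebra fingroup perm.
From mathcomp Require Import mpoly ring zify.
From mathcomp Require Import boolp classical_sets functions cardinality.

Set Implicit Arguments.
Unset Strict Implicit.
Unset Printing Implicit Defensive.

Import Order.TTheory GRing.Theory Num.Theory.
Local Open Scope ring_scope.

(** * Torus weights and polynomial functions *)

(** Most of the work lies in showing that the induced modules are spanned by bideterminants: an
    element is given only as a regular function with an equivariance, and its shape has to be
    recovered from functional equations. For a weight vector, the torus normalizes a nowhere zero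
    first column to ones; upper column operations then clear the rest of one row [m], and what
    remains is a function of an [N] by [N] matrix, semi-invariant for the fundamental weight of
    order [i]. Rank one computations together with the LU decomposition show that it is a
    combination of minors. Undoing the normalization multiplies these by Laurent monomials in the
    first column, and regularity along curves excludes negative exponents. No dimension or character
    is ever computed. Instead, two-variable functions such as [v (g^-1 x)] have finite rank, which
    yields rationality and turns the functionals that occur into combinations of point
    evaluations. *)

Definition unbounded (T : eqType) := forall s : seq T, exists x, x \notin s.

Lemma unbounded_infinite (T : choiceType) :
  infinite_set [set: T]%classic -> unbounded T.
Proof.
move=> infT s; apply: contrapT => nex; apply: infT.
apply: (@sub_finite_set _ _ [set` s]%classic); last exact: finite_seq.
by move=> x _ /=; apply/negPn/negP => xNs; apply: nex; exists x.
Qed.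

Lemma unbounded_uniq (T : eqType) m :
  unbounded T -> exists s : seq T, uniq s /\ size s = m.
Proof.
move=> infT; elim: m => [|m [s [us <-]]]; first by exists [::].
by have [x xs] := infT s; exists (x :: s); rewrite /= xs us.
Qed.

Lemma unbounded_int : unbounded int.
Proof.
move=> s; exists (\sum_(x <- s) `|x| + 1); apply/negP => /seq_tnthP[i].
move=> e; have: (tnth (in_tuple s) i <= \sum_(x <- s) `|x|).
  rewrite (big_tnth _ _ s) (bigD1 i) //= (le_trans (ler_norm _)) // lerDl.
  exact: sumr_ge0.
by rewrite -e gerDl.
Qed.

Lemma exists_nonroot (R : idomainType) (P : {poly R}) :
  unbounded R -> P != 0 -> exists x, P.[x] != 0.
Proof.
move=> infR Pn0; have [s [us ss]] := unbounded_uniq (size P) infR.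
have: ~~ all (root P) s.
  by apply/negP => rs; have := max_poly_roots Pn0 rs us; rewrite ss ltnn.
by case/allPn => x _ rx; exists x.
Qed.

Lemma poly_eq_generic (R : idomainType) (C P Q : {poly R}) :
  unbounded R -> C != 0 -> (forall x, C.[x] != 0 -> P.[x] = Q.[x]) -> P = Q.
Proof.
move=> infR Cn0 PQ; apply/eqP; rewrite -subr_eq0; apply: contraT => Dn0.
have /(exists_nonroot infR)[x] : (P - Q) * C != 0 by rewrite mulf_neq0.
rewrite hornerM mulf_eq0 negb_or => /andP[+ Cx].
by rewrite hornerD hornerN PQ // subrr eqxx.
Qed.

Section Torus.
Variables (k : fieldType) (n : nat).
Hypothesis kinf : unbounded k.
Local Notation G := (GL k n).
Local Notation weight := (weight n).

Lemma diag_unitmx (d : 'rV[k]_n) : (forall j, d 0 j != 0) -> diag_mx d \in unitmx.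
Proof.
by move=> dn0; rewrite unitmxE det_diag unitfE; apply/prodf_neq0 => j _.
Qed.

Definition torus_elt (d : 'rV[k]_n) (dn0 : forall j, d 0 j != 0) : G :=
  exist (fun x => x \in unitmx) _ (diag_unitmx dn0).

Lemma torus_eltP d dn0 : torus (@torus_elt d dn0).
Proof. exact: diag_mx_is_diag. Qed.

Lemma character_torus_elt d dn0 (a : weight) :
  character a (@torus_elt d dn0) = \prod_(j < n) d 0 j ^ a 0 j.
Proof. by apply: eq_bigr => j _; rewrite /= mxE eqxx mulr1n. Qed.

Lemma torusE (t : G) : torus t -> GL_mx t = diag_mx (\row_j GL_mx t j j).
Proof.
move/is_diag_mxP => td; apply/matrixP => a b; rewrite !mxE.
by have [->|ab] := eqVneq a b; rewrite ?mulr1n // mulr0n td.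
Qed.

Lemma torus_neq0 (t : G) j : torus t -> GL_mx t j j != 0.
Proof.
move=> tt; have := Defs.GL_unit t; rewrite {1}torusE // unitmxE det_diag unitfE.
by move/prodf_neq0/(_ j isT); rewrite mxE.
Qed.

Lemma torus_mulE (t g : G) a b : torus t ->
  GL_mx (t * g)%g a b = GL_mx t a a * GL_mx g a b.
Proof.
move=> tt; rewrite GL_mxM {1}torusE // mul_diag_mx mxE.
by rewrite !mxE.
Qed.

Lemma torusM (s t : G) : torus s -> torus t -> torus (s * t)%g.
Proof.
move=> ts tt; apply/is_diag_mxP => a b ab.
by rewrite torus_mulE // (is_diag_mxP tt) ?mulr0.
Qed.

Lemma torus1 : torus (1%g : G).
Proof. exact: scalar_mx_is_diag. Qed.

Lemma characterM (a : weight) (s t : G) : torus s -> torus t ->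
  character a (s * t)%g = character a s * character a t.
Proof.
move=> ts tt; rewrite -big_split /=; apply: eq_bigr => j _.
by rewrite torus_mulE // exprzMl // unitfE torus_neq0.
Qed.

Lemma character1 (a : weight) : character a (1%g : G) = 1.
Proof. by apply: big1 => j _; rewrite /= mxE eqxx exp1rz. Qed.

Lemma characterX (a : weight) (t : G) m : torus t ->
  torus (t ^+ m)%g /\ character a (t ^+ m)%g = character a t ^+ m.
Proof.
move=> tt; elim: m => [|m [IHt IH]].
  by rewrite expg0 expr0 character1; split=> //; apply: torus1.
by rewrite expgS exprS -IH; split; [apply: torusM | apply: characterM].
Qed.

Lemma expfz_prod (s : k) (F : 'I_n -> int) : s != 0 ->
  \prod_(j < n) s ^ F j = s ^ (\sum_(j < n) F j).
Proof.
move=> sn0; elim/big_rec2: _ => // j x y _ ->.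
by rewrite expfzDr.
Qed.

(* Kronecker substitution: t_j = s^(D^j), for generic D and then generic s. *)
Lemma character_separation (W : seq weight) :
  exists2 t : G, torus t & {in W &, injective (fun a => character a t)}.
Proof.
pose P : {poly int} := \prod_(u <- W) \prod_(v <- W | u != v) rVpoly (u - v).
have [||D PD] := @exists_nonroot _ P; first exact: unbounded_int.
  rewrite prodf_seq_neq0; apply/allP => u _; apply/implyP => _.
  rewrite prodf_seq_neq0; apply/allP => v _; apply/implyP => uv.
  apply: contra uv => /eqP /(congr1 (poly_rV (d := n))).
  by rewrite rVpolyK raddf0 => /eqP; rewrite subr_eq0.
pose c (u : weight) := (rVpoly u).[D].
have cI : {in W &, injective c}.
  move=> u v uW vW cuv; apply/eqP; apply: contraTT PD => uv.
  rewrite negbK horner_prod (big_rem u) //= horner_prod.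
  by rewrite (big_rem v) //= uv raddfB hornerD hornerN -/(c u) cuv subrr !mul0r.
pose Q : {poly k} := 'X * \prod_(u <- W) \prod_(v <- W | c u != c v)
   ('X^(`|c u - c v|%N) - 1).
have [||s Qs] := @exists_nonroot _ Q => //.
  rewrite mulf_neq0 ?polyX_eq0 // prodf_seq_neq0.
  apply/allP => u _; apply/implyP => _.
  rewrite prodf_seq_neq0; apply/allP => v _; apply/implyP => uv.
  by rewrite -size_poly_gt0 size_XnsubC // absz_gt0 subr_eq0.
move: Qs; rewrite hornerM hornerX mulf_eq0 negb_or => /andP[sn0 Qs].
have dn0 j : (\row_(j < n) s ^ (D ^+ j)) 0 j != 0 by rewrite mxE expfz_neq0.
exists (torus_elt dn0); first exact: torus_eltP.
have cE u : character u (torus_elt dn0) = s ^ c u.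
  rewrite character_torus_elt /c horner_poly -expfz_prod //.
  by apply: eq_bigr => j _; rewrite mxE valK mulrC -exprz_exp.
move=> u v uW vW; rewrite !cE => suv; apply: cI => //; apply/eqP.
apply: contraTT Qs => uv; rewrite negbK horner_prod (big_rem u) //= horner_prod.
rewrite (big_rem v) //= uv hornerD hornerN hornerXn hornerE.
suff -> : s ^+ `|c u - c v| = 1 by rewrite subrr !mul0r.
have h : s ^ (c u - c v) = 1 by rewrite expfzDr // -invr_expz suv divff ?expfz_neq0.
by move: h; case: (intP (c u - c v)) => [|m|m] //; rewrite ?abszN ?exprnN -?invr_expz // => /eqP; rewrite invr_eq1 => /eqP.
Qed.

(** Lagrange interpolation at the values of the characters on a separating [t]: a character sends
    [t ^+ l] to an [l]-th power, so the coefficients of the interpolation polynomial become scalars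
    attached to the powers of [t]. *)
Lemma weight_projector (W : seq weight) (a0 : weight) : a0 \in W ->
  exists m (c : 'I_m -> k) (t : 'I_m -> G), (forall l, torus (t l)) /\
    {in W, forall a, \sum_(l < m) c l * character a (t l) = (a == a0)%:R}.
Proof.
move=> a0W; have [t tt tI] := character_separation W.
pose L := \prod_(b <- W | b != a0)
  ((character a0 t - character b t)^-1 *: ('X - (character b t)%:P)).
exists (size L), (fun l => L`_l), (fun l => (t ^+ l)%g); split.
  by move=> l; have [] := characterX 0 l tt.
move=> a aW; transitivity L.[character a t].
  by rewrite horner_coef; apply: eq_bigr => l _; rewrite (characterX a l tt).2.
rewrite horner_prod; have [->|aa0] := eqVneq a a0.
  rewrite big_seq_cond big1 // => b /andP[bW ba0].
  rewrite hornerZ hornerXsubC mulVf // subr_eq0; apply: contra ba0 => /eqP e.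
  by apply/eqP/esym/tI.
by rewrite (big_rem a) //= aa0 hornerZ hornerXsubC subrr mulr0 mul0r.
Qed.

End Torus.

(** * Polynomial and regular functions, their restriction to curves, and density arguments *)

Section PolynomialFunctions.
Variables (k : fieldType) (n : nat).
Hypothesis kinf : unbounded k.
Local Notation G := (GL k n).

Definition polynomial_fun (F : 'M[k]_n -> k) : Prop :=
  exists P : {mpoly k[n * n]}, forall X, F X = P.@[fun l => mxvec X 0 l].

Lemma polynomial_const c : polynomial_fun (fun=> c).
Proof. by exists c%:MP => X; rewrite mevalC. Qed.

Lemma polynomial_entry a b : polynomial_fun (fun X => X a b).
Proof. by exists 'X_(mxvec_index a b) => X; rewrite mevalXU mxvecE. Qed.

Lemma polynomialD F H :
  polynomial_fun F -> polynomial_fun H -> polynomial_fun (fun X => F X + H X).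
Proof. by move=> [P FP] [Q HQ]; exists (P + Q) => X; rewrite mevalD FP HQ. Qed.

Lemma polynomialM F H :
  polynomial_fun F -> polynomial_fun H -> polynomial_fun (fun X => F X * H X).
Proof. by move=> [P FP] [Q HQ]; exists (P * Q) => X; rewrite mevalM FP HQ. Qed.

Lemma polynomialX F m : polynomial_fun F -> polynomial_fun (fun X => F X ^+ m).
Proof. by move=> [P FP]; exists (P ^+ m) => X; rewrite rmorphXn /= FP. Qed.

Lemma polynomial_sum (I : Type) (r : seq I) (p : pred I) F :
  (forall i, polynomial_fun (F i)) ->
  polynomial_fun (fun X => \sum_(i <- r | p i) F i X).
Proof.
move=> pF; elim: r => [|i r [P rP]].
  by exists 0 => X; rewrite big_nil meval0.
have [Q iQ] := pF i; case pi: (p i); last first.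
  by exists P => X; rewrite big_cons pi.
by exists (Q + P) => X; rewrite big_cons pi mevalD -rP -iQ.
Qed.

Lemma polynomial_prod (I : Type) (r : seq I) (p : pred I) F :
  (forall i, polynomial_fun (F i)) ->
  polynomial_fun (fun X => \prod_(i <- r | p i) F i X).
Proof.
move=> pF; elim: r => [|i r [P rP]].
  by exists 1 => X; rewrite big_nil meval1.
have [Q iQ] := pF i; case pi: (p i); last first.
  by exists P => X; rewrite big_cons pi.
by exists (Q * P) => X; rewrite big_cons pi mevalM -rP -iQ.
Qed.

Lemma polynomial_det m (A : 'M[k]_n -> 'M[k]_m) :
  (forall a b, polynomial_fun (fun X => A X a b)) -> polynomial_fun (fun X => \det (A X)).
Proof.
move=> pA; apply: polynomial_sum => s.
apply: polynomialM; first exact: polynomial_const.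
exact: polynomial_prod.
Qed.

Lemma polynomial_meval m (P : {mpoly k[m]}) (v : 'M[k]_n -> 'I_m -> k) :
  (forall a, polynomial_fun (fun X => v X a)) -> polynomial_fun (fun X => P.@[v X]).
Proof.
move=> pv; have [|Q QE] := @polynomial_sum _ (msupp P) xpredT
    (fun m0 X => P@_m0 * \prod_(i < m) v X i ^+ m0 i).
  move=> m0; apply: polynomialM; first exact: polynomial_const.
  by apply: polynomial_prod => i; apply: polynomialX.
by exists Q => X; rewrite -QE mevalE.
Qed.

Lemma polynomial_mulr (A : 'M[k]_n) F :
  polynomial_fun F -> polynomial_fun (fun X => F (X *m A)).
Proof.
move=> [P FP]; have [|Q QE] := @polynomial_meval _ P (fun X l => mxvec (X *m A) 0 l).
  case/mxvec_indexP => a b.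
  have [|Q QE] := @polynomial_sum _ (index_enum 'I_n) xpredT
      (fun j X => X a j * A j b).
    move=> j; apply: polynomialM; [exact: polynomial_entry|exact: polynomial_const].
  by exists Q => X; rewrite -QE mxvecE mxE.
by exists Q => X; rewrite FP QE.
Qed.

Definition horner_mx_at m1 m2 (X : 'M[{poly k}]_(m1, m2)) (t : k) : 'M[k]_(m1, m2) :=
  map_mx (horner^~ t) X.

Lemma polynomial_curve F (X : 'M[{poly k}]_n) : polynomial_fun F ->
  exists Q : {poly k}, forall t, F (horner_mx_at X t) = Q.[t].
Proof.
move=> [P FP]; exists (\sum_(m <- msupp P) P@_m *: \prod_i mxvec X 0 i ^+ m i) => t.
rewrite FP mevalE horner_sum; apply: eq_bigr => m _.
rewrite hornerZ horner_prod; congr (_ * _); apply: eq_bigr => l _.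
by rewrite horner_exp; case/mxvec_indexP: l => a b; rewrite !mxvecE mxE.
Qed.

Lemma regularE (f : G -> k) : regular f <->
  exists F e, polynomial_fun F /\ forall g, f g = F (GL_mx g) / \det (GL_mx g) ^+ e.
Proof.
split=> [[P [e fP]]|[F [e [[P FP] fF]]]].
  exists (fun X => P.@[fun l => mxvec X 0 l]), e; split=> //.
  by exists P.
by exists P, e => g; rewrite fF FP.
Qed.

Lemma regular_polynomial F : polynomial_fun F -> regular (fun g : G => F (GL_mx g)).
Proof.
by move=> pF; apply/regularE; exists F, 0%N; split=> // g; rewrite expr0 divr1.
Qed.

Lemma regular_right_translate (h : G) (f : G -> k) :
  regular f -> regular (fun g => f (g * h)%g).
Proof.
move=> /regularE[F [e [pF fF]]]; apply/regularE.
exists (fun X => F (X *m GL_mx h) * (\det (GL_mx h) ^+ e)^-1), e; split.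
  apply: polynomialM; [exact: polynomial_mulr|exact: polynomial_const].
by move=> g; rewrite fF GL_mxM det_mulmx exprMn invfM mulrA mulrAC.
Qed.

Lemma regular0 : regular (fun _ : G => 0 : k).
Proof. exact: (regular_polynomial (polynomial_const 0)). Qed.

Lemma regular_sum (I : Type) (r : seq I) (c : I -> k) (f : I -> G -> k) :
  (forall i, regular (f i)) -> regular (fun g => \sum_(i <- r) c i * f i g).
Proof.
move=> rf; elim: r => [|i r IH].
  suff -> : (fun g => \sum_(i <- [::]) c i * f i g) = fun _ : G => 0 by exact: regular0.
  by apply/funext => g; rewrite big_nil.
suff -> : (fun g => \sum_(j <- i :: r) c j * f j g) =
   fun g : G => c i * f i g + \sum_(j <- r) c j * f j g.
  exact: (regularP (c i) (rf i) IH).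
by apply/funext => g; rewrite big_cons.
Qed.

Lemma regular_curve (f : G -> k) (X : 'M[{poly k}]_n) : regular f ->
  exists (Q : {poly k}) e, forall t g, GL_mx g = horner_mx_at X t ->
    f g * \det (GL_mx g) ^+ e = Q.[t].
Proof.
move=> /regularE[F [e [pF fF]]]; have [Q QE] := polynomial_curve X pF.
exists Q, e => t g gE; rewrite fF -QE gE mulfVK // -gE expf_neq0 //.
by rewrite -unitfE -unitmxE Defs.GL_unit.
Qed.

(** When the determinant is constant along the curve, the denominator of [f] is a scalar and can be
    absorbed into the polynomial. *)
Lemma regular_curve1 (f : G -> k) (X : 'M[{poly k}]_n) c : regular f ->
  c != 0 -> (forall t, \det (horner_mx_at X t) = c) ->
  exists Q : {poly k}, forall t g, GL_mx g = horner_mx_at X t -> f g = Q.[t].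
Proof.
move=> rf cn0 dc; have [Q [e QE]] := regular_curve X rf.
exists (c ^- e *: Q) => t g gE; rewrite hornerZ -(QE t g gE) gE dc.
by rewrite mulrC mulfK // expf_neq0.
Qed.

Definition line (A B : 'M[k]_n) : 'M[{poly k}]_n :=
  \matrix_(i, j) ((A i j)%:P + B i j *: 'X).

Lemma lineE A B t : horner_mx_at (line A B) t = A + t *: B.
Proof.
by apply/matrixP => i j; rewrite !mxE hornerD hornerC hornerZ hornerX mulrC.
Qed.

Lemma det_horner (X : 'M[{poly k}]_n) t : \det (horner_mx_at X t) = (\det X).[t].
Proof. by rewrite -[RHS]/(horner_eval t _) -det_map_mx; congr (\det _). Qed.

(** Density of the invertible matrices: [X + t] is invertible unless [t] is a root of the
    characteristic polynomial of [- X], which is nonzero, and the field is infinite. *)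
Lemma polynomial_eq0_GL F : polynomial_fun F ->
  (forall g : G, F (GL_mx g) = 0) -> forall X, F X = 0.
Proof.
move=> pF F0 X; have [Q QE] := polynomial_curve (line X 1%:M) pF.
suff Q0 : Q = 0 by rewrite -[X]addr0 -(scale0r 1%:M) -lineE QE Q0 horner0.
pose C := char_poly (- X).
have CE t : \det (X + t *: 1%:M) = C.[t].
  rewrite /C /char_poly -det_horner; congr (\det _); apply/matrixP => i j.
  by rewrite !mxE hornerD hornerN hornerMn hornerX hornerC opprK addrC mulr_natr.
apply: (@poly_eq_generic _ C) => //; first exact/monic_neq0/char_poly_monic.
move=> t Ct; rewrite -QE horner0 lineE.
have uX : X + t *: 1%:M \in unitmx by rewrite unitmxE unitfE CE.
exact: (F0 (exist (fun x => x \in unitmx) _ uX)).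
Qed.

(* Density of the open set cut out by the non-vanishing of the first column. *)
Lemma regular_eq0_generic (f : G -> k) (B : 'M[k]_n) (C : G -> {poly k}) :
  regular f -> (forall g, C g != 0) ->
  (forall g h t, (C g).[t] != 0 -> GL_mx h = GL_mx g + t *: B -> f h = 0) ->
  forall g, f g = 0.
Proof.
move=> rf Cn0 f0 g; have [Q [e QE]] := regular_curve (line (GL_mx g) B) rf.
suff Q0 : Q = 0.
  have := QE 0 g; rewrite lineE scale0r addr0 Q0 horner0 => /(_ erefl)/eqP.
  rewrite mulf_eq0 expf_eq0 => /orP[/eqP //|/andP[_ /eqP d0]].
  by have := Defs.GL_unit g; rewrite unitmxE unitfE d0 eqxx.
pose D := \det (line (GL_mx g) B).
have DE t : \det (GL_mx g + t *: B) = D.[t] by rewrite -lineE det_horner.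
have Dn0 : D != 0.
  apply/eqP => D0; have := DE 0; rewrite scale0r addr0 D0 horner0 => d0.
  by have := Defs.GL_unit g; rewrite unitmxE unitfE d0 eqxx.
apply: (@poly_eq_generic _ (D * C g)) => //; first by rewrite mulf_neq0.
move=> t; rewrite hornerM mulf_eq0 negb_or -DE -unitfE -unitmxE => /andP[u Ct].
by rewrite -(QE t (exist (fun x => x \in unitmx) _ u)) ?lineE // (f0 g _ t) // mul0r horner0.
Qed.

End PolynomialFunctions.

(** * Decomposition of regular functions under left translation by the torus *)

Section WeightDecomposition.
Variables (k : fieldType) (n : nat).
Hypothesis kinf : unbounded k.
Local Notation G := (GL k n).
Local Notation weight := (weight n).

(** A monomial in the matrix entries divided by [\det ^+ e] is a weight vector for left torus
    translation: its weight consists of the row sums of the exponents, each lowered by [e]. *)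
Lemma torus_expansion (f : G -> k) : regular f ->
  exists (r : seq weight) (phi : nat -> G -> k),
  forall t g, torus t ->
    f (t * g)%g = \sum_(l < size r) character r`_l t * phi l g.
Proof.
move=> [P [e fP]].
pose w (m : 'X_{1..n * n}) : weight :=
  \row_a ((\sum_b m (mxvec_index a b))%N%:Z - e%:Z).
pose phi (m : 'X_{1..n * n}) (g : G) :=
  P@_m * (\prod_l mxvec (GL_mx g) 0 l ^+ m l) / \det (GL_mx g) ^+ e.
exists (map w (msupp P)), (fun l => phi (nth 0%MM (msupp P) l)) => t g tt.
rewrite size_map.
transitivity (\sum_(m <- msupp P) character (w m) t * phi m g); last first.
  rewrite (big_nth 0%MM) big_mkord; apply: eq_bigr => l _.
  by rewrite (nth_map 0%MM).
rewrite fP mevalE mulr_suml; apply: eq_bigr => m _.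
have dt : \det (GL_mx t) = \prod_a GL_mx t a a.
  by rewrite {1}torusE // det_diag; apply: eq_bigr => a _; rewrite mxE.
have -> : character (w m) t =
   (\prod_a \prod_b GL_mx t a a ^+ m (mxvec_index a b)) / \det (GL_mx t) ^+ e.
  rewrite dt -prodrXl -prodfV -big_split /=; apply: eq_bigr => a _.
  rewrite mxE expfzDr ?torus_neq0 // -exprnP -invr_expz -exprnP; congr (_ / _).
  by rewrite prodrXr.
have -> : \prod_l mxvec (GL_mx (t * g)%g) 0 l ^+ m l =
    (\prod_a \prod_b GL_mx t a a ^+ m (mxvec_index a b)) *
    (\prod_l mxvec (GL_mx g) 0 l ^+ m l).
  rewrite pair_bigA /=.
  rewrite !(reindex _ (curry_mxvec_bij n n)) /= -big_split /=.
  apply: eq_bigr => -[a b] _ /=.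
  by rewrite !mxvecE torus_mulE // exprMn.
rewrite GL_mxM det_mulmx exprMn invfM /phi.
set x := \prod_a _; set y := \prod_l _; set d1 := _^-1; set d2 := _^-1.
by clearbody x y d1 d2; ring.
Qed.

(** Records how a weight component is produced, so that it inherits from [f] every linear condition
    stable under left translation, in particular membership in an induced module and the vanishing
    of a right translation operator. *)
Definition torus_comb (f h : G -> k) :=
  exists m (c : 'I_m -> k) (t : 'I_m -> G), (forall l, torus (t l)) /\
    forall g, h g = \sum_(l < m) c l * f (t l * g)%g.

Lemma weight_decomposition (f : G -> k) : regular f ->
  exists (W : seq weight) (fam : weight -> G -> k),
  [/\ uniq W, {in W, forall a, torus_comb f (fam a)},
    {in W, forall a t g, torus t -> fam a (t * g)%g = character a t * fam a g}
    & forall g, f g = \sum_(a <- W) fam a g].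
Proof.
move=> rf; have [r [phi fE]] := torus_expansion rf.
pose fam a g := \sum_(l < size r | r`_l == a) phi l g.
have inW (l : 'I_(size r)) : r`_l \in undup r by rewrite mem_undup mem_nth.
(* The projector is applied after an arbitrary torus translation [s]: the case [s = 1] exhibits the
   component as a torus combination, and comparison with general [s] shows that it has weight
   [a]. *)
have key a : a \in undup r ->
    exists m (c : 'I_m -> k) (t : 'I_m -> G), (forall l, torus (t l)) /\
    forall s g, torus s ->
    \sum_(l < m) c l * f (t l * (s * g))%g = character a s * fam a g.
  move=> aW; have [m [c [t [tt pt]]]] := weight_projector kinf aW.
  exists m, c, t; split=> // s g ts.
  under eq_bigr => l _.
    rewrite mulgA fE; last exact: torusM.
    rewrite mulr_sumr; under eq_bigr => j _ do rewrite characterM // mulrA -mulrA.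
    over.
  rewrite exchange_big /= /fam mulr_sumr [RHS]big_mkcond /=.
  apply: eq_bigr => j _; rewrite -[LHS]/(\sum_(l < m) _).
  under eq_bigr => l _ do rewrite mulrA.
  rewrite -mulr_suml; under eq_bigr => l _ do rewrite mulrA.
  rewrite -mulr_suml pt //; case: eqVneq => [->|_]; first by rewrite mul1r.
  by rewrite !mul0r.
exists (undup r), fam; split; first exact: undup_uniq.
- move=> a /key[m [c [t [tt h]]]]; exists m, c, t; split=> // g.
  by have := h 1%g g (torus1 _ _); rewrite character1 mul1r mul1g.
- move=> a /key[m [c [t [tt h]]]] s g ts; rewrite -h //.
  have := h 1%g (s * g)%g (torus1 _ _); rewrite character1 mul1r mul1g.
  by move=> <-.
- move=> g; rewrite -{1}[g]mul1g fE; last exact: torus1.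
  under [RHS]eq_bigr => a _ do rewrite /fam big_mkcond.
  rewrite exchange_big; apply: eq_bigr => l _ /=.
  rewrite (bigD1_seq r`_l) ?undup_uniq //= eqxx big1 => [|a ar].
    by rewrite addr0 character1 mul1r.
  by rewrite eq_sym (negPf ar).
Qed.

End WeightDecomposition.

(** * Semi-invariants of the upper triangular group *)

Section ReciprocalPolynomials.
Variable k : fieldType.
Hypothesis kinf : unbounded k.

(** Multiplying by [t ^+ d] turns the relation into an identity of polynomials, with [R] the
    reversal of [Q]. The choice [d = (size Q).+1] is positive, so [e <= a.+1] gives [e <= a + d];
    for [e] equal to 0 or 1, the two uses, every [a] is allowed. *)
Lemma reciprocal_coef (P Q : {poly k}) c e a : (e <= a.+1)%N ->
  (forall t, t != 0 -> P.[t] = c * t ^+ e * Q.[t^-1]) ->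
  P`_a = if (a <= e)%N then c * Q`_(e - a) else 0.
Proof.
move=> ea PQ; pose d := (size Q).+1.
pose R := \poly_(b < d.+1) Q`_(d - b).
have RE t : t != 0 -> R.[t] = t ^+ d * Q.[t^-1].
  move=> tn0; rewrite horner_poly (@horner_coef_wide _ d.+1 Q); last by rewrite !leqW.
  rewrite mulr_sumr (reindex_inj rev_ord_inj) /=; apply: eq_bigr => i _.
  have id : (i <= d)%N by rewrite -ltnS.
  rewrite subSS subKn // exprVn mulrCA; congr (_ * _).
  have -> : t ^+ d = t ^+ (d - i) * t ^+ i by rewrite -exprD subnK.
  by rewrite mulfK ?expf_neq0.
have : P * 'X^d = c *: 'X^e * R.
  apply: (@poly_eq_generic _ 'X) => //; first by rewrite polyX_eq0.
  move=> t; rewrite hornerX => tn0.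
  by rewrite !hornerM hornerZ !hornerXn RE // PQ //; ring.
move/(congr1 (fun p : {poly k} => p`_(a + d))).
rewrite coefMXn ltnNge leq_addl /= addnK -scalerAl coefZ coefXnM => ->.
have -> : (a + d < e)%N = false by lia.
rewrite coef_poly; case: (leqP a e) => ae; last first.
  by rewrite ifN ?mulr0 // -leqNgt; clear -ae; lia.
rewrite ifT; last by lia.
by congr (_ * Q`_ _); lia.
Qed.

Lemma reciprocal_horner0 (P Q : {poly k}) c :
  (forall t, t != 0 -> P.[t] = c * Q.[t^-1]) -> forall t, P.[t] = c * Q.[0].
Proof.
move=> PQ t; suff -> : P = (c * Q.[0])%:P by rewrite hornerC.
apply/polyP => a; rewrite (@reciprocal_coef P Q c 0) // => [|s /PQ ->].
  by rewrite coefC leqn0; case: eqP => // ->; rewrite horner_coef0.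
by rewrite mulr1.
Qed.

Lemma reciprocal_horner1 (P Q : {poly k}) c :
  (forall t, t != 0 -> P.[t] = c * t * Q.[t^-1]) ->
  forall t, P.[t] = P.[0] + t * (c * Q.[0]).
Proof.
move=> PQ t; suff -> : P = P.[0]%:P + (c * Q.[0]) *: 'X.
  by rewrite !(hornerD, hornerC, hornerZ, hornerX) mulr0 addr0 mulrC.
apply/polyP => -[|a]; rewrite coefD coefC coefZ coefX /= ?mulr0 ?addr0 -?horner_coef0 //.
rewrite (@reciprocal_coef P Q c 1) // add0r.
by case: a => [|a] /=; rewrite ?mulr1 ?mulr0 // horner_coef0.
Qed.

End ReciprocalPolynomials.

Section ColumnOperations.
Variables (k : fieldType) (n : nat).
Hypothesis kinf : unbounded k.
Implicit Types (A B X : 'M[k]_n) (h : 'M[k]_n -> k) (i j : 'I_n).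

Definition col_add (i j : 'I_n) (t : k) : 'M[k]_n := 1%:M + t *: delta_mx j i.

Lemma mul_col_add m (A : 'M[k]_(m, n)) i j t r c :
  (A *m col_add i j t) r c = A r c + t * A r j *+ (c == i).
Proof.
rewrite mulmxDr mulmx1 -scalemxAr !mxE (bigD1 j) //= mxE eqxx /=.
rewrite big1 => [|l lj]; last by rewrite mxE (negPf lj) mulr0.
by rewrite addr0 mulr_natr mulrnAr.
Qed.

Lemma det_col_add i j t : i != j -> \det (col_add i j t) = 1.
Proof.
move=> ij; have d1 a : col_add i j t a a = 1.
  rewrite !mxE eqxx; case: eqP => [->|_] /=; last by rewrite mulr0 addr0.
  by rewrite eq_sym (negPf ij) mulr0 addr0.
have [lt_ij|ge_ij] := ltnP i j.
  rewrite det_trig; first by apply: big1.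
  apply/is_trig_mxP => a b ab; rewrite !mxE -!val_eqE /= (ltn_eqF ab) add0r.
  by do 2![case: eqP => ?] => /=; rewrite ?mulr0 //; lia.
have {}ge_ij : (j < i)%N by rewrite ltn_neqAle ge_ij eq_sym andbT.
rewrite -det_tr det_trig; first by apply: big1 => a _; rewrite mxE.
apply/is_trig_mxP => a b ab; rewrite !mxE -!val_eqE /= (gtn_eqF ab) add0r.
by do 2![case: eqP => ?] => /=; rewrite ?mulr0 //; lia.
Qed.

Lemma col_add_unit i j t : i != j -> col_add i j t \in unitmx.
Proof. by move=> ij; rewrite unitmxE det_col_add // unitr1. Qed.

Lemma perm_col_add (s : 'S_n) i j t :
  col_add i j t *m perm_mx s = perm_mx s *m col_add (s i) (s j) t.
Proof.
rewrite mulmxDl mulmxDr mul1mx mulmx1 -scalemxAl -scalemxAr; congr (_ + _ *: _).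
apply/matrixP => a b; rewrite -row_permE -{1}[s]invgK -col_permE !mxE.
by rewrite (inj_eq perm_inj) (canF_eq (permKV s)).
Qed.

(** Only invertible matrices are constrained, and of regularity only polynomiality along
    one-parameter lower triangular column additions is kept; this is all that the rank one arguments
    consume. *)
Record semi_invariant (lam : 'I_n -> nat) h : Prop := SemiInvariant {
  upper_semi_invariant : forall A b, A \in unitmx -> b \in unitmx ->
    is_trig_mx b^T -> h (A *m b) = \prod_j b j j ^+ lam j * h A;
  col_add_poly : forall A (i j : 'I_n), A \in unitmx -> (i < j)%N ->
    exists Q : {poly k}, forall t, h (A *m col_add i j t) = Q.[t] }.

Lemma semi_invariantB lam h1 h2 c : semi_invariant lam h1 -> semi_invariant lam h2 ->
  semi_invariant lam (fun A => h1 A - c * h2 A).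
Proof.
move=> [u1 p1] [u2 p2]; split=> [A b uA ub tb|A i j uA ij].
  by rewrite u1 // u2 //; ring.
have [Q1 Q1E] := p1 A i j uA ij; have [Q2 Q2E] := p2 A i j uA ij.
by exists (Q1 - c *: Q2) => t; rewrite Q1E Q2E hornerD hornerN hornerZ.
Qed.

Lemma upper_unit_diag lam h A b : semi_invariant lam h -> A \in unitmx ->
  b \in unitmx -> is_trig_mx b^T -> (forall j, b j j = 1) -> h (A *m b) = h A.
Proof.
move=> [u _] uA ub tb b1; rewrite u // big1 ?mul1r // => j _.
by rewrite b1 expr1n.
Qed.

Lemma col_add_upper lam h A i j t : semi_invariant lam h -> A \in unitmx ->
  (j < i)%N -> h (A *m col_add i j t) = h A.
Proof.
move=> sh uA ji; have ij : i != j by rewrite neq_ltn ji orbT.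
apply: (upper_unit_diag sh) => //; first exact: col_add_unit.
  apply/is_trig_mxP => a b ab; rewrite !mxE -!val_eqE /= (gtn_eqF ab) add0r.
  by do 2![case: eqP => ?] => /=; rewrite ?mulr0 //; lia.
move=> a; rewrite !mxE eqxx; case: eqP => [->|_] /=; last by rewrite mulr0 addr0.
by rewrite eq_sym (negPf ij) mulr0 addr0.
Qed.

(* In GL_2: (1 0; t 1)(1 -1/t; 0 1) = (0 1; 1 0)(1 0; 1/t 1)diag(t, -1/t). *)
Lemma col_add_swap i j t : i != j -> t != 0 ->
  col_add i j t *m col_add j i (- t^-1) =
  tperm_mx i j *m col_add i j t^-1 *m
    diag_mx (\row_c (if c == i then t else if c == j then - t^-1 else 1)).
Proof.
move=> ij tn0; apply/matrixP => r c; rewrite mul_col_add mul_mx_diag mxE mul_col_add.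
rewrite /tperm_mx !mxE !eqxx.
have ji : j != i by rewrite eq_sym.
have tD : r != i -> r != j -> tperm i j r = r by move=> *; rewrite tpermD // eq_sym.
case: (eqVneq c i) => [->|ci]; last case: (eqVneq c j) => [->|cj].
- case: (eqVneq r i) => [->|ri]; last case: (eqVneq r j) => [->|rj].
  + by rewrite tpermL ?eqxx ?(negPf ij) ?(negPf ji) /=; field.
  + by rewrite tpermR ?eqxx ?(negPf ij) ?(negPf ji) /=; field.
  by rewrite tD // ?(negPf ri) ?(negPf rj) ?(negPf ij) ?(negPf ji) /=; ring.
- case: (eqVneq r i) => [->|ri]; last case: (eqVneq r j) => [->|rj].
  + by rewrite tpermL ?eqxx ?(negPf ij) ?(negPf ji) /=; field.
  + by rewrite tpermR ?eqxx ?(negPf ij) ?(negPf ji) /=; field.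
  by rewrite tD // ?(negPf ri) ?(negPf rj) ?(negPf ij) ?(negPf ji) /=; ring.
rewrite !andbF !mulr0n !mulr0 !addr0 mulr1.
case: (eqVneq r i) => [->|ri]; last case: (eqVneq r j) => [->|rj].
- by rewrite tpermL ![_ == c]eq_sym (negPf ci) (negPf cj).
- by rewrite tpermR ![_ == c]eq_sym (negPf ci) (negPf cj).
by rewrite tD.
Qed.

Lemma tperm_mx_unit (i j : 'I_n) : tperm_mx i j \in @unitmx k n.
Proof. exact: unitmx_perm. Qed.

(** The upper unipotent factor in [col_add_swap] is invisible to [h], and the diagonal one acts
    through [lam]. Hence a polynomial in [t] is matched with a polynomial in [t^-1]. *)
Lemma col_add_reciprocal lam h A i j t :
  semi_invariant lam h -> A \in unitmx -> (i < j)%N -> t != 0 ->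
  h (A *m col_add i j t) = t ^+ lam i * (- t^-1) ^+ lam j *
    h (A *m tperm_mx i j *m col_add i j t^-1).
Proof.
move=> sh uA lt_ij tn0; have ij : i != j by rewrite neq_ltn lt_ij.
have uAi : A *m col_add i j t \in unitmx by rewrite unitmx_mul uA col_add_unit.
have uAt : A *m tperm_mx i j *m col_add i j t^-1 \in unitmx.
  by rewrite !unitmx_mul uA tperm_mx_unit col_add_unit.
rewrite -(@col_add_upper _ _ (A *m _) j i (- t^-1) sh uAi lt_ij).
rewrite -mulmxA col_add_swap // !mulmxA (upper_semi_invariant sh) //.
- congr (_ * _); rewrite (bigD1 i) //= (bigD1 j) 1?eq_sym //= !mxE !eqxx.
  rewrite eq_sym (negPf ij) !mulr1n big1 ?mulr1 // => c /andP[/negPf ci /negPf cj].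
  by rewrite !mxE ci cj eqxx expr1n.
- apply: diag_unitmx => c; rewrite mxE.
  by do 2!case: ifP => _ //; rewrite ?oppr_eq0 ?invr_eq0 ?oner_neq0.
- by rewrite tr_diag_mx diag_mx_is_trig.
Qed.

(** Rank one theory for the weight [(a, a)]: a polynomial in [t] equal to a polynomial in [t^-1] is
    constant, so the lower unipotent acts trivially and the swap by a sign. *)
Lemma col_add_same lam h A i j t : semi_invariant lam h -> A \in unitmx ->
  (i < j)%N -> lam i = lam j ->
  h (A *m col_add i j t) = h A /\ h (A *m tperm_mx i j) = (-1) ^+ lam j * h A.
Proof.
move=> sh uA lt_ij e.
have uAt : A *m tperm_mx i j \in unitmx by rewrite unitmx_mul uA tperm_mx_unit.
have [Q QE] := col_add_poly sh uA lt_ij; have [R RE] := col_add_poly sh uAt lt_ij.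
have QR s : s != 0 -> Q.[s] = (-1) ^+ lam j * R.[s^-1].
  move=> sn0; rewrite -QE (col_add_reciprocal sh) // RE e -exprMn mulrN.
  by rewrite divff.
have Qc := reciprocal_horner0 kinf QR.
have A0 B : B *m col_add i j 0 = B by rewrite /col_add scale0r addr0 mulmx1.
have := QE 0; have := RE 0; rewrite !A0 QE !Qc => -> ->; split=> //.
by rewrite signrMK.
Qed.

(** Rank one theory for the weight [(1, 0)], the natural module: the dependence on [t] is affine,
    and its slope is the value at the swapped matrix. *)
Lemma col_add_drop lam h A i j t : semi_invariant lam h -> A \in unitmx ->
  (i < j)%N -> lam i = 1%N -> lam j = 0%N ->
  h (A *m col_add i j t) = h A + t * h (A *m tperm_mx i j).
Proof.
move=> sh uA lt_ij li lj.
have uAt : A *m tperm_mx i j \in unitmx by rewrite unitmx_mul uA tperm_mx_unit.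
have [Q QE] := col_add_poly sh uA lt_ij; have [R RE] := col_add_poly sh uAt lt_ij.
have QR s : s != 0 -> Q.[s] = 1 * s * R.[s^-1].
  by move=> sn0; rewrite -QE (col_add_reciprocal sh) // RE li lj mulr1 mul1r.
have A0 B : B *m col_add i j 0 = B by rewrite /col_add scale0r addr0 mulmx1.
have := QE 0; have := RE 0; rewrite !A0 QE (reciprocal_horner1 kinf QR t) => -> ->.
by rewrite mul1r.
Qed.

End ColumnOperations.

Lemma perm_lower_upper (k : fieldType) n (A : 'M[k]_n) : A \in unitmx ->
  exists (u : 'S_n) L U, [/\ A = perm_mx u *m L *m U, is_trig_mx L,
    forall i, L i i = 1, is_trig_mx U^T & U \in unitmx].
Proof.
case: n A => [|n] A uA.
  exists 1%g, 1%:M, 1%:M; split;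
    by [apply/matrixP; case | apply/is_trig_mxP; case | case | exact: unitmx1].
have := cormen_lup_correct A; have := cormen_lup_perm A; have := @cormen_lup_lower _ _ A.
have := @cormen_lup_upper _ _ A.
case: (cormen_lup A) => [[P L] U] /= tU tL /is_perm_mxP[u ->] PA.
exists (u^-1)%g, L, U.
have AE : A = perm_mx u^-1 *m L *m U.
  by rewrite -mulmxA -[L *m U]/(L * U) -PA mulmxA -perm_mxM mulVg perm_mx1 mul1mx.
split=> //.
- apply/is_trig_mxP => i j ij; rewrite tL ?(ltnW ij) //.
  by rewrite -val_eqE (ltn_eqF ij).
- by move=> i; rewrite tL // eqxx.
- by apply/is_trig_mxP => i j ij; rewrite mxE tU.
by move: uA; rewrite AE !unitmx_mul => /andP[].
Qed.

(** * Minors on the first columns and the fundamental semi-invariants *)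

Section Minors.
Variables (k : fieldType) (n : nat).
Hypothesis kinf : unbounded k.
Implicit Types (A B X : 'M[k]_n) (h : 'M[k]_n -> k) (i j : 'I_n).

(** Rows enter through an arbitrary matrix [L], which keeps the family stable under left
    translation; [rowsub rho 1%:M] gives the ordinary minor on the rows [rho]. *)
Definition minor r (rn : (r <= n)%N) (L : 'M[k]_(r, n)) (X : 'M[k]_n) : k :=
  \det (colsub (widen_ord rn) (L *m X)).

Lemma polynomial_minor r (rn : (r <= n)%N) L : polynomial_fun (minor rn L).
Proof.
apply: polynomial_det => a b.
have [|P PE] := @polynomial_sum k n _ (index_enum 'I_n) xpredT
  (fun j X => L a j * X j (widen_ord rn b)).
  move=> j; apply: polynomialM; [exact: polynomial_const|exact: polynomial_entry].
by exists P => X; rewrite -PE !mxE.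
Qed.

Lemma minor_mull r (rn : (r <= n)%N) L A X : minor rn L (A *m X) = minor rn (L *m A) X.
Proof. by rewrite /minor mulmxA. Qed.

Lemma minor_upper r (rn : (r <= n)%N) L X (b : 'M[k]_n) : is_trig_mx b^T ->
  minor rn L (X *m b) = \prod_j b (widen_ord rn j) (widen_ord rn j) * minor rn L X.
Proof.
move=> /is_trig_mxP tb; pose w := widen_ord rn.
have b0 (i j : 'I_n) : (j < i)%N -> b i j = 0 by move/tb; rewrite mxE.
have -> : minor rn L (X *m b) = \det (colsub w (L *m X) *m mxsub w w b).
  congr (\det _); rewrite mulmxA; apply/matrixP => a c; rewrite !mxE.
  rewrite (bigID (fun j : 'I_n => (j < r)%N)) /= [X in _ + X]big1 => [|j]; last first.
    rewrite -leqNgt => rj; rewrite b0 ?mulr0 //=.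
    exact: leq_trans (ltn_ord c) rj.
  rewrite addr0 (big_ord_narrow rn); apply: eq_bigr => j _.
  by rewrite !mxE.
rewrite det_mulmx mulrC; congr (_ * _); rewrite -det_tr det_trig.
  by apply: eq_bigr => j _; rewrite !mxE.
by apply/is_trig_mxP => i j ij; rewrite !mxE b0.
Qed.

Definition first_ones s (j : 'I_n) : nat := (j < s)%N.

Lemma prod_first_ones s (sn : (s <= n)%N) (F : 'I_n -> k) :
  \prod_j F j ^+ first_ones s j = \prod_(j < s) F (widen_ord sn j).
Proof.
rewrite (bigID (fun j : 'I_n => (j < s)%N)) /= [X in _ * X]big1 => [|j /negPf js].
  rewrite mulr1 (big_ord_narrow sn); apply: eq_bigr => j _.
  by rewrite /first_ones /= ltn_ord.
by rewrite /first_ones js.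
Qed.

Lemma minor_semi_invariant s (sn : (s <= n)%N) L :
  semi_invariant (first_ones s) (minor sn L).
Proof.
split=> [A b _ _ tb|A i j _ _].
  by rewrite minor_upper // (prod_first_ones sn).
have [Q QE] := polynomial_curve (line A (A *m delta_mx j i)) (polynomial_minor sn L).
by exists Q => t; rewrite -QE lineE /col_add mulmxDr mulmx1 -scalemxAr.
Qed.

Section Fundamental.
Variables (s : nat) (sn : (s <= n)%N).

Definition vanishes_on_perm h A := forall u : 'S_n, h (A *m perm_mx u) = 0.

(** Moved past a permutation, a column addition becomes another one. There it is either upper, or
    joins columns of equal weight, or drops from 1 to 0; in the last case the value is a combination
    of values at two permutations. *)
Lemma vanishes_col_add h A i j t : semi_invariant (first_ones s) h -> A \in unitmx ->
  i != j -> vanishes_on_perm h A -> vanishes_on_perm h (A *m col_add i j t).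
Proof.
move=> sh uA ij hA u; rewrite -mulmxA perm_col_add mulmxA.
have uAu : A *m perm_mx u \in unitmx by rewrite unitmx_mul uA unitmx_perm.
have [lt|ge] := ltnP (u i) (u j); last first.
  rewrite (col_add_upper _ sh) // ltn_neqAle ge andbT.
  by rewrite (inj_eq val_inj) (inj_eq perm_inj) eq_sym.
have [e|ne] := eqVneq (first_ones s (u i)) (first_ones s (u j)).
  by rewrite (col_add_same kinf t sh uAu lt e).1.
rewrite (col_add_drop kinf t sh) //; last 2 first.
- by move: ne lt; rewrite /first_ones; do 2!case: ltnP => //; lia.
- by move: ne lt; rewrite /first_ones; do 2!case: ltnP => //; lia.
by rewrite -mulmxA -perm_mxM !hA mulr0 addr0.
Qed.

Lemma vanishes_lower h A (L : 'M[k]_n) : semi_invariant (first_ones s) h ->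
  A \in unitmx -> is_trig_mx L -> (forall i, L i i = 1) ->
  vanishes_on_perm h A -> vanishes_on_perm h (A *m L).
Proof.
move=> sh uA /is_trig_mxP tL L1 hA.
(* [Lm m] has the first [m] columns of [L] and is the identity elsewhere. The factor [K m] fills in
   column [m], and it is itself a product of column additions. *)
pose Lm m : 'M[k]_n := \matrix_(i, j) (if (j < m)%N then L i j else (i == j)%:R).
pose K (m : 'I_n) (J : seq 'I_n) : 'M[k]_n :=
  1%:M + \sum_(j <- J | (m < j)%N) L j m *: delta_mx j m.
have LmK (m : 'I_n) : Lm m *m K m (index_enum _) = Lm m.+1.
  rewrite mulmxDr mulmx1 mulmx_sumr; apply/matrixP => i j.
  rewrite !mxE summxE ltnS.
  under eq_bigr => l ml.
    rewrite -scalemxAr !mxE (bigD1 l) //= !mxE eqxx big1 ?addr0 => [|l' ll']; last first.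
      by rewrite !mxE (negPf ll') mulr0.
    rewrite ltnNge ltnW //=.
    over.
  have neqv (a b : 'I_n) : (a < b)%N -> ((a == b) = false) * ((b == a) = false).
    by move=> ab; rewrite -!val_eqE /= (ltn_eqF ab) (gtn_eqF ab).
  have [jm|mj|/val_inj jm] := ltngtP j m.
  - by rewrite big1 ?addr0 // => l _; rewrite (neqv _ _ jm) !mulr0.
  - by rewrite big1 ?addr0 // => l _; rewrite (neqv _ _ mj) !mulr0.
  rewrite jm eqxx; have [im|mi|/val_inj im] := ltngtP i m.
  - rewrite tL // (neqv _ _ im) add0r big1 // => l ml.
    by rewrite (neqv _ _ (ltn_trans im ml)) mul0r mulr0.
  - rewrite (neqv _ _ mi) add0r (bigD1 i) //= eqxx !mulr1 big1 ?addr0 //.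
    by move=> l /andP[_ li]; rewrite eq_sym (negPf li) mul0r mulr0.
  - rewrite im L1 eqxx big1 ?addr0 // => l ml.
    by rewrite (neqv _ _ ml) mul0r mulr0.
have KJ (m : 'I_n) B J : B \in unitmx -> vanishes_on_perm h B ->
    B *m K m J \in unitmx /\ vanishes_on_perm h (B *m K m J).
  elim: J B => [|j J IH] B uB hB; first by rewrite /K big_nil addr0 mulmx1.
  rewrite /K big_cons; case: ifP => mj; last exact: IH.
  have mj' : m != j by rewrite neq_ltn mj.
  have -> : B *m (1%:M + (L j m *: delta_mx j m +
       \sum_(l <- J | (m < l)%N) L l m *: delta_mx l m)) = 
      B *m col_add m j (L j m) *m K m J.
    have e : (L j m *: delta_mx j m) *m K m J = L j m *: delta_mx j m.
      rewrite mulmxDr mulmx1 -[RHS]addr0; congr (_ + _).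
      rewrite mulmx_sumr big1 // => l ml; rewrite -scalemxAl -scalemxAr.
      by rewrite mul_delta_mx_0 ?scaler0 // neq_ltn ml.
    by rewrite -mulmxA /col_add mulmxDl mul1mx e /K addrCA addrC.
  apply: IH; first by rewrite unitmx_mul uB col_add_unit.
  exact: vanishes_col_add.
have H m : (m <= n)%N -> A *m Lm m \in unitmx /\ vanishes_on_perm h (A *m Lm m).
  elim: m => [|m IH] mn.
    suff -> : Lm 0%N = 1%:M by rewrite mulmx1.
    by apply/matrixP => i j; rewrite !mxE.
  have [um hm] := IH (ltnW mn).
  by rewrite -[m.+1]/((Ordinal mn).+1) -LmK mulmxA; apply: KJ.
have [_] := H n (leqnn n); congr (vanishes_on_perm h (A *m _)).
by apply/matrixP => i j; rewrite mxE ltn_ord.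
Qed.

(** In a factorization into permutation, lower unitriangular and upper triangular matrices, the
    upper factor only rescales [h] and the lower one preserves vanishing, so the permutation
    matrices decide. *)
Lemma vanishes_unit h A : semi_invariant (first_ones s) h ->
  vanishes_on_perm h 1%:M -> A \in unitmx -> h A = 0.
Proof.
move=> sh h0 uA; have [u [L [U [-> tL L1 tU uU]]]] := perm_lower_upper uA.
have uL : L \in unitmx by rewrite unitmxE det_trig // big1 ?unitr1 // => i _; rewrite L1.
have uP : perm_mx u \in @unitmx k n by exact: unitmx_perm.
rewrite (upper_semi_invariant sh) //; last by rewrite unitmx_mul uP.
suff hP : vanishes_on_perm h (perm_mx u *m L).
  by have := hP 1%g; rewrite perm_mx1 mulmx1 => ->; rewrite mulr0.
apply: vanishes_lower => // v; rewrite -perm_mxM.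
by have := h0 (u * v)%g; rewrite mul1mx.
Qed.

(** Such a [u] is a product of transpositions of columns with equal weight, and each of these
    changes [h] by a sign. The induction is on the number of points moved. *)
Lemma block_perm_zero h A (u : 'S_n) : semi_invariant (first_ones s) h ->
  A \in unitmx -> (forall j, (u j < s)%N = (j < s)%N) ->
  h A = 0 -> h (A *m perm_mx u) = 0.
Proof.
move=> sh uA; move: {2}_.+1 (ltnSn #|[set x | u x != x]|) => m.
elim: m u => // m IH u um bu hA.
have [/forallP u1|] := boolP [forall x, u x == x].
  suff -> : u = 1%g by rewrite perm_mx1 mulmx1.
  by apply/permP => x; rewrite perm1; apply/eqP.
rewrite negb_forall => /existsP[x ux].
(* [v] fixes [x] and all fixed points of [u], so it moves fewer points. *)
pose v : 'S_n := (u * tperm x (u x))%g.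
have vx : v x = x by rewrite permM tpermR.
have vfix y : u y = y -> v y = y.
  move=> uy; rewrite permM uy; have [xy|xy] := eqVneq x y.
    by rewrite xy uy eqxx in ux.
  rewrite tpermD //; apply: contra xy => /eqP e.
  by apply/eqP/(@perm_inj _ u); rewrite uy.
have bv j : (v j < s)%N = (j < s)%N.
  rewrite permM -(bu j); by case: tpermP => [->|->|//]; rewrite bu.
have hv : h (A *m perm_mx v) = 0.
  apply: IH => //; rewrite ltnS in um; apply: (leq_trans _ um); apply: proper_card.
  apply/properP; split.
    by apply/fintype.subsetP => y; rewrite !inE; apply: contra => /eqP /vfix ->.
  by exists x; rewrite !inE // vx eqxx.
have -> : u = (v * tperm x (u x))%g by rewrite -mulgA tperm2 mulg1.
rewrite perm_mxM mulmxA.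
have uAv : A *m perm_mx v \in unitmx by rewrite unitmx_mul uA unitmx_perm.
have same : first_ones s x = first_ones s (u x) by rewrite /first_ones bu.
have [lt|gt|/val_inj e] := ltngtP x (u x); last by rewrite -e eqxx in ux.
  by have [_ ->] := col_add_same kinf 0 sh uAv lt same; rewrite hv mulr0.
rewrite tpermC.
by have [_ ->] := col_add_same kinf 0 sh uAv gt (esym same); rewrite hv mulr0.
Qed.

Lemma minor_perm (rho : {ffun 'I_s -> 'I_n}) (u : 'S_n) :
  minor sn (rowsub rho 1%:M) (perm_mx u : 'M[k]_n) =
  \det (\matrix_(a < s, b < s) (u (rho a) == widen_ord sn b)%:R).
Proof.
by congr (\det _); apply/matrixP => a b; rewrite -rowsubE !mxE.
Qed.

(* A semi-invariant function is determined by its values on permutation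
   matrices, and these are matched one coset of 'S_s * 'S_(n - s) at a time. *)
Lemma fundamental_semi_invariant h : semi_invariant (first_ones s) h ->
  exists a : {ffun 'I_s -> 'I_n} -> k,
    (forall A, A \in unitmx ->
      h A = \sum_rho a rho * minor sn (rowsub rho 1%:M) A) /\
    (forall rho, a rho != 0 -> exists u : 'S_n,
      (forall b, u (rho b) = widen_ord sn b) /\ h (perm_mx u) != 0).
Proof.
move: {2}_.+1 (ltnSn #|[set u | h (perm_mx u) != 0]|) => m.
elim: m h => // m IH h hm sh.
have [/existsP[u hu]|] := boolP [exists u, h (perm_mx u) != 0]; last first.
  rewrite negb_exists => /forallP h0; exists (fun=> 0); split; last first.
    by move=> rho; rewrite eqxx.
  move=> A uA; rewrite big1 => [|rho _]; last by rewrite mul0r.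
  apply: vanishes_unit => // u; rewrite mul1mx; apply/eqP.
  by have := h0 u; rewrite negbK.
(* These are the rows that [u] carries to the first [s] positions, so their minor equals 1 at [u];
   subtracting [c] times it kills the value there. *)
pose rho0 : {ffun 'I_s -> 'I_n} := [ffun b => (u^-1)%g (widen_ord sn b)].
pose c := h (perm_mx u).
pose h' A := h A - c * minor sn (rowsub rho0 1%:M) A.
have sh' : semi_invariant (first_ones s) h'.
  by apply: semi_invariantB => //; apply: minor_semi_invariant.
have h'u : h' (perm_mx u) = 0.
  rewrite /h' minor_perm; have -> : \matrix_(a < s, b < s)
      (u (rho0 a) == widen_ord sn b)%:R = 1%:M :> 'M[k]_s.
    by apply/matrixP => a b; rewrite !mxE ffunE permKV -val_eqE.
  by rewrite det1 mulr1 subrr.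
(* No new nonzero value is created: where the subtracted minor is nonzero, [v] differs from [u] by a
   block permutation, and there [h'] vanishes because it vanishes at [u]. *)
have h'v v : h' (perm_mx v) != 0 -> h (perm_mx v) = h' (perm_mx v).
  have [m0|mn0] := eqVneq (minor sn (rowsub rho0 1%:M) (perm_mx v : 'M[k]_n)) 0.
    by rewrite /h' m0 mulr0 subr0.
  case/eqP; have -> : v = (u * (u^-1 * v))%g by rewrite mulKVg.
  rewrite perm_mxM; apply: block_perm_zero => //; first exact: unitmx_perm.
  have lts (j : 'I_n) : (j < s)%N -> ((u^-1 * v)%g j < s)%N.
    move=> js; rewrite permM.
    pose a := Ordinal js.
    have [b /eqP vb|vb] := pickP (fun b => v (rho0 a) == widen_ord sn b).
      have <- : rho0 a = (u^-1)%g j by rewrite ffunE; congr (_ _); apply: val_inj.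
      by rewrite vb /=.
    case/eqP: mn0; rewrite minor_perm (expand_det_row _ a) big1 // => b _.
    by rewrite mxE vb mul0r.
  set w := (u^-1 * v)%g in lts *; pose S := [set j : 'I_n | (j < s)%N].
  have wS : w @: S = S.
    apply/eqP; rewrite eqEcard (card_imset _ perm_inj) leqnn andbT.
    by apply/fintype.subsetP => _ /imsetP[j + ->]; rewrite !inE => /lts.
  move=> j; apply/idP/idP; last exact: lts.
  move=> wj; have /imsetP[x] : w j \in w @: S by rewrite wS inE.
  by rewrite inE => xs /perm_inj ->.
have [|a [aE an0]] := IH h' _ sh'.
  rewrite ltnS in hm; apply: (leq_trans _ hm); apply: proper_card.
  apply/properP; split; last by exists u; rewrite !inE // h'u eqxx.
  by apply/fintype.subsetP => v; rewrite !inE => hv; rewrite h'v.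
(* Otherwise [h'] is nonzero at some [v] where the subtracted minor is 1, and [h'v] would force
   [c = 0]. *)
have a0 : a rho0 = 0.
  apply/eqP/negPn/negP => /an0[v [vE hv]]; move: (h'v v hv); rewrite /h'.
  rewrite minor_perm; have -> : \matrix_(a < s, b < s)
      (v (rho0 a) == widen_ord sn b)%:R = 1%:M :> 'M[k]_s.
    by apply/matrixP => i b; rewrite !mxE vE -val_eqE.
  rewrite det1 mulr1 => /eqP; rewrite eq_sym subr_eq -subr_eq0 opprD addrA subrr sub0r.
  by rewrite oppr_eq0 (negPf hu).
exists (fun rho => if rho == rho0 then c else a rho); split.
  move=> A uA; have := aE A uA; rewrite /h' => /eqP; rewrite subr_eq => /eqP ->.
  rewrite [RHS](bigD1 rho0) //= eqxx [X in X + _](bigD1 rho0) //= a0 mul0r add0r addrC.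
  by congr (_ + _); apply: eq_bigr => rho /negPf rr; rewrite rr.
move=> rho; case: (eqVneq rho rho0) => [-> _|_ /an0[v [vE hv]]].
  by exists u; split=> // b; rewrite ffunE permKV.
by exists v; split=> //; rewrite h'v.
Qed.

End Fundamental.
End Minors.

(** * Weight vectors expanded in bideterminants *)

Section HookExpansion.
Variables (k : fieldType) (N : nat).
Hypothesis kinf : unbounded k.
Local Notation n := N.+1.
Local Notation G := (GL k n).

Lemma expfz_inj (a b : int) :
  (forall s : k, s != 0 -> s ^ a = s ^ b) -> a = b.
Proof.
move=> ab; apply/eqP; rewrite -subr_eq0; apply: contraT => dn0.
have [|s] := @exists_nonroot _ ('X * ('X^(`|a - b|%N) - 1) : {poly k}) kinf.
  by rewrite mulf_neq0 ?polyX_eq0 // -size_poly_gt0 size_XnsubC // absz_gt0.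
rewrite hornerM hornerX mulf_eq0 negb_or => /andP[sn0].
rewrite hornerD hornerN hornerXn hornerE.
suff -> : s ^+ `|a - b| = 1 by rewrite subrr eqxx.
have h : s ^ (a - b) = 1 by rewrite expfzDr // -invr_expz ab // divff ?expfz_neq0.
by move: h; case: (intP (a - b)) => [|m|m] //; rewrite ?abszN -?invr_expz // => /eqP; rewrite invr_eq1 => /eqP.
Qed.

Lemma expfz_polynomial_ge0 (Q : {poly k}) (c : k) (z : int) : c != 0 ->
  (forall s, s != 0 -> Q.[s] = c * s ^ z) -> 0 <= z.
Proof.
move=> cn0; case: z => // d QE; suff Qc : Q * 'X^(d.+1) = c%:P.
  by move/(congr1 (horner^~ 0)): Qc; rewrite hornerM hornerXn expr0n mulr0 hornerC => /esym/eqP; rewrite (negPf cn0).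
apply: (@poly_eq_generic _ 'X) => //; first by rewrite polyX_eq0.
move=> s; rewrite hornerX => sn0; rewrite hornerM QE // hornerXn hornerC NegzE.
by rewrite -invr_expz -exprnP mulfVK // expf_neq0.
Qed.

(** Normal form of a matrix with first column of ones: [A] sits outside column 0 and row [m], whose
    remaining entries are cleared. *)
Definition mx_extend (m : 'I_n) (A : 'M[k]_N) : 'M[k]_n := \matrix_(r, c)
  if unlift ord0 c is Some j then (if unlift m r is Some a then A a j else 0) else 1.

Definition mx_lift (A : 'M[k]_N) : 'M[k]_n := \matrix_(r, c)
  if unlift ord0 c is Some j then (if unlift ord0 r is Some a then A a j else 0)
  else (r == ord0)%:R.

Lemma mx_extend_mul m A B : mx_extend m A *m mx_lift B = mx_extend m (A *m B).
Proof.
apply/matrixP => r c; rewrite !mxE big_ord_recl !mxE unlift_none.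
case: unliftP => [j ->|->].
  rewrite mulr0 add0r; case: unliftP => [a ->|->].
    by rewrite mxE; apply: eq_bigr => l _; rewrite !mxE !liftK.
  by apply: big1 => l _; rewrite !mxE liftK unlift_none mul0r.
by rewrite eqxx mul1r big1 ?addr0 // => l _; rewrite !mxE unlift_none mulr0.
Qed.

Lemma det_mx_extend m A : \det (mx_extend m A) = (-1) ^+ m * \det A.
Proof.
rewrite (expand_det_row _ m) big_ord_recl big1 => [|j _]; last first.
  by rewrite mxE liftK unlift_none mul0r.
rewrite mxE unlift_none mul1r addr0 /cofactor addn0; congr (_ * \det _).
by apply/matrixP => a j; rewrite !mxE !liftK.
Qed.

Lemma mx_extend_unit m A : (mx_extend m A \in unitmx) = (A \in unitmx).
Proof. by rewrite !unitmxE det_mx_extend unitrM unitfE signr_eq0. Qed.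

Lemma mx_lift_unit A : A \in unitmx -> mx_lift A \in unitmx.
Proof.
move=> uA; have e : mx_extend ord0 1%:M *m mx_lift A = mx_extend ord0 A.
  by rewrite mx_extend_mul mul1mx.
have : mx_extend ord0 A \in unitmx by rewrite mx_extend_unit.
by rewrite -e unitmx_mul => /andP[].
Qed.

Lemma mx_lift_trig A : is_trig_mx A^T -> is_trig_mx (mx_lift A)^T.
Proof.
move=> /is_trig_mxP tA; apply/is_trig_mxP => a b ab; rewrite !mxE.
case: (unliftP ord0 a) ab => [j ->|->] ab; last first.
  by rewrite -val_eqE (gtn_eqF ab).
case: (unliftP ord0 b) ab => [l ->|-> //]; rewrite /= /bump !add1n ltnS => /tA.
by rewrite mxE.
Qed.

(** Multiples of the column of ones are subtracted from the other columns until row [m] is zero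
    beyond its first entry. *)
Lemma first_column_ones m (M : 'M[k]_n) : (forall r, M r ord0 = 1) ->
  exists A (U : 'M[k]_n), [/\ M = mx_extend m A *m U, is_trig_mx U^T & forall j, U j j = 1].
Proof.
move=> M1; exists (\matrix_(a, j) (M (lift m a) (lift ord0 j) - M m (lift ord0 j))).
exists (\matrix_(r, c) if r == ord0 then
  (if unlift ord0 c is Some j then M m (lift ord0 j) else 1) else (r == c)%:R); split.
- apply/matrixP => r c; rewrite mxE big_ord_recl !mxE eqxx unlift_none.
  case: (unliftP ord0 c) => [j ->|->]; last first.
    by rewrite M1 mulr1 big1 ?addr0 // => l _; rewrite !mxE /= mulr0.
  rewrite mul1r (bigD1 j) //= big1 ?addr0 => [|l lj]; last first.
    by rewrite !mxE /= (inj_eq lift_inj) (negPf lj) mulr0.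
  rewrite !mxE liftK /= eqxx mulr1; case: (unliftP m r) => [b ->|->]; last by rewrite addr0.
  by rewrite mxE addrC subrK.
- apply/is_trig_mxP => r c rc; rewrite !mxE -!val_eqE /=.
  by rewrite (gtn_eqF rc) gtn_eqF //; apply: leq_ltn_trans rc.
- by move=> j; rewrite !mxE eqxx; case: eqP => // ->; rewrite unlift_none.
Qed.

Section Expansion.
Variables (i : nat) (iN : (i <= N)%N) (lam : 'I_n -> nat) (f : G -> k) (alpha : weight n).
Hypothesis lam_lift : forall j : 'I_N, lam (lift ord0 j) = (j < i)%N.
Hypothesis rf : regular f.
Hypothesis upper_f : forall g b : G, is_trig_mx (GL_mx b)^T ->
  f (g * b)%g = \prod_j GL_mx b j j ^+ lam j * f g.
Hypothesis weight_f : forall t g : G, torus t -> f (t * g)%g = character alpha t * f g.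

Definition to_GL (X : 'M[k]_n) : G :=
  if @idP (X \in unitmx) is ReflectT u then exist (fun x => x \in unitmx) _ u else 1%g.

Lemma to_GLK X : X \in unitmx -> GL_mx (to_GL X) = X.
Proof. by rewrite /to_GL; case: {-}_ / idP. Qed.

Lemma GL_mx_inj : injective (@GL_mx k n).
Proof. exact: val_inj. Qed.

Let iN1 : (i.+1 <= n)%N := iN.

Definition hook_rows (m : 'I_n) (rho : {ffun 'I_i -> 'I_N}) (a : 'I_i.+1) : 'I_n :=
  if unlift ord0 a is Some c then lift m (rho c) else m.

Definition hook_count m rho (r : 'I_n) : nat := \sum_(a < i.+1) (hook_rows m rho a == r).

Let hm m A := f (to_GL (mx_extend m A)).

(** Upper triangular operations on [A] lift through [mx_lift] to operations on the extended matrix,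
    with exponents [lam] shifted by one column, that is, [first_ones i]. Column additions trace a
    line of constant determinant. *)
Lemma hm_semi_invariant m : semi_invariant (first_ones i) (hm m).
Proof.
split=> [A b uA ub tb|A j1 j2 uA lt].
  have uAb : A *m b \in unitmx by rewrite unitmx_mul uA.
  have -> : hm m (A *m b) = f (to_GL (mx_extend m A) * to_GL (mx_lift b))%g.
    congr f; apply: GL_mx_inj; rewrite GL_mxM !to_GLK ?mx_extend_unit ?mx_lift_unit //.
    by rewrite mx_extend_mul.
  rewrite upper_f ?to_GLK ?mx_lift_unit ?mx_lift_trig //; congr (_ * _).
  rewrite big_ord_recl mxE unlift_none eqxx expr1n mul1r; apply: eq_bigr => j _.
  by rewrite mxE liftK lam_lift.
have ne : j1 != j2 by rewrite neq_ltn lt.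
(* Subtracting the extension of 0 removes the column of ones, so that [D] is a direction which
   leaves the first column fixed. *)
pose D : 'M[k]_n := mx_extend m (A *m delta_mx j2 j1) - mx_extend m 0.
have lE t : mx_extend m A + t *: D = mx_extend m (A *m col_add j1 j2 t).
  rewrite /col_add mulmxDr mulmx1 -scalemxAr /D; set M := _ *m _; apply/matrixP => r c.
  rewrite !mxE; case: (unlift ord0 c) => [j|]; last by ring.
  by case: (unlift m r) => [a|]; rewrite ?mxE; ring.
have [||Q QE] := regular_curve1 (X := line (mx_extend m A) D) (c := (-1) ^+ m * \det A) rf.
- by rewrite mulf_neq0 ?signr_eq0 // -unitfE -unitmxE.
- by move=> t; rewrite lineE lE det_mx_extend det_mulmx det_col_add // mulr1.
exists Q => t; apply: QE; rewrite lineE lE to_GLK // mx_extend_unit unitmx_mul uA.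
exact: col_add_unit.
Qed.

Lemma hook_rows_minor m (rho : {ffun 'I_i -> 'I_N}) A :
  minor iN1 (rowsub (hook_rows m rho) 1%:M) (mx_extend m A) =
  minor iN (rowsub rho 1%:M) A.
Proof.
rewrite /minor -!rowsubE (expand_det_row _ ord0) big_ord_recl big1 => [|j _].
  rewrite addr0 !mxE /= /cofactor mul1r; case: unliftP => [j /(congr1 val)//|_].
  rewrite mul1r; congr (\det _); apply/matrixP => a b; rewrite !mxE.
  have -> : widen_ord iN1 (lift ord0 b) = lift ord0 (widen_ord iN b) by apply: val_inj.
  by rewrite /hook_rows !liftK.
rewrite !mxE; have -> : widen_ord iN1 (lift ord0 j) = lift ord0 (widen_ord iN j) by apply: val_inj.
by rewrite liftK /hook_rows unlift_none unlift_none mul0r.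
Qed.

Lemma minor_torus r (rn : (r <= n)%N) (phi : 'I_r -> 'I_n) (t g : G) : torus t ->
  minor rn (rowsub phi 1%:M) (GL_mx (t * g)%g) =
  \prod_a GL_mx t (phi a) (phi a) * minor rn (rowsub phi 1%:M) (GL_mx g).
Proof.
move=> tt; rewrite /minor -!rowsubE.
have -> : colsub (widen_ord rn) (rowsub phi (GL_mx (t * g)%g)) =
    diag_mx (\row_a GL_mx t (phi a) (phi a)) *m colsub (widen_ord rn) (rowsub phi (GL_mx g)).
  by apply/matrixP => a b; rewrite mul_diag_mx [RHS]mxE [LHS]mxE [LHS]mxE torus_mulE // !mxE.
by rewrite det_mulmx det_diag; congr (_ * _); apply: eq_bigr => a _; rewrite mxE.
Qed.

Lemma prod_hook_rows m rho (F : 'I_n -> k) :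
  \prod_a F (hook_rows m rho a) = \prod_r F r ^+ hook_count m rho r.
Proof.
rewrite (partition_big (hook_rows m rho) xpredT) //=; apply: eq_bigr => r _.
rewrite (eq_bigr (fun=> F r)) => [|a /eqP -> //].
rewrite prodr_const; congr (_ ^+ _); rewrite -sum1_card big_mkcond /=.
by apply: eq_bigr => a _; rewrite unfold_in.
Qed.

Definition hook_expansion m (a : {ffun 'I_i -> 'I_N} -> k) :=
  forall g : G, (forall r, GL_mx g r ord0 != 0) ->
  f g = \sum_rho a rho * \prod_r GL_mx g r ord0 ^ (alpha 0 r - (hook_count m rho r)%:Z) *
    minor iN1 (rowsub (hook_rows m rho) 1%:M) (GL_mx g).

Lemma hook_expansion_exists m : exists a, hook_expansion m a /\
  forall rho, a rho != 0 -> exists u : 'S_N,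
      (forall b, u (rho b) = widen_ord iN b) /\ hm m (perm_mx u) != 0.
Proof.
have [a [aE an0]] := fundamental_semi_invariant kinf iN (hm_semi_invariant m).
exists a; split=> // g g0.
have d0 j : (\row_r GL_mx g r ord0) 0 j != 0 by rewrite mxE.
(* [t] carries the first column of [g] on its diagonal, so [t^-1 * g] has first column of ones. *)
pose t := torus_elt d0; have tt : torus t by apply: torus_eltP.
have tE r : GL_mx t r r = GL_mx g r ord0 by rewrite /= !mxE eqxx mulr1n.
pose g' := (t^-1 * g)%g.
have gE : g = (t * g')%g by rewrite mulKVg.
have g'0 r : GL_mx g' r ord0 = 1.
  have e := torus_mulE g' r ord0 tt; rewrite -gE tE in e.
  by apply: (mulfI (g0 r)); rewrite -e mulr1.
have [A [U [g'E tU U1]]] := first_column_ones m g'0.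
have [uA uU] : A \in unitmx /\ U \in unitmx.
  have := Defs.GL_unit g'; rewrite g'E unitmx_mul mx_extend_unit => /andP[] //.
have mE rho : minor iN1 (rowsub (hook_rows m rho) 1%:M) (GL_mx g') = minor iN (rowsub rho 1%:M) A.
  by rewrite g'E minor_upper // big1 ?mul1r ?hook_rows_minor // => j _; rewrite U1.
have fg' : f g' = hm m A.
  have -> : g' = (to_GL (mx_extend m A) * to_GL U)%g.
    by apply: GL_mx_inj; rewrite GL_mxM !to_GLK ?mx_extend_unit.
  by rewrite upper_f to_GLK // big1 ?mul1r // => j _; rewrite U1 expr1n.
rewrite {1}gE weight_f // fg' aE // mulr_sumr; apply: eq_bigr => rho _.
rewrite -mE gE minor_torus // mulrCA -mulrA; congr (_ * _); rewrite mulrA -gE; congr (_ * _).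
rewrite (prod_hook_rows m rho (fun r => GL_mx t r r)) -big_split /=; apply: eq_bigr => r _.
by rewrite tE exprnP -expfzDr // subrK.
Qed.

(** Replacing the entry of [mx_extend m (perm_mx u)] at row [j], column 0 by [s] multiplies [f] by
    [s] to the power [alpha 0 j - hook_count m rho j]. Along this curve [f] is polynomial in [s] up
    to a constant determinant, so the exponent is not negative. *)
Lemma hook_expansion_support m (u : 'S_N) (rho : {ffun 'I_i -> 'I_N}) :
  (forall b, u (rho b) = widen_ord iN b) -> hm m (perm_mx u) != 0 ->
  injective rho /\ forall j, j != m -> (hook_count m rho j)%:Z <= alpha 0 j.
Proof.
move=> uE hu; have rI : injective rho.
  by move=> b c bc; apply: val_inj; have := congr1 val (uE b); rewrite bc uE.
split=> // j jm; case: (unliftP m j) jm => [a ->|->]; last by rewrite eqxx.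
move=> _; set j0 := lift m a.
have cE : hook_count m rho j0 = (u a < i)%N.
  rewrite /hook_count big_ord_recl /hook_rows unlift_none (negPf (neq_lift _ _)) add0n.
  under eq_bigr => b _ do rewrite liftK (inj_eq lift_inj).
  case: ltnP => [lt|ge].
    rewrite (bigD1 (Ordinal lt)) //= big1 => [|b bl].
      rewrite addn0; suff -> : rho (Ordinal lt) = a by rewrite eqxx.
      by apply: (@perm_inj _ u); rewrite uE; apply: val_inj.
    case: eqP => // ra; case/eqP: bl; apply: val_inj => /=.
    by rewrite -ra uE.
  rewrite big1 // => b _; case: eqP => // ra.
  by have := ltn_ord b; rewrite ltnNge; have := congr1 val (uE b); rewrite ra /= => <-; rewrite ge.
pose Y := mx_extend m (perm_mx u).
have uY : Y \in unitmx by rewrite mx_extend_unit unitmx_perm.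
have [Q [e QE]] := regular_curve (line (Y - delta_mx j0 ord0) (delta_mx j0 ord0)) rf.
rewrite -subr_ge0; apply: (@expfz_polynomial_ge0 Q (hm m (perm_mx u) * \det Y ^+ e)).
  by rewrite mulf_neq0 // expf_neq0 // -unitfE -unitmxE.
move=> s sn0.
have d1 r : (\row_(r < n) (if r == j0 then s else 1)) 0 r != 0.
  by rewrite mxE; case: ifP => _ //; apply: oner_neq0.
have d2 r : (\row_(r < n) (if r == lift ord0 (u a) then s^-1 else 1)) 0 r != 0.
  by rewrite mxE; case: ifP => _; rewrite ?oner_neq0 // invr_eq0.
(* [t1] scales row [j0] by [s]; [t2] undoes this at the only other nonzero entry of that row by
   scaling its column. *)
pose t1 := torus_elt d1; pose t2 := torus_elt d2.
have gE : GL_mx (t1 * (to_GL Y * t2))%g = Y - delta_mx j0 ord0 + s *: delta_mx j0 ord0.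
  rewrite !GL_mxM to_GLK //; apply/matrixP => r c.
  rewrite [GL_mx t1]/= [GL_mx t2]/= mul_diag_mx mxE mul_mx_diag 2!mxE mxE !mxE.
  case: (unliftP ord0 c) => [l ->|->]; last first.
    rewrite andbT; case: eqVneq => _ /=; last by ring.
    by rewrite ?eqxx; ring.
  rewrite andbF /= mulr0 subr0 addr0 (inj_eq lift_inj).
  case: (unliftP m r) => [b ->|->]; last by rewrite mul0r mulr0.
  rewrite !mxE (inj_eq lift_inj) -(inj_eq (@perm_inj _ u)).
  case: (eqVneq (u b) l) => [->|]; last by rewrite mul0r mulr0.
  by case: eqVneq => _; rewrite mul1r ?mulr1 // divff.
have dg : \det (GL_mx (t1 * (to_GL Y * t2))%g) = \det Y.
  rewrite !GL_mxM !det_mulmx to_GLK // [GL_mx t1]/= [GL_mx t2]/= !det_diag.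
  rewrite (bigD1 j0) //= big1 => [|r /negPf rj]; last by rewrite mxE rj.
  rewrite (bigD1 (lift ord0 (u a))) //= big1 => [|r /negPf rj]; last by rewrite mxE rj.
  by rewrite !mxE !eqxx !mulr1 mulrCA divff // mulr1.
rewrite -(QE s (t1 * (to_GL Y * t2))%g) ?lineE // dg mulrAC; congr (_ * _).
rewrite weight_f ?upper_f; last 2 first.
- by rewrite tr_diag_mx diag_mx_is_trig.
- exact: torus_eltP.
rewrite /character (bigD1 j0) //= [X in _ * X * _]big1 => [|r /negPf rj]; last first.
  by rewrite !mxE eqxx rj exp1rz.
rewrite (bigD1 (lift ord0 (u a))) //= [X in _ * (_ * X * _)]big1 => [|r /negPf rj]; last first.
  by rewrite !mxE eqxx rj expr1n.
rewrite !mxE !eqxx !mulr1 !mulr1n lam_lift cE expfzDr // -invr_expz exprVn -exprnP.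
by rewrite mulrA [RHS]mulrC.
Qed.

Lemma hook_expansion_zero m (a : {ffun 'I_i -> 'I_N} -> k) : hook_expansion m a ->
  (forall rho, a rho = 0) -> forall g, f g = 0.
Proof.
move=> aE a0.
(* Adding [t] to all entries makes the first column nowhere zero, except at the roots of [C g]. *)
pose C (g : G) : {poly k} := \prod_r ((GL_mx g r ord0)%:P + 'X).
apply: (regular_eq0_generic kinf (B := const_mx 1) (C := C)) => //.
  move=> g; apply/prodf_neq0 => r _; rewrite -size_poly_gt0 addrC size_polyDl //.
    by rewrite size_polyX.
  by rewrite size_polyX (leq_ltn_trans (size_polyC_leq1 _)).
move=> g h t Ct hE; rewrite aE => [|r]; last first.
  move: Ct; rewrite /C horner_prod => /prodf_neq0/(_ r isT).
  by rewrite hE !mxE mulr1 hornerD hornerC hornerX.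
by apply: big1 => rho _; rewrite a0 !mul0r.
Qed.

End Expansion.

Definition bideterminant r (rn : (r <= n)%N) (F : {mpoly k[n]}) (L : 'M[k]_(r, n))
    (X : 'M[k]_n) : k :=
  F.@[fun c => X c ord0] * minor rn L X.

Lemma polynomial_bideterminant r (rn : (r <= n)%N) F L :
  polynomial_fun (bideterminant rn F L).
Proof.
apply: polynomialM; last exact: polynomial_minor.
by apply: polynomial_meval => a; apply: polynomial_entry.
Qed.

Lemma bideterminantX r (rn : (r <= n)%N) (gam : 'X_{1..n}) L X :
  bideterminant rn 'X_[gam] L X = \prod_c X c ord0 ^+ gam c * minor rn L X.
Proof. by rewrite /bideterminant mevalX. Qed.

Lemma character_scalar (lam : weight n) (s : k) (sn0 : s != 0)
  (d0 : forall j, (const_mx s : 'rV[k]_n) 0 j != 0) :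
  character lam (torus_elt d0) = s ^ (\sum_j lam 0 j).
Proof.
rewrite character_torus_elt -expfz_prod //.
by apply: eq_bigr => j _; rewrite mxE.
Qed.

(** * From Laurent monomials on an open set to bideterminants on the whole group *)

Section WeightForm.
Variables (i : nat) (iN : (i <= N)%N) (lam : 'I_n -> nat) (f : G -> k) (alpha : weight n).
Hypothesis lam_lift : forall j : 'I_N, lam (lift ord0 j) = (j < i)%N.
Hypothesis rf : regular f.
Hypothesis upper_f : forall g b : G, is_trig_mx (GL_mx b)^T ->
  f (g * b)%g = \prod_j GL_mx b j j ^+ lam j * f g.
Hypothesis weight_f : forall t g : G, torus t -> f (t * g)%g = character alpha t * f g.
Hypothesis f_neq0 : exists g, f g != 0.

Let iN1 : (i.+1 <= n)%N := iN.

(** Scalar matrices are central, so the left weight and the right equivariance must agree on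
    them. *)
Lemma weight_degree : \sum_j alpha 0 j = (\sum_j lam j)%N%:Z.
Proof.
have [g fg] := f_neq0; apply: expfz_inj => s sn0.
have d0 j : (const_mx s : 'rV[k]_n) 0 j != 0 by rewrite mxE.
have := weight_f g (torus_eltP d0); rewrite (character_scalar alpha sn0).
have -> : (torus_elt d0 * g = g * torus_elt d0)%g.
  apply: GL_mx_inj; rewrite !GL_mxM [GL_mx (torus_elt _)]/=.
  by rewrite diag_const_mx scalar_mxC.
rewrite upper_f; last by rewrite tr_diag_mx diag_mx_is_trig.
move=> e; apply: (mulIf fg); rewrite -e -exprnP; congr (_ * _).
rewrite -prodrXr; apply: eq_bigr => j _.
by rewrite /= !mxE eqxx.
Qed.

(** The support bound at [m] says nothing about row [m] itself, where the count is 1; this is why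
    [0 < A m] is required. Once all exponents are nonnegative, both sides are regular and the
    identity spreads by density. *)
Lemma hook_weight_form : exists A : 'X_{1..n},
  [/\ forall j, alpha 0 j = (A j)%:Z, mdeg A = (\sum_j lam j)%N
   & forall m, (0 < A m)%N -> exists a : {ffun 'I_i -> 'I_N} -> k,
     (forall g, f g = \sum_rho a rho *
        bideterminant iN1 'X_[[multinom (A r - hook_count m rho r)%N | r < n]]
           (rowsub (hook_rows m rho) 1%:M) (GL_mx g)) /\
     (forall rho, a rho != 0 ->
        injective rho /\ forall r, (hook_count m rho r <= A r)%N)].
Proof.
have [g0 fg0] := f_neq0.
have ge0 j : 0 <= alpha 0 j.
  (* The sign of [alpha 0 j] is read off the expansion at a row other than [j]. For [n = 1] there is
     none, and [alpha 0 j] is the total degree. *)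
  have [m mj|nomj] := pickP (fun m => m != j); last first.
    have := weight_degree; rewrite (bigD1 j) //= big_pred0 // addr0 => ->.
    by [].
  have [a [aE an0]] := hook_expansion_exists iN lam_lift rf upper_f weight_f m.
  have [/existsP[rho arho]|] := boolP [exists rho, a rho != 0].
    have [u [uE hu]] := an0 _ arho.
    have [_ ge] := hook_expansion_support lam_lift rf upper_f weight_f uE hu.
    by apply: le_trans (ge j _); rewrite // eq_sym.
  rewrite negb_exists => /forallP a0; case/eqP: fg0.
  apply: (hook_expansion_zero rf aE) => rho.
  by apply/eqP/negPn.
pose A := [multinom `|alpha 0%R j|%N | j < n].
have AE j : alpha 0 j = (A j)%:Z by rewrite mnmE gez0_abs.
exists A; split=> //.
  apply/eqP; rewrite -eqz_nat -weight_degree mdegE -[X in X == _]natz natr_sum; apply/eqP.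
  by apply: eq_bigr => j _; rewrite natz AE.
move=> m Am; have [a [aE an0]] := hook_expansion_exists iN lam_lift rf upper_f weight_f m.
have an0' rho : a rho != 0 -> injective rho /\ forall r, (hook_count m rho r <= A r)%N.
  move=> /an0[u [uE hu]].
  have [rI ge] := hook_expansion_support lam_lift rf upper_f weight_f uE hu.
  split=> // r; have [->|rm] := eqVneq r m; last by rewrite -lez_nat -AE ge.
  rewrite /hook_count big_ord_recl /hook_rows unlift_none eqxx big1 //.
  by move=> b _; rewrite liftK eq_sym (negPf (neq_lift _ _)).
exists a; split=> //.
pose h (g : G) := f g - \sum_rho a rho *
        bideterminant iN1 'X_[[multinom (A r - hook_count m rho r)%N | r < n]]
           (rowsub (hook_rows m rho) 1%:M) (GL_mx g).
suff h0 g : h g = 0 by move=> g; apply/eqP; rewrite -subr_eq0; apply/eqP/h0.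
pose C (g : G) : {poly k} := \prod_r ((GL_mx g r ord0)%:P + 'X).
move: g; apply: (regular_eq0_generic kinf (B := const_mx 1) (C := C)).
- have rb : regular (fun g : G => \sum_rho a rho *
        bideterminant iN1 'X_[[multinom (A r - hook_count m rho r)%N | r < n]]
           (rowsub (hook_rows m rho) 1%:M) (GL_mx g)).
    by apply: regular_sum => rho; apply: regular_polynomial; apply: polynomial_bideterminant.
  suff -> : h = (fun g => -1 * (\sum_rho a rho *
        bideterminant iN1 'X_[[multinom (A r - hook_count m rho r)%N | r < n]]
           (rowsub (hook_rows m rho) 1%:M) (GL_mx g)) + f g) by exact: regularP.
  by apply/funext => g; rewrite /h mulN1r addrC.
- move=> g; apply/prodf_neq0 => r _; rewrite -size_poly_gt0 addrC size_polyDl //.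
    by rewrite size_polyX.
  by rewrite size_polyX (leq_ltn_trans (size_polyC_leq1 _)).
move=> g1 g t Ct gE; apply/eqP; rewrite subr_eq0; apply/eqP.
rewrite aE => [|r]; last first.
  move: Ct; rewrite /C horner_prod => /prodf_neq0/(_ r isT).
  by rewrite gE !mxE mulr1 hornerD hornerC hornerX.
apply: eq_bigr => rho _; have [->|/an0'[_ le]] := eqVneq (a rho) 0; first by rewrite !mul0r.
rewrite bideterminantX mulrA; congr (_ * _ * _); apply: eq_bigr => r _.
by rewrite mnmE AE exprnP -subzn.
Qed.

End WeightForm.
End HookExpansion.

(** * Polarization and the differential *)

Section LinearCombinations.
Variables (k : fieldType) (T : Type).

Definition lin_comb (I : Type) (b : I -> T -> k) (f : T -> k) : Prop :=
  exists s : seq (k * I), forall x, f x = \sum_(u <- s) u.1 * b u.2 x.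

Variables (I : Type) (b : I -> T -> k).

Lemma lin_comb_gen i : lin_comb b (b i).
Proof. by exists [:: (1, i)] => x; rewrite big_seq1 mul1r. Qed.

Lemma lin_comb0 : lin_comb b (fun=> 0).
Proof. by exists [::] => x; rewrite big_nil. Qed.

Lemma lin_combD f h : lin_comb b f -> lin_comb b h -> lin_comb b (fun x => f x + h x).
Proof. by move=> [s sE] [t tE]; exists (s ++ t) => x; rewrite big_cat sE tE. Qed.

Lemma lin_combZ c f : lin_comb b f -> lin_comb b (fun x => c * f x).
Proof.
move=> [s sE]; exists [seq (c * u.1, u.2) | u <- s] => x.
by rewrite sE big_map mulr_sumr; apply: eq_bigr => u _; rewrite mulrA.
Qed.

Lemma eq_lin_comb f h : f =1 h -> lin_comb b f -> lin_comb b h.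
Proof. by move=> fh [s sE]; exists s => x; rewrite -fh. Qed.

Lemma lin_comb_sum (J : eqType) (r : seq J) (p : pred J) (f : J -> T -> k) :
  (forall j, j \in r -> p j -> lin_comb b (f j)) -> lin_comb b (fun x => \sum_(j <- r | p j) f j x).
Proof.
elim: r => [|j r IH] fr.
  by apply: (eq_lin_comb _ lin_comb0) => x; rewrite big_nil.
have {}IH : lin_comb b (fun x => \sum_(j <- r | p j) f j x).
  by apply: IH => l lr; apply: fr; rewrite inE lr orbT.
case pj: (p j); last by apply: (eq_lin_comb _ IH) => x; rewrite big_cons pj.
apply: (eq_lin_comb _ (lin_combD (fr j (mem_head _ _) pj) IH)) => x.
by rewrite big_cons pj.
Qed.

Lemma lin_comb_trans (J : Type) (c : J -> T -> k) f :
  (forall i, lin_comb c (b i)) -> lin_comb b f -> lin_comb c f.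
Proof.
move=> bc [s sE]; suff [t tE] : lin_comb c (fun x => \sum_(u <- s) u.1 * b u.2 x).
  by exists t => x; rewrite sE tE.
elim: {sE} s => [|u s [t tE]].
  by exists [::] => x; rewrite !big_nil.
have [t' tE'] := bc u.2; exists ([seq (u.1 * v.1, v.2) | v <- t'] ++ t) => x.
rewrite big_cons big_cat tE tE' big_map mulr_sumr; congr (_ + _).
by apply: eq_bigr => v _; rewrite mulrA.
Qed.

End LinearCombinations.

Lemma lin_comb_fin (k : fieldType) (T : Type) (I : finType) (b : I -> T -> k) f :
  lin_comb b f -> exists c : I -> k, forall x, f x = \sum_i c i * b i x.
Proof.
move=> [s sE]; exists (fun i => \sum_(u <- s | u.2 == i) u.1) => x.
rewrite sE; under [RHS]eq_bigr => i _ do rewrite mulr_suml big_mkcond.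
rewrite exchange_big; apply: eq_bigr => u _ /=.
by rewrite (bigD1 u.2) //= eqxx big1 ?addr0 // => i /negPf iu; rewrite eq_sym iu.
Qed.

(** * Monomials of degree below the characteristic as sums of powers of linear forms *)

Section Polarization.
Variables (k : fieldType) (p : nat).
Hypotheses (kinf : unbounded k) (pchar : p \in [pchar k]).

Lemma pchar_natr_neq0 m : (0 < m < p)%N -> m%:R != 0 :> k.
Proof.
by move=> /andP[m0 mp]; rewrite -(dvdn_pcharf pchar) gtnNdvd.
Qed.

Lemma pchar_bin_neq0 d a : (d < p)%N -> (a <= d)%N -> 'C(d, a)%:R != 0 :> k.
Proof.
move=> dp ad; have fn0 m : (m < p)%N -> m`!%:R != 0 :> k.
  elim: m => [|m IH] mp; first by rewrite oner_neq0.
  by rewrite factS natrM mulf_neq0 //; [exact: pchar_natr_neq0 | exact/IH/ltnW].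
by have := fn0 d dp; rewrite -(bin_fact ad) natrM mulf_eq0 negb_or => /andP[].
Qed.

(** This is [weight_projector] for the one-dimensional torus and the weights from 0 to [d]. *)
Lemma coef_extraction d a : (a <= d)%N -> exists m (c t : 'I_m -> k),
  forall b, (b <= d)%N -> \sum_(l < m) c l * t l ^+ b = (b == a)%:R.
Proof.
move=> ad; pose w (b : nat) : weight 1 := const_mx b%:Z.
have wa : w a \in map w (iota 0 d.+1) by apply: map_f; rewrite mem_iota.
have [m [c [t [_ ct]]]] := weight_projector kinf wa.
exists m, c, (fun l => GL_mx (t l) ord0 ord0) => b bd.
have wb : w b \in map w (iota 0 d.+1) by apply: map_f; rewrite mem_iota.
have := ct _ wb; have -> : (w b == w a) = (b == a).
  by apply/eqP/eqP => [/matrixP/(_ ord0 ord0)|->] //; rewrite !mxE => -[].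
move=> <-; apply: eq_bigr => l _; rewrite /character big_ord1.
by rewrite mxE exprnP.
Qed.

(** Extracts the coefficient of degree [e] in [t] from the binomial expansion of
    [(x + t y) ^+ (d + e)] and divides by its binomial coefficient. *)
Lemma binomial_extraction (A : comAlgType k) (x y : A) d e m (c t : 'I_m -> k) :
  'C(d + e, e)%:R != 0 :> k ->
  (forall b, (b <= d + e)%N -> \sum_(l < m) c l * t l ^+ b = (b == e)%:R) ->
  y ^+ e * x ^+ d = \sum_(l < m) (c l / 'C(d + e, e)%:R) *: (x + t l *: y) ^+ (d + e).
Proof.
move=> Cn0 ct.
have step l : (c l / 'C(d + e, e)%:R) *: (x + t l *: y) ^+ (d + e) =
  \sum_(j < (d + e).+1) (c l * t l ^+ j) *:
     (('C(d + e, j)%:R / 'C(d + e, e)%:R) *: (x ^+ (d + e - j) * y ^+ j)).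
  rewrite exprDn scaler_sumr; apply: eq_bigr => j _.
  rewrite exprZn -scalerAr -scaler_nat !scalerA; congr (_ *: _).
  by ring.
under [RHS]eq_bigr => l _ do rewrite step.
rewrite exchange_big /=.
have ej : (e < (d + e).+1)%N by rewrite ltnS leq_addl.
rewrite (bigD1 (Ordinal ej)) //= -scaler_suml ct ?leq_addl // eqxx scale1r.
rewrite addnK divff // scale1r [x ^+ d * _]mulrC big1 ?addr0 // => j /negPf je.
rewrite -scaler_suml ct; last by rewrite -ltnS ltn_ord.
by move: je; rewrite -val_eqE /= => ->; rewrite scale0r.
Qed.

Variable n : nat.

Definition linear_form (y : 'rV[k]_n) : {mpoly k[n]} := \sum_c y 0 c *: 'X_c.

Lemma linear_formD y z : linear_form (y + z) = linear_form y + linear_form z.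
Proof. by rewrite -big_split; apply: eq_bigr => c _; rewrite mxE scalerDl. Qed.

Lemma linear_formZ a y : linear_form (a *: y) = a *: linear_form y.
Proof. by rewrite scaler_sumr; apply: eq_bigr => c _; rewrite mxE scalerA. Qed.

Lemma linear_form_delta c : linear_form (delta_mx 0 c) = 'X_c.
Proof.
rewrite /linear_form (bigD1 c) //= mxE !eqxx scale1r big1 ?addr0 // => j /negPf jc.
by rewrite mxE jc andbF scale0r.
Qed.

Lemma meval_linear_form y v : (linear_form y).@[v] = \sum_c y 0 c * v c.
Proof. by rewrite raddf_sum; apply: eq_bigr => c _; rewrite /= mevalZ mevalXU. Qed.

Definition power_sum d (F : {mpoly k[n]}) : Prop :=
  exists s : seq (k * 'rV[k]_n), F = \sum_(u <- s) u.1 *: linear_form u.2 ^+ d.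

Lemma power_sum_mul d e y F : (d + e < p)%N -> power_sum d F ->
  power_sum (d + e) (linear_form y ^+ e * F).
Proof.
move=> dep [s ->]; rewrite mulr_sumr.
have [m [c [t ct]]] := coef_extraction (leq_addl d e).
have Cn0 : 'C(d + e, e)%:R != 0 :> k by rewrite pchar_bin_neq0 // leq_addl.
have key z : linear_form y ^+ e * linear_form z ^+ d =
    \sum_(l < m) (c l / 'C(d + e, e)%:R) *: linear_form (z + t l *: y) ^+ (d + e).
  rewrite (binomial_extraction _ _ Cn0 ct); apply: eq_bigr => l _.
  by rewrite linear_formD linear_formZ.
exists (flatten [seq [seq (u.1 * (c l / 'C(d + e, e)%:R), u.2 + t l *: y) | l : 'I_m] | u <- s]).
rewrite big_flatten big_map; apply: eq_bigr => u _.
rewrite -scalerAr key scaler_sumr big_map enumT; apply: eq_bigr => l _.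
by rewrite scalerA.
Qed.

Lemma power_sum_monomial (bet : 'X_{1..n}) : (mdeg bet < p)%N ->
  power_sum (mdeg bet) 'X_[bet].
Proof.
move=> bp; rewrite mpolyXE_id mdegE.
have : (\sum_(c <- index_enum 'I_n) bet c < p)%N by rewrite -mdegE.
elim: (index_enum _) => [|c r IH]; rewrite ?big_nil ?big_cons => lt.
  by exists [:: (1, 0)]; rewrite big_seq1 scale1r.
rewrite addnC -linear_form_delta; apply: power_sum_mul; first by rewrite addnC.
by apply: IH; apply: leq_ltn_trans lt; apply: leq_addl.
Qed.

End Polarization.

Section Laplace.
Variable k : fieldType.

(** Swapping column [s] with the last one puts the surviving columns in the first [r] places, so
    each cofactor becomes a minor on first columns of a right translate, up to sign. *)
Lemma det_expand_first_row r (A : 'M[k]_(r.+1)) : \det A =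
  \sum_s A ord0 s * ((-1) ^+ r * (-1) ^+ (s != ord_max) *
    \det (\matrix_(a < r, b < r) A (lift ord0 a) (tperm s ord_max (lift ord_max b)))).
Proof.
rewrite (expand_det_row _ ord0); apply: eq_bigr => s _; congr (_ * _).
pose B : 'M[k]_(r.+1) := \matrix_(a, b) if a == ord0 then (b == s)%:R else A a b.
have -> : cofactor A ord0 s = \det B.
  rewrite (expand_det_row _ ord0) (bigD1 s) //= big1 => [|b /negPf bs].
    rewrite mxE !eqxx mul1r addr0 /cofactor; congr (_ * \det _).
    by apply/matrixP => a b; rewrite !mxE eq_sym (negPf (neq_lift _ _)).
  by rewrite mxE eqxx bs mul0r.
pose C := B *m perm_mx (tperm s ord_max).
have CE a b : C a b = B a (tperm s ord_max b).
  by rewrite /C -[tperm _ _]invgK -col_permE mxE !tpermV.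
have dC : \det C = (-1) ^+ (s != ord_max) * \det B.
  rewrite /C det_mulmx det_perm odd_tperm. by rewrite mulrC.
clearbody C.
have -> : \det B = (-1) ^+ (s != ord_max) * \det C by rewrite dC signrMK.
rewrite -mulrA mulrCA; congr (_ * _).
rewrite (expand_det_row _ ord0) (bigD1 ord_max) //= big1 => [|b bm].
  rewrite CE mxE eqxx tpermR eqxx mul1r addr0 /cofactor; congr (_ * \det _).
  by apply/matrixP => a b; rewrite !mxE CE mxE eq_sym (negPf (neq_lift _ _)).
rewrite CE mxE eqxx; case: eqP => [e|_]; last by rewrite mul0r.
by case/eqP: bm; rewrite -(tpermK s ord_max b) e tpermL.
Qed.

End Laplace.

Section Derivation.
Variables (k : fieldType) (N p : nat).
Hypotheses (kinf : unbounded k) (pchar : p \in [pchar k]).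
Local Notation n := N.+1.
Implicit Types (X : 'M[k]_n) (y : 'rV[k]_n).

Lemma bideterminant_power r (rn : (r <= n)%N) y d L X :
  bideterminant rn (linear_form y ^+ d) L X = ((y *m X) ord0 ord0) ^+ d * minor rn L X.
Proof. by rewrite /bideterminant rmorphXn /= meval_linear_form mxE. Qed.

Lemma mul_tperm_mx m (X : 'M[k]_(m, n)) (a b : 'I_n) r c : (X *m tperm_mx a b) r c = X r (tperm a b c).
Proof. by rewrite /tperm_mx -[tperm _ _]invgK -col_permE mxE !tpermV. Qed.

Section Rows.
Variables (r : nat) (rn : (r < n)%N).
Let rr : 'I_n := Ordinal rn.
Let rn0 : (r <= n)%N := ltnW rn.
Let rn1 : (1 + r <= n)%N := rn.

Lemma minor_swap (L : 'M[k]_(r, n)) X (a b : 'I_n) : (a < r)%N -> (b < r)%N -> a != b ->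
  minor rn0 L (X *m tperm_mx a b) = - minor rn0 L X.
Proof.
move=> ar br ab; pose F Y := minor rn0 L (Y *m tperm_mx a b) + minor rn0 L Y.
apply/eqP; rewrite -addr_eq0; apply/eqP; rewrite -/(F X).
apply: (polynomial_eq0_GL kinf) => [|g].
  apply: polynomialD; last exact: polynomial_minor.
  exact/polynomial_mulr/polynomial_minor.
have sm := minor_semi_invariant rn0 L.
have key (a' b' : 'I_n) : (a' < b')%N -> (a' < r)%N -> (b' < r)%N ->
    minor rn0 L (GL_mx g *m tperm_mx a' b') = - minor rn0 L (GL_mx g).
  move=> lt a'r b'r.
  have e : first_ones r a' = first_ones r b' by rewrite /first_ones a'r b'r.
  have [_ ->] := col_add_same kinf 0 sm (Defs.GL_unit g) lt e.
  by rewrite /first_ones b'r mulN1r.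
have [lt|gt] := ltnP a b; first by rewrite /F key // addNr.
rewrite /F /tperm_mx tpermC -/(tperm_mx b a) key ?addNr //.
by rewrite ltn_neqAle gt andbT -(inj_eq val_inj) eq_sym in ab *.
Qed.

Lemma minor_col_add (L : 'M[k]_(r, n)) X t : (0 < r)%N ->
  minor rn0 L (X *m col_add ord0 rr t) =
  minor rn0 L X + t * minor rn0 L (X *m tperm_mx ord0 rr).
Proof.
move=> r0; pose F Y := minor rn0 L (Y *m col_add ord0 rr t) +
   (- 1) * (minor rn0 L Y + t * minor rn0 L (Y *m tperm_mx ord0 rr)).
apply/eqP; rewrite -subr_eq0 -mulN1r; apply/eqP; rewrite -/(F X).
apply: (polynomial_eq0_GL kinf) => [|g].
  apply: polynomialD; first exact/polynomial_mulr/polynomial_minor.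
  apply: polynomialM; first exact: polynomial_const.
  apply: polynomialD; first exact: polynomial_minor.
  apply: polynomialM; first exact: polynomial_const.
  exact/polynomial_mulr/polynomial_minor.
rewrite /F (col_add_drop kinf t (minor_semi_invariant rn0 L) (Defs.GL_unit g)) //.
- by rewrite mulN1r subrr.
- by rewrite /first_ones r0.
- by rewrite /first_ones ltnn.
Qed.

Lemma minor_laplace y (L : 'M[k]_(r, n)) X :
  minor rn1 (col_mx y L) X = \sum_(s < n | (s <= r)%N) (y *m X) ord0 s *
    ((-1) ^+ r * (-1) ^+ (s != rr) * minor rn0 L (X *m tperm_mx s rr)).
Proof.
rewrite /minor mul_col_mx det_expand_first_row.
rewrite [RHS](eq_bigl (fun s : 'I_n => (s < 1 + r)%N)) // (big_ord_narrow rn1).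
apply: eq_bigr => s _.
have wrr : widen_ord rn1 ord_max = rr by apply: val_inj.
have winj : injective (widen_ord rn1) by move=> a b /(congr1 val) /= /val_inj.
congr (_ * _).
  rewrite mxE (_ : ord0 = lshift r (ord0 : 'I_1)); last exact: val_inj.
  by rewrite col_mxEu.
rewrite -wrr (inj_eq winj) wrr; congr (_ * _); congr (\det _).
apply/matrixP => a b; rewrite mxE [LHS]mxE [RHS]mxE.
have -> : lift ord0 a = rshift 1 a by apply: val_inj.
rewrite col_mxEd mulmxA mul_tperm_mx; congr (fun_of_matrix _ _ _).
have -> : widen_ord rn0 b = widen_ord rn1 (lift ord_max b).
  by apply: val_inj; rewrite /= /bump leqNgt ltn_ord.
rewrite -wrr; case: tpermP => [->|->|/eqP ns /eqP nm]; rewrite ?tpermL ?tpermR //.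
by rewrite tpermD // (inj_eq winj) eq_sym.
Qed.

(** Evaluates the terms where the derivative hits the minor instead of the linear form: up to sign
    they are the same for all [s]. *)
Lemma minor_swap_swap (L : 'M[k]_(r, n)) X (s : 'I_n) : (0 < s)%N -> (s <= r)%N ->
  minor rn0 L (X *m tperm_mx s rr *m tperm_mx ord0 rr) =
  (-1) ^+ (s != rr) * minor rn0 L (X *m tperm_mx ord0 rr).
Proof.
move=> s0 sr; have [->|srr] := eqVneq s rr.
  by rewrite /tperm_mx tperm1 perm_mx1 mulmx1 mul1r.
have lt : (s < r)%N by rewrite ltn_neqAle sr andbT.
have e : (tperm s rr * tperm ord0 rr = tperm ord0 rr * tperm ord0 s)%g.
  have := tpermJ s rr (tperm ord0 rr); rewrite tpermR tpermD; last 2 first.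
  - by rewrite -val_eqE /= neq_ltn s0.
  - by rewrite eq_sym.
  by rewrite [tperm s ord0]tpermC => <-; rewrite conjgE !mulgA mulgV mul1g.
rewrite -!mulmxA -!perm_mxM e perm_mxM mulmxA mulN1r.
rewrite -/(tperm_mx ord0 s) (@minor_swap _ _ ord0 s) //.
  exact: (leq_ltn_trans (leq0n s) lt).
by rewrite -val_eqE /= neq_ltn s0.
Qed.

Lemma coef_extraction_poly m (c t : 'I_m -> k) d a (P : {poly k}) :
  (forall b, (b <= d)%N -> \sum_(l < m) c l * t l ^+ b = (b == a)%:R) ->
  (size P <= d.+1)%N -> (a <= d)%N -> \sum_(l < m) c l * P.[t l] = P`_a.
Proof.
move=> ct sP ad.
under eq_bigr => l _ do rewrite (horner_coef_wide _ sP) mulr_sumr.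
rewrite exchange_big /=.
have E (b : 'I_d.+1) : \sum_(l < m) c l * (P`_b * t l ^+ b) = P`_b * (b == a :> nat)%:R.
  rewrite -ct; last by rewrite -ltnS.
  by rewrite mulr_sumr; apply: eq_bigr => l _; rewrite mulrCA.
rewrite (eq_bigr _ (fun b _ => E b)).
rewrite (bigD1 (Ordinal (ad : (a < d.+1)%N))) //= eqxx mulr1 big1 ?addr0 // => b.
by rewrite -val_eqE /= => /negPf ->; rewrite mulr0.
Qed.

Lemma linear_coefficient (y0 y1 m0 m1 : k) q :
  ((y0%:P + y1 *: 'X) ^+ q * (m0%:P + m1 *: 'X))`_1 =
  q%:R * y0 ^+ q.-1 * y1 * m0 + y0 ^+ q * m1.
Proof.
rewrite -[LHS]mulr1n -coef_deriv -horner_coef0 derivM deriv_exp.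
rewrite !(derivD, derivC, derivZ, derivX) !add0r.
rewrite !(hornerD, hornerM, hornerMn, hornerZ, hornerC, horner_exp, hornerX).
by rewrite !mulr0 !addr0 !mulr1 -mulr_natl; ring.
Qed.

Hypotheses (r0 : (0 < r)%N) (rp : (r < p)%N).

(* The Koszul/de Rham differential, written as a combination of right
   translations: the sum over s of the derivative of the first column in the
   direction of column s, that column being replaced by column r.  The identity
   uses that degree (p - r) + 1 of the first column plus r - 1 is p = 0. *)
Lemma derivation_exists : exists Z : seq (k * 'M[k]_n),
  (forall u, u \in Z -> u.2 \in unitmx) /\
  forall y L X,
    \sum_(u <- Z) u.1 * bideterminant rn0 (linear_form y ^+ (p - r)) L (X *m u.2) =
    (p - r)%:R * bideterminant rn1 (linear_form y ^+ (p - r).-1) (col_mx y L) X.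
Proof.
have p1 : (1 <= p)%N by apply: leq_trans rp.
(* These scalars pick the coefficient of degree 1. The polynomials concerned have degree at most
   [p - r + 1], which is at most [p] because [0 < r]. *)
have [m [c [t ct]]] := coef_extraction kinf p1.
pose ss := [seq s : 'I_n <- index_enum 'I_n | (0 < s <= r)%N].
(* Column [s] is moved to position [r], just outside the minor, and [t] times it is added to the
   first column; the signs are those of [minor_laplace]. *)
pose Z := [seq ((-1) ^+ r * (-1) ^+ (s != rr) * c l,
    tperm_mx s rr *m col_add ord0 rr (t l)) | s <- ss, l <- index_enum 'I_m].
exists Z; split.
  move=> u /allpairsP[[s l] /= [_ _ ->]].
  rewrite unitmx_mul tperm_mx_unit col_add_unit // -val_eqE /= neq_ltn r0 //.
move=> y L X; rewrite big_allpairs_dep /=.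
set q := (p - r)%N; set Y := y *m X.
have inner s : s \in ss -> \sum_(l <- index_enum 'I_m) (-1) ^+ r * (-1) ^+ (s != rr) * c l *
    bideterminant rn0 (linear_form y ^+ q) L (X *m (tperm_mx s rr *m col_add ord0 rr (t l)))
  = (-1) ^+ r * (-1) ^+ (s != rr) * (q%:R * Y ord0 ord0 ^+ q.-1 * Y ord0 s *
       minor rn0 L (X *m tperm_mx s rr) +
     Y ord0 ord0 ^+ q * ((-1) ^+ (s != rr) * minor rn0 L (X *m tperm_mx ord0 rr))).
  rewrite mem_filter => /andP[/andP[s0 sr] _].
  rewrite -minor_swap_swap // -linear_coefficient.
  rewrite -(coef_extraction_poly ct) //; last first.
    apply: leq_trans (size_polyMleq _ _) _.
    have sl (a b : k) : (size (a%:P + b *: 'X)%R <= 2)%N.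
      apply: leq_trans (size_polyD _ _) _; rewrite geq_max.
      rewrite (leq_trans (size_polyC_leq1 _)) // (leq_trans (size_scale_leq _ _)) //.
      by rewrite size_polyX.
    have := size_poly_exp_leq ((Y ord0 ord0)%:P + Y ord0 s *: 'X) q.
    have := sl (Y ord0 ord0) (Y ord0 s).
    have := sl (minor rn0 L (X *m tperm_mx s rr))
               (minor rn0 L (X *m tperm_mx s rr *m tperm_mx ord0 rr)).
    set A := size _; set B := size _; set C := size _ => A2 B2 CB.
    have : (B.-1 * q <= 1 * q)%N by apply: leq_mul => //; lia.
    by rewrite /q; lia.
  rewrite mulr_sumr; apply: eq_bigr => l _; rewrite -mulrA; congr (_ * (_ * _)).
  rewrite bideterminant_power !mulmxA minor_col_add // hornerM horner_exp.
  rewrite !(hornerD, hornerC, hornerZ, hornerX) (mulrC _ (t l)) (mulrC _ (t l)).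
  congr (_ ^+ _ * _).
  rewrite mul_col_add eqxx mulr1n !mul_tperm_mx -/Y tpermR tpermD //.
    by rewrite -val_eqE /= neq_ltn s0 orbT.
  by rewrite -val_eqE /= neq_ltn r0 orbT.
under eq_big_seq => s ins do rewrite inner //.
rewrite bideterminant_power minor_laplace -/Y big_filter.
set M0 := minor rn0 L (X *m tperm_mx ord0 rr).
have z0 : (ord0 == rr) = false by rewrite -val_eqE /= ltn_eqF.
rewrite [in RHS](bigD1 ord0) //= z0.
rewrite (eq_bigr (fun s => q%:R * Y ord0 ord0 ^+ q.-1 *
    (Y ord0 s * ((-1) ^+ r * (-1) ^+ (s != rr) * minor rn0 L (X *m tperm_mx s rr)))
    + (-1) ^+ r * Y ord0 ord0 ^+ q * M0)) => [|s _]; last first.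
  by case: (s != rr); rewrite ?expr0 ?expr1; ring.
rewrite big_split /= -mulr_sumr [RHS]mulrA mulrDr addrC; congr (_ + _); last first.
  by congr (_ * _); apply: eq_bigl => s; rewrite lt0n -val_eqE /= andbC.
have card : #|[pred s : 'I_n | (0 < s <= r)%N]| = r.
  rewrite -sum1_card big_mkcond big_ord_recl /= add0n.
  rewrite -[RHS](card_ord r) -sum1_card (big_ord_widen N (fun=> 1%N)) // [RHS]big_mkcond.
  by apply: eq_bigr => s _; rewrite inE.
rewrite sumr_const card.
have q0 : (0 < q)%N by rewrite subn_gt0.
have -> : Y ord0 ord0 ^+ q = Y ord0 ord0 ^+ q.-1 * Y ord0 ord0.
  by rewrite -exprSr prednK.
(* The [r] equal terms from differentiating the minor thereby supply the summand [s = 0] of the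
   Laplace expansion, which [ss] leaves out. *)
have qr : q%:R = - r%:R :> k.
  by apply/eqP; rewrite -addr_eq0 -natrD subnK ?(ltnW rp) // (pcharf0 pchar).
by rewrite -[LHS]mulr_natl qr -/M0 expr1; clearbody M0 Y; ring.
Qed.

End Rows.
End Derivation.

(** * The modules induced from hooks *)

Lemma row_free_extension_add (k : fieldType) r m (L : 'M[k]_(r, r + m)) : row_free L ->
  exists2 h : 'M[k]_(r + m), h \in unitmx & usubmx h = L.
Proof.
move=> fL; exists (block_mx (col_ebase L) 0 0 1%:M *m row_ebase L).
  rewrite unitmx_mul row_ebase_unit andbT unitmxE det_lblock det1 mulr1.
  by rewrite -unitmxE col_ebase_unit.
rewrite -[RHS]mulmx_ebase -mul_usub_mx block_mxEv col_mxKu (eqP fL); congr (_ *m _).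
by rewrite pid_mx_row mul_mx_row mulmx1 mulmx0.
Qed.

Lemma row_free_extension (k : fieldType) n r (rn : (r <= n)%N) (L : 'M[k]_(r, n)) :
  row_free L -> exists2 h : 'M[k]_n, h \in unitmx & rowsub (widen_ord rn) h = L.
Proof.
have [m e] : exists m, n = (r + m)%N by exists (n - r)%N; rewrite subnKC.
subst n => /row_free_extension_add[h uh hE].
exists h => //; rewrite -hE; apply/matrixP => a b; rewrite !mxE; congr (h _ _).
exact: val_inj.
Qed.

Section HookModule.
Variables (k : fieldType) (N p : nat).
Hypotheses (kinf : unbounded k) (pchar : p \in [pchar k]).
Local Notation n := N.+1.
Local Notation G := (GL k n).

Definition rev_perm : 'S_n := perm (@rev_ord_inj n).
Definition w0 : G := exist (fun x => x \in unitmx) _ (unitmx_perm k rev_perm).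

Lemma w0K : (w0 * w0)%g = 1%g.
Proof.
apply: GL_mx_inj; rewrite GL_mxM -perm_mxM.
suff -> : (rev_perm * rev_perm)%g = 1%g by exact: perm_mx1.
by apply/permP => j; rewrite permM !permE rev_ordK.
Qed.

Lemma mulw0K (g : G) : (g * w0 * w0)%g = g.
Proof. by rewrite -mulgA w0K mulg1. Qed.

Lemma mul_w0E (X : 'M[k]_n) a b : (X *m GL_mx w0) a b = X a (rev_ord b).
Proof.
rewrite /= -[rev_perm]invgK -col_permE mxE; congr (X a _).
by apply: (@perm_inj _ rev_perm); rewrite permKV permE rev_ordK.
Qed.

Lemma w0_mulE (X : 'M[k]_n) a b : (GL_mx w0 *m X) a b = X (rev_ord a) b.
Proof. by rewrite /= -row_permE mxE permE. Qed.

Lemma w0_conj_diag (b : G) j : GL_mx (w0 * b * w0)%g j j = GL_mx b (rev_ord j) (rev_ord j).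
Proof. by rewrite GL_mxM mul_w0E GL_mxM w0_mulE. Qed.

Lemma w0_conj_lower (b : G) : is_trig_mx (GL_mx b)^T -> borel (w0 * b * w0)%g.
Proof.
move=> /is_trig_mxP tb; apply/is_trig_mxP => a c ac.
rewrite GL_mxM mul_w0E GL_mxM w0_mulE.
by have := tb (rev_ord c) (rev_ord a); rewrite mxE; apply; have := ltn_ord c; rewrite /=; move: ac; clear; lia.
Qed.

Lemma w0_conj_upper (b : G) : borel b -> is_trig_mx (GL_mx (w0 * b * w0)%g)^T.
Proof.
move=> /is_trig_mxP tb; apply/is_trig_mxP => a c ac.
rewrite mxE GL_mxM mul_w0E GL_mxM w0_mulE.
by apply: tb; have := ltn_ord c; rewrite /=; move: ac; clear; lia.
Qed.

Section Hook.
Variables (i : nat) (iN : (i <= N)%N) (ip : (i < p)%N).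
Let iN1 : (i.+1 <= n)%N := iN.

Definition hook_part (j : 'I_n) : nat := nth 0%N (hook p i) j.
Definition hook_nabla : (G -> k) -> Prop :=
  nabla_set (dual_weight (hook_weight n p i)).
Let q := (p - i.+1)%N.

Lemma hook_part0 : hook_part ord0 = q.+1.
Proof. by rewrite /hook_part /= /q; move: ip; clear; lia. Qed.

Lemma hook_part_lift (j : 'I_N) : hook_part (lift ord0 j) = (j < i)%N.
Proof. by rewrite /hook_part /= nth_nseq; case: ltnP. Qed.

Lemma hook_part_small (j : 'I_n) : (i < j)%N -> hook_part j = 0%N.
Proof.
by case: (unliftP ord0 j) => [l ->|-> //]; rewrite hook_part_lift lift0 ltnNge => /negPf ->.
Qed.

Lemma sum_hook_part : (\sum_j hook_part j = p)%N.
Proof.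
rewrite big_ord_recl hook_part0; under eq_bigr => j _ do rewrite hook_part_lift.
suff -> : (\sum_(j < N) (j < i) = i)%N by rewrite /q; move: ip; clear; lia.
rewrite -[RHS](card_ord i) -sum1_card (big_ord_widen N (fun=> 1%N)) // [RHS]big_mkcond.
by apply: eq_bigr => j _; case: ltnP.
Qed.

Lemma hook_weightE j : hook_weight n p i 0 j = (hook_part j)%:Z.
Proof. by rewrite !mxE. Qed.

Lemma dual_character (b : G) :
  (character (dual_weight (hook_weight n p i)) (w0 * b * w0)%g)^-1 =
  \prod_j GL_mx b j j ^+ hook_part j.
Proof.
rewrite /character -prodfV (reindex_inj rev_ord_inj) /=; apply: eq_bigr => j _.
by rewrite w0_conj_diag !rev_ordK !mxE rev_ordK -invr_expz invrK -exprnP.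
Qed.

(** Conjugation by [w0] exchanges lower and upper triangular matrices; the reversal and sign in
    [dual_weight] and the inverse in [nabla_set] then cancel, leaving the parts of the hook as
    exponents. *)
Lemma hook_nablaP (f : G -> k) : hook_nabla f <-> regular f /\
  forall g b : G, is_trig_mx (GL_mx b)^T ->
    f (g * b * w0)%g = \prod_j GL_mx b j j ^+ hook_part j * f (g * w0)%g.
Proof.
split=> -[rf uf]; split=> // g b tb.
  rewrite -dual_character -(uf _ _ (w0_conj_lower tb)); congr f.
  by rewrite !mulgA mulw0K.
have e : (w0 * (w0 * b * w0) * w0)%g = b by rewrite !mulgA w0K mul1g mulw0K.
rewrite -{1}e -mulgA.
have := uf (g * w0)%g (w0 * b * w0)%g (w0_conj_upper tb).
rewrite mulw0K -dual_character e => <-; congr f.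
by rewrite !mulgA.
Qed.

Lemma hook_nabla_comb (f : G -> k) m (c : 'I_m -> k) (t : 'I_m -> G) : hook_nabla f ->
  hook_nabla (fun g => \sum_(l < m) c l * f (t l * g)%g).
Proof.
move=> [rf uf]; split.
  by apply: regular_sum => l; apply: regular_left_translate.
move=> g b Bb; rewrite mulr_sumr; apply: eq_bigr => l _; rewrite mulgA (uf _ _ Bb).
exact: (@GRing.mulrCA k (c l)).
Qed.

(* Right translation by w0 exchanges the Borel subgroup of the negative roots,
   used to define the induced modules, and the upper triangular group. *)
Definition bid (F : {mpoly k[n]}) (L : 'M[k]_(i.+1, n)) (g : G) : k :=
  bideterminant iN1 F L (GL_mx (g * w0)%g).

Lemma regular_bid F L : regular (bid F L).
Proof.
exact: (regular_right_translate w0 (regular_polynomial (polynomial_bideterminant iN1 F L))).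
Qed.

(** On the first column the linear form contributes exponent [q] and the minor 1, together [p - i];
    the other [i] columns of the minor contribute 1 each. *)
Lemma bid_power_nabla y L : hook_nabla (bid (linear_form y ^+ q) L).
Proof.
apply/hook_nablaP; split; first exact: regular_bid.
move=> g b tb; rewrite /bid !mulw0K GL_mxM !bideterminant_power minor_upper //.
have -> : (y *m (GL_mx g *m GL_mx b)) ord0 ord0 = (y *m GL_mx g) ord0 ord0 * GL_mx b ord0 ord0.
  rewrite mulmxA mxE big_ord_recl big1 ?addr0 // => j _.
  have /is_trig_mxP/(_ ord0 (lift ord0 j) isT) := tb; rewrite mxE => ->.
  by rewrite mulr0.
rewrite exprMn big_ord_recl [in RHS]big_ord_recl hook_part0.
have -> : widen_ord iN1 ord0 = ord0 by apply: val_inj.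
have -> : \prod_(j < N) GL_mx b (lift ord0 j) (lift ord0 j) ^+ hook_part (lift ord0 j) =
   \prod_(j < i) GL_mx b (widen_ord iN1 (lift ord0 j)) (widen_ord iN1 (lift ord0 j)).
  under eq_bigr => j _ do rewrite hook_part_lift.
  rewrite (prod_first_ones iN (fun j => GL_mx b (lift ord0 j) (lift ord0 j))).
  apply: eq_bigr => j _; congr (GL_mx b _ _); exact: val_inj.
by rewrite exprS; ring.
Qed.

Record weight_part (alpha : weight n) (f : G -> k) : Prop := WeightPart {
  weight_part_nabla : hook_nabla f;
  weight_part_weight : forall t g, torus t -> f (t * g)%g = character alpha t * f g;
  weight_part_neq0 : exists g, f g != 0;
  weight_part_form : exists A : 'X_{1..n},
  [/\ forall j, alpha 0 j = (A j)%:Z, mdeg A = p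
   & forall m, (0 < A m)%N -> exists a : {ffun 'I_i -> 'I_N} -> k,
     (forall g, f g = \sum_rho a rho *
        bid 'X_[[multinom (A r - hook_count m rho r)%N | r < n]]
           (rowsub (hook_rows m rho) 1%:M) g) /\
     (forall rho, a rho != 0 ->
        injective rho /\ forall r, (hook_count m rho r <= A r)%N)] }.

Lemma weight_partI alpha f : hook_nabla f ->
  (forall t g, torus t -> f (t * g)%g = character alpha t * f g) ->
  (exists g, f g != 0) -> weight_part alpha f.
Proof.
move=> Vf wf nf; split=> //; have [rf uf] := (hook_nablaP f).1 Vf.
have [||A [AE dA AF]] := hook_weight_form kinf iN hook_part_lift
   (f := fun g => f (g * w0)%g) (alpha := alpha) (regular_right_translate w0 rf) uf.
- by move=> t g tt; rewrite -mulgA (wf _ _ tt).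
- by have [g fg] := nf; exists (g * w0)%g; rewrite mulw0K.
exists A; split=> //; first by rewrite dA sum_hook_part.
move=> m /AF[a [aE an0]]; exists a; split=> // g.
by have := aE (g * w0)%g; rewrite mulw0K.
Qed.

Lemma hook_nabla_decomposition f : hook_nabla f ->
  exists (W : seq (weight n)) (fam : weight n -> G -> k),
  [/\ uniq W, {in W, forall a, weight_part a (fam a)}, {in W, forall a, torus_comb f (fam a)}
    & forall g, f g = \sum_(a <- W) fam a g].
Proof.
move=> Vf; have [W [fam [uW tW wW fE]]] := weight_decomposition kinf (proj1 Vf).
pose nz a := `[< exists g, fam a g != 0 >].
exists [seq a <- W | nz a], fam; split.
- exact: filter_uniq.
- move=> a; rewrite mem_filter => /andP[/asboolP nza aW].
  apply: weight_partI => //; last by move=> t g tt; apply: wW.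
  have [m [c [t [tt ct]]]] := tW _ aW.
  have -> : fam a = fun g => \sum_(l < m) c l * f (t l * g)%g by apply/funext.
  exact: hook_nabla_comb.
- by move=> a; rewrite mem_filter => /andP[_ /tW].
move=> g; rewrite fE big_filter [RHS]big_mkcond /=; apply: eq_bigr => a _.
case: ifP => // /negbT/asboolPn nza; apply/eqP/negPn/negP => fn0.
by apply: nza; exists g.
Qed.

Definition hook_index : finType :=
  ('X_{1..n < p.+1} * 'I_n * {ffun 'I_i -> 'I_N})%type.
(** A finite spanning family, not a basis: no independence is claimed, and members of degree other
    than [q] need not lie in the induced module. It serves to bound ranks. *)
Definition hook_basis (u : hook_index) : G -> k :=
  bid 'X_[u.1.1] (rowsub (hook_rows u.1.2 u.2) 1%:M).

Lemma multinom_sub_deg (A : 'X_{1..n}) m (rho : {ffun 'I_i -> 'I_N}) :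
  (forall r, (hook_count m rho r <= A r)%N) -> mdeg A = p ->
  mdeg [multinom (A r - hook_count m rho r)%N | r < n] = q.
Proof.
move=> le dA; have sc : (\sum_r hook_count m rho r = i.+1)%N.
  rewrite exchange_big /= -[RHS](card_ord i.+1) -sum1_card; apply: eq_bigr => a _.
  by rewrite (bigD1 (hook_rows m rho a)) //= eqxx big1 // => r /negPf; rewrite eq_sym => ->.
apply/eqP; rewrite -(eqn_add2r i.+1) subnK // -{1}sc -dA !mdegE -big_split /=.
by apply/eqP; apply: eq_bigr => r _; rewrite mnmE subnK.
Qed.

Lemma weight_part_span alpha f : weight_part alpha f ->
  lin_comb (fun u : 'X_{1..n} * ('I_n * {ffun 'I_i -> 'I_N}) =>
    if mdeg u.1 == q then bid 'X_[u.1] (rowsub (hook_rows u.2.1 u.2.2) 1%:M) else fun=> 0) f.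
Proof.
case=> Vf _ [g0 fg0] [A [_ dA AF]].
have [m Am] : exists m, (0 < A m)%N.
  apply/existsP; apply: contraTT (ip) => /existsPn A0; rewrite -dA mdegE big1 // => j _.
  by apply/eqP; have := A0 j; rewrite lt0n negbK.
have [a [aE an0]] := AF m Am.
apply: (eq_lin_comb (fun g => esym (aE g))); apply: lin_comb_sum => rho _ _.
have [->|arho] := eqVneq (a rho) 0.
  by apply: (eq_lin_comb _ (lin_comb0 _)) => g; rewrite mul0r.
have [_ le] := an0 _ arho.
apply: lin_combZ; set gam := [multinom _ | r < n].
apply: (eq_lin_comb _ (lin_comb_gen _ (gam, (m, rho)))) => g /=.
by rewrite multinom_sub_deg // eqxx.
Qed.

Lemma hook_nabla_span f : hook_nabla f ->
  lin_comb (fun u : 'X_{1..n} * ('I_n * {ffun 'I_i -> 'I_N}) =>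
    if mdeg u.1 == q then bid 'X_[u.1] (rowsub (hook_rows u.2.1 u.2.2) 1%:M) else fun=> 0) f.
Proof.
move=> /hook_nabla_decomposition[W [fam [_ Wp _ fE]]].
apply: (eq_lin_comb (fun g => esym (fE g))); apply: lin_comb_sum => a aW _.
exact/weight_part_span/Wp.
Qed.

Lemma hook_nabla_finite_span f : hook_nabla f ->
  exists c : hook_index -> k, forall g, f g = \sum_u c u * hook_basis u g.
Proof.
move=> Vf; apply: lin_comb_fin; apply: lin_comb_trans (hook_nabla_span Vf) => -[gam [m rho]] /=.
case: eqP => dg; last exact: lin_comb0.
have lt : (mdeg gam < p.+1)%N by rewrite dg /q; move: ip; clear; lia.
exact: (lin_comb_gen hook_basis (BMultinom lt, m, rho)).
Qed.

Lemma hook_nabla_power_span f : hook_nabla f ->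
  lin_comb (fun u : 'rV[k]_n * 'M[k]_(i.+1, n) => bid (linear_form u.1 ^+ q) u.2) f.
Proof.
move=> Vf; apply: lin_comb_trans (hook_nabla_span Vf) => -[gam [m rho]] /=.
case: eqP => dg; last exact: lin_comb0.
have lt : (mdeg gam < p)%N by rewrite dg /q; move: ip; clear; lia.
have [s sE] := power_sum_monomial kinf pchar lt.
exists [seq (u.1, (u.2, rowsub (hook_rows m rho) 1%:M)) | u <- s] => g.
rewrite big_map /bid /bideterminant sE raddf_sum mulr_suml; apply: eq_bigr => u _ /=.
by rewrite mevalZ dg mulrA.
Qed.

Definition first_rows : 'M[k]_(i.+1, n) := rowsub (widen_ord iN1) 1%:M.
Definition hook_vector : G -> k := bid (linear_form (delta_mx 0 ord0) ^+ q) first_rows.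

Lemma hook_vector_nabla : hook_nabla hook_vector.
Proof. exact: bid_power_nabla. Qed.

Lemma hook_vector_w0 : hook_vector w0 = 1.
Proof.
rewrite /hook_vector /bid w0K bideterminant_power mulmx1 mxE !eqxx expr1n mul1r.
rewrite /minor mulmx1 -[RHS](det1 _ i.+1); congr (\det _); apply/matrixP => a b.
by rewrite !mxE.
Qed.

Definition hook_socle (f : G -> k) : Prop := lin_comb (fun h g => hook_vector (h * g)%g) f.

(** If [y] and the rows of [L] are independent, they are the top rows of an invertible [h], and the
    function is the translate of [hook_vector] by [h]; otherwise the minor vanishes. *)
Lemma hook_socle_bid y (L : 'M[k]_(i, n)) :
  hook_socle (bid (linear_form y ^+ q) (col_mx y L : 'M_(1 + i, n))).
Proof.
have [fL|nfL] := boolP (row_free (col_mx y L : 'M_(i.+1, n))).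
  have [h uh hE] := row_free_extension iN1 fL.
  exists [:: (1, to_GL h)] => g; rewrite big_seq1 mul1r /hook_vector /bid -mulgA.
  rewrite (GL_mxM (to_GL h)) to_GLK // !bideterminant_power minor_mull.
  rewrite mulmxA -rowE /first_rows -rowsubE hE; congr ((_ *m _) _ _ ^+ _ * _).
  apply/rowP => b; have := congr1 (fun M : 'M_(i.+1, n) => M ord0 b) hE.
  rewrite !mxE (_ : widen_ord iN1 ord0 = ord0); last exact: val_inj.
  by move=> ->; case: splitP => // j _; rewrite (ord1 j).
apply: (eq_lin_comb _ (lin_comb0 _)) => g.
rewrite /bid bideterminant_power /minor -mulmx_colsub; set M := _ *m colsub _ _.
suff -> : \det M = 0 by rewrite mulr0.
apply/eqP; apply: contraR nfL; rewrite -unitfE -unitmxE => /mxrank_unit rM.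
by rewrite /row_free eqn_leq rank_leq_row -{1}rM mxrankM_maxl.
Qed.

End Hook.
End HookModule.

(** * Weights of the induced module and its highest weight line *)

Section HookWeights.
Variables (k : fieldType) (N p : nat).
Hypotheses (kinf : unbounded k) (pchar : p \in [pchar k]).
Local Notation n := N.+1.
Local Notation G := (GL k n).
Variables (i : nat) (iN : (i <= N)%N) (ip : (i < p)%N).
Let iN1 : (i.+1 <= n)%N := iN.
Let q := (p - i.+1)%N.
Let lam := hook_weight n p i.

Lemma hook_rows_inj m (rho : {ffun 'I_i -> 'I_N}) :
  injective rho -> injective (hook_rows m rho).
Proof.
move=> rI a b; rewrite /hook_rows; case: unliftP => [c ->|->]; case: unliftP => [d ->|->] //.
- by move=> /lift_inj/rI ->.
- by move=> e; have := neq_lift m (rho c); rewrite e eqxx.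
- by move=> e; have := neq_lift m (rho d); rewrite -e eqxx.
Qed.

Lemma hook_count_ge m (rho : {ffun 'I_i -> 'I_N}) a :
  (0 < hook_count m rho (hook_rows m rho a))%N.
Proof. by rewrite /hook_count (bigD1 a) //= eqxx. Qed.

Lemma hook_count_inj m (rho : {ffun 'I_i -> 'I_N}) a : injective rho ->
  hook_count m rho (hook_rows m rho a) = 1%N.
Proof.
move=> rI; rewrite /hook_count (bigD1 a) // eqxx big1 // => b /negPf ba.
by rewrite (inj_eq (hook_rows_inj rI)) ba.
Qed.

(* Such a bideterminant involves the first i + 1 rows only, permuted. *)
Lemma bid_highest (A : 'X_{1..n}) (rho : {ffun 'I_i -> 'I_N}) :
  (forall j, A j = hook_part p i j) -> injective rho ->
  (forall r, (hook_count ord0 rho r <= A r)%N) ->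
  exists e : k, forall g,
    bid iN 'X_[[multinom (A r - hook_count ord0 rho r)%N | r < n]]
      (rowsub (hook_rows ord0 rho) 1%:M) g = e * hook_vector p iN g.
Proof.
move=> AE rI le.
have small a : (hook_rows ord0 rho a < i.+1)%N.
  rewrite ltnNge; apply/negP => /hook_part_small h.
  have := leq_trans (hook_count_ge ord0 rho a) (le _).
  by rewrite AE h.
pose sf a : 'I_i.+1 := Ordinal (small a).
have sI : injective sf by move=> a b /(congr1 val) /= /val_inj /(hook_rows_inj rI).
pose s := perm sI.
exists ((-1) ^+ s) => g; rewrite /hook_vector /bid bideterminantX bideterminant_power.
set X := GL_mx _; clearbody X.
rewrite mulrCA; congr (_ * _); last first.
  rewrite /minor /first_rows -!rowsubE -det_perm -det_mulmx -row_permE; congr (\det _).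
  by apply/matrixP => a b; rewrite !mxE permE; congr (X _ _); apply: val_inj.
rewrite (bigD1 ord0) //= big1 ?mulr1 => [|j j0].
  rewrite -rowE mxE; congr (_ ^+ _); rewrite mnmE AE (hook_part0 N ip).
  have -> : hook_count ord0 rho ord0 = 1%N.
    by rewrite -(hook_count_inj ord0 ord0 rI) /hook_rows unlift_none.
  by rewrite subSS subn0.
rewrite mnmE AE; suff -> : (hook_part p i j - hook_count ord0 rho j = 0)%N by [].
have [ji|ij] := ltnP j i.+1; last by rewrite hook_part_small.
have -> : hook_count ord0 rho j = 1%N.
  pose a := (s^-1)%g (Ordinal ji).
  suff <- : hook_rows ord0 rho a = j by exact: hook_count_inj.
  by have := congr1 val (permKV s (Ordinal ji)); rewrite permE => /= /val_inj.
case: (unliftP ord0 j) j0 => [l ->|-> //] _.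
by rewrite hook_part_lift; case: ltnP.
Qed.

Lemma weight_part_highest (f : G -> k) : weight_part p iN lam f ->
  exists e, forall g, f g = e * hook_vector p iN g.
Proof.
case=> _ _ _ [A [AE dA AF]].
have AE' j : A j = hook_part p i j.
  by have := AE j; rewrite hook_weightE => -[].
have A0 : (0 < A ord0)%N by rewrite AE' (hook_part0 N ip).
have [a [aE an0]] := AF ord0 A0.
have E rho : exists e, forall g, a rho *
    bid iN 'X_[[multinom (A r - hook_count ord0 rho r)%N | r < n]]
      (rowsub (hook_rows ord0 rho) 1%:M) g = e * hook_vector p iN g.
  have [->|/an0[rI le]] := eqVneq (a rho) 0.
    by exists 0 => g; rewrite !mul0r.
  have [e eE] := bid_highest AE' rI le.
  by exists (a rho * e) => g; rewrite eE mulrA.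
have [e eE] := choice E.
exists (\sum_rho e rho) => g; rewrite aE mulr_suml.
by apply: eq_bigr => rho _; rewrite eE.
Qed.

(** A finite list containing every weight of the induced module, so that one projector serves all
    its elements. *)
Definition degree_weights : seq (weight n) :=
  [seq \row_j (val (u j))%:Z | u : {ffun 'I_n -> 'I_p.+1} <- enum {: {ffun 'I_n -> 'I_p.+1}}].

Lemma degree_weightsP (A : 'X_{1..n}) (a : weight n) : (forall j, a 0 j = (A j)%:Z) ->
  (forall j, (A j <= p)%N) -> a \in degree_weights.
Proof.
move=> aA Ap; have lt j : (A j < p.+1)%N by rewrite ltnS.
apply/mapP; exists [ffun j => Ordinal (lt j)]; first by rewrite mem_enum.
by apply/rowP => j; rewrite mxE ffunE aA.
Qed.

Lemma weight_part_degree a (f : G -> k) : weight_part p iN a f -> a \in degree_weights.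
Proof.
case=> _ _ _ [A [AE dA _]]; apply: (degree_weightsP AE) => j.
by rewrite -dA mdegE (bigD1 j) //= leq_addr.
Qed.

Lemma hook_weight_degree : lam \in degree_weights.
Proof.
apply: (@degree_weightsP [multinom hook_part p i j | j < n]) => j.
  by rewrite hook_weightE mnmE.
rewrite mnmE; case: (unliftP ord0 j) => [l ->|->].
  by rewrite hook_part_lift; case: ltnP => _; move: ip; clear; lia.
by rewrite (hook_part0 N ip); move: ip; clear; lia.
Qed.

Lemma hook_nabla_w0 (f : G -> k) t : hook_nabla p i f -> torus t ->
  f (t * w0 k N)%g = character lam t * f (w0 k N).
Proof.
move=> /hook_nablaP[_ uf] tt.
have := uf 1%g t; rewrite !mul1g => ->; last first.
  by rewrite torusE // tr_diag_mx diag_mx_is_trig.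
congr (_ * _); apply: eq_bigr => j _.
by rewrite hook_weightE.
Qed.

(* The highest weight space of the induced module is a line, and an element of
   it is determined by its value at w_0. *)
Lemma hook_projector : exists m (c : 'I_m -> k) (t : 'I_m -> G),
  (forall l, torus (t l)) /\ forall f, hook_nabla p i f ->
    forall g, \sum_(l < m) c l * f (t l * g)%g = f (w0 k N) * hook_vector p iN g.
Proof.
have [m [c [t [tt ct]]]] := weight_projector kinf hook_weight_degree.
exists m, c, t; split=> // f Vf g.
have [W [fam [uW Wp _ fE]]] := hook_nabla_decomposition kinf iN ip Vf.
pose h g := \sum_(l < m) c l * f (t l * g)%g.
have hE g' : h g' = \sum_(a <- W) (a == lam)%:R * fam a g'.
  rewrite /h; under eq_bigr => l _ do rewrite fE mulr_sumr.
  rewrite exchange_big /= !big_seq; apply: eq_bigr => a aW.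
  rewrite -ct; last exact: weight_part_degree (Wp _ aW).
  rewrite mulr_suml; apply: eq_bigr => l _.
  by rewrite (weight_part_weight (Wp _ aW)) // mulrA.
have [e eE] : exists e, forall g, h g = e * hook_vector p iN g.
  have [lW|lW] := boolP (lam \in W); last first.
    exists 0 => g'; rewrite hE mul0r big_seq big1 // => a aW.
    by case: eqP => [al|_]; [rewrite -al aW in lW | rewrite mul0r].
  have [e eE] := weight_part_highest (Wp _ lW); exists e => g'.
  rewrite hE (bigD1_seq lam) //= eqxx mul1r eE big1 ?addr0 // => a /negPf ->.
  by rewrite mul0r.
rewrite -/(h g) eE; congr (_ * _).
have := eE (w0 k N); rewrite hook_vector_w0 mulr1 => <-.
rewrite /h; under eq_bigr => l _ do rewrite hook_nabla_w0 // mulrA.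
by rewrite -mulr_suml ct ?hook_weight_degree // eqxx mul1r.
Qed.

End HookWeights.

Section Dominance.
Variable n : nat.
Implicit Types (mu nu : weight n).

Lemma weight_le_refl mu : weight_le mu mu.
Proof.
by exists (fun _ _ => 0%N); rewrite subrr big1 // => a _; rewrite big1.
Qed.

Lemma weight_leD mu mu' nu nu' : weight_le mu nu -> weight_le mu' nu' ->
  weight_le (mu + mu') (nu + nu').
Proof.
move=> [c cE] [d dE]; exists (fun a b => (c a b + d a b)%N).
rewrite opprD addrACA cE dE -big_split /=; apply: eq_bigr => a _.
by rewrite -big_split /=; apply: eq_bigr => b _; rewrite mulrnDr.
Qed.

Lemma weight_le_sum (I : Type) (r : seq I) (P : pred I) (F H : I -> weight n) :
  (forall a, P a -> weight_le (F a) (H a)) ->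
  weight_le (\sum_(a <- r | P a) F a) (\sum_(a <- r | P a) H a).
Proof.
move=> FH; elim/big_rec2: _ => [|a x y Pa]; first exact: weight_le_refl.
by apply: weight_leD; apply: FH.
Qed.

Definition unit_weight (a : 'I_n) : weight n := delta_mx 0 a.

Lemma unit_weight_le (a b : 'I_n) : (a <= b)%N -> weight_le (unit_weight b) (unit_weight a).
Proof.
rewrite leq_eqVlt => /orP[/eqP/val_inj ->|ab]; first exact: weight_le_refl.
exists (fun c d => (c == a) && (d == b) : nat).
rewrite [RHS](bigD1 a) //= [X in _ = _ + X]big1 => [|c /negPf ca]; last first.
  by rewrite big1 // => d _; rewrite ca mulr0n.
rewrite addr0 [RHS](bigD1 b) //= !eqxx mulr1n [X in _ = _ + X]big1 ?addr0 // => d /andP[_ /negPf db].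
by rewrite db mulr0n.
Qed.

(** Induction removes the largest element [b] of [s]; counting the elements up to [b] shows that its
    index is at least that of the last of the first positions. *)
Lemma weight_le_set (s : {set 'I_n}) m (mn : (m <= n)%N) : #|s| = m ->
  weight_le (\sum_(b in s) unit_weight b) (\sum_(a < m) unit_weight (widen_ord mn a)).
Proof.
elim: m s mn => [|m IH] s mn sm.
  rewrite big_ord0 (cards0_eq sm) big_set0; exact: weight_le_refl.
have /finset.set0Pn[b0 b0s] : s != finset.set0 by rewrite -card_gt0 sm.
pose b := [arg max_(b > b0 | b \in s) (b : nat)].
have [bs bmax] : b \in s /\ forall c, c \in s -> (c <= b)%N.
  by rewrite /b; case: arg_maxnP.
rewrite big_ord_recr (big_setD1 b) //= addrC; apply: weight_leD.
  have := IH (s :\ b) (ltnW mn); rewrite (cardsD1 b s) bs in sm; case: sm => sm /(_ sm).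
  by congr weight_le; apply: eq_bigr => a _; congr unit_weight; apply: val_inj.
apply: unit_weight_le => /=; rewrite -ltnS -sm.
have : s \subset [set c : 'I_n | (c < b.+1)%N].
  by apply/fintype.subsetP => c cs; rewrite inE ltnS bmax.
move=> /subset_leq_card /leq_trans; apply.
rewrite -sum1_card (eq_bigl (fun c : 'I_n => (c < b.+1)%N)) => [|c]; last by rewrite inE.
by rewrite (big_ord_narrow (ltn_ord b)) sum1_card card_ord.
Qed.

End Dominance.

(** The weight splits into [i.+1] distinct unit weights, taken at the values of [J], and [p - i.+1]
    further ones. The former are compared with the first [i.+1] unit weights, each of the latter
    with the first. *)
Lemma hook_dominates (N p i : nat) (iN : (i <= N)%N) (A : 'X_{1..N.+1}) (a : weight N.+1)
    (J : 'I_i.+1 -> 'I_N.+1) : (i < p)%N ->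
  (forall j, a 0 j = (A j)%:Z) -> mdeg A = p -> injective J -> (forall b, (0 < A (J b))%N) ->
  weight_le a (hook_weight N.+1 p i).
Proof.
move=> ip aE dA JI AJ.
pose s := [set J b | b : 'I_i.+1].
have sm : #|s| = i.+1 by rewrite card_imset // card_ord.
have iN1 : (i.+1 <= N.+1)%N by [].
pose B j := (A j - (j \in s))%N.
have AB j : A j = (B j + (j \in s))%N.
  rewrite subnK //; case: imsetP => // -[b _ ->]; exact: AJ.
have sB : (\sum_j B j = p - i.+1)%N.
  apply/eqP; rewrite -(eqn_add2r i.+1) subnK // -{1}sm -dA mdegE -sum1_card.
  by rewrite [in X in (_ + X)%N]big_mkcond -big_split /=; apply/eqP/eq_bigr => j _; rewrite AB; case: (_ \in _).
have -> : a = \sum_j unit_weight j *+ B j + \sum_(j in s) unit_weight j.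
  apply/rowP => j; rewrite mxE !summxE aE AB PoszD; congr (_ + _).
    rewrite (bigD1 j) //= mulmxnE mxE !eqxx big1 ?addr0 ?natz // => l /negPf lj.
    by rewrite mulmxnE mxE eq_sym lj mul0rn.
  case: (boolP (j \in s)) => js.
    rewrite (bigD1 j) //= mxE !eqxx big1 ?addr0 // => l /andP[_ /negPf lj].
    by rewrite mxE eq_sym lj.
  rewrite big1 // => l ls; rewrite mxE eqxx; have [e|//] := eqVneq j l.
  by rewrite e ls in js.
have -> : hook_weight N.+1 p i = \sum_(j < N.+1) unit_weight ord0 *+ B j +
    \sum_(b < i.+1) unit_weight (widen_ord iN1 b).
  rewrite sumrMnr sB; apply/rowP => j; rewrite hook_weightE mxE mulmxnE summxE.
  have -> : \sum_(b < i.+1) unit_weight (widen_ord iN1 b) 0 j = (j < i.+1)%N%:Z.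
    case: ltnP => ji.
      rewrite (bigD1 (Ordinal ji)) //= mxE eqxx big1 => [|b bj].
        by rewrite addr0 (_ : j == _) //; apply/eqP/val_inj.
      rewrite mxE eqxx; have [e|//] := eqVneq j (widen_ord iN1 b).
      by case/eqP: bj; apply: val_inj; rewrite /= e.
    rewrite big1 // => b _; rewrite mxE eqxx; have [e|//] := eqVneq j (widen_ord iN1 b).
    by have := ltn_ord b; rewrite ltnNge; move: ji; rewrite e /= => ->.
  rewrite mxE eqxx /=; case: (unliftP ord0 j) => [l ->|->].
    by rewrite hook_part_lift eq_sym (negPf (neq_lift _ _)) mul0rn add0r lift0 ltnS.
  by rewrite (hook_part0 N ip) eqxx -[_.+1]addn1 PoszD pmulrn intz.
apply: weight_leD; last exact: weight_le_set.
apply: weight_le_sum => j _; elim: (B j) => [|m IH].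
  rewrite !mulr0n; exact: weight_le_refl.
by rewrite !mulrS; apply: weight_leD IH; apply: unit_weight_le.
Qed.

(** * Exactness of the differential *)

Section ConsRows.
Variables (k : fieldType) (N : nat).
Hypothesis kinf : unbounded k.
Local Notation n := N.+1.

Definition cons_rows r (j : 'I_n) (h : 'I_r -> 'I_n) (a : 'I_r.+1) : 'I_n :=
  if unlift ord0 a is Some c then h c else j.

Lemma cons_rows0 r j (h : 'I_r -> 'I_n) : cons_rows j h ord0 = j.
Proof. by rewrite /cons_rows unlift_none. Qed.

Lemma cons_rowsS r j (h : 'I_r -> 'I_n) a : cons_rows j h (lift ord0 a) = h a.
Proof. by rewrite /cons_rows liftK. Qed.

Lemma col_mx_delta r j (h : 'I_r -> 'I_n) :
  (col_mx (delta_mx 0 j : 'rV[k]_n) (rowsub h 1%:M) : 'M[k]_(r.+1, n)) = rowsub (cons_rows j h) 1%:M.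
Proof.
apply/matrixP => a b; rewrite [RHS]mxE; case: (unliftP ord0 a) => [c ->|->].
  rewrite cons_rowsS (_ : lift ord0 c = rshift 1 c); last exact: val_inj.
  by apply: (etrans (col_mxEd _ _ c b)); rewrite mxE.
rewrite cons_rows0 (_ : ord0 = lshift r (ord0 : 'I_1)); last exact: val_inj.
by apply: (etrans (col_mxEu _ _ ord0 b)); rewrite !mxE eqxx eq_sym.
Qed.

Lemma minor_col_mx_linear r (rn : (r < n)%N) (y : 'rV[k]_n) (L : 'M[k]_(r, n)) X :
  minor (rn : (1 + r <= n)%N) (col_mx y L) X =
  \sum_j y 0 j * minor (rn : (1 + r <= n)%N) (col_mx (delta_mx 0 j : 'rV[k]_n) L) X.
Proof.
rewrite minor_laplace.
under [RHS]eq_bigr => j _ do rewrite minor_laplace mulr_sumr.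
rewrite exchange_big /=; apply: eq_bigr => s _.
rewrite mxE mulr_suml; apply: eq_bigr => j _.
by rewrite -rowE [row _ _ _ _]mxE mulrA.
Qed.

Lemma mderiv_linear_form_power (y : 'rV[k]_n) d j :
  (linear_form y ^+ d)^`M(j) = (d%:R * y 0 j) *: linear_form y ^+ d.-1.
Proof.
have d1 : (linear_form y)^`M(j) = (y 0 j)%:MP.
  rewrite raddf_sum (bigD1 j) //= big1 => [|c cj].
    rewrite addr0 mderivZ mderivX mnm1E eqxx scale1r.
    rewrite (_ : (U_(j) - U_(j))%MM = 0%MM) ?mpolyX0 ?alg_mpolyC //.
    by apply/mnmP => c; rewrite mnmBE subnn mnm0E.
  by rewrite mderivZ mderivX mnm1E (negPf cj) scale0r scaler0.
elim: d => [|d IH]; first by rewrite expr0 mderivC mul0r scale0r.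
rewrite exprS mderivM d1 IH mul_mpolyC -scalerAr -exprS.
case: d {IH} => [|d]; first by rewrite expr0 mul0r scale0r addr0 mul1r.
by rewrite -scalerDl; congr (_ *: _); rewrite [d.+2%:R]mulrS; ring.
Qed.

(** The de Rham form of the differential, with wedging by a basis vector written as prepending a
    row. It makes sense for forms of every degree, and monomials can be fed to it directly. *)
Definition diff_bideterminant r (rn : (r < n)%N) (F : {mpoly k[n]}) (L : 'M[k]_(r, n)) X : k :=
  \sum_j bideterminant (rn : (1 + r <= n)%N) F^`M(j) (col_mx (delta_mx 0 j : 'rV[k]_n) L) X.

Lemma diff_bideterminant_power r (rn : (r < n)%N) y d (L : 'M[k]_(r, n)) X :
  diff_bideterminant rn (linear_form y ^+ d) L X =
  d%:R * bideterminant (rn : (1 + r <= n)%N) (linear_form y ^+ d.-1) (col_mx y L) X.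
Proof.
rewrite /bideterminant minor_col_mx_linear !mulr_sumr; apply: eq_bigr => j _.
by rewrite /bideterminant mderiv_linear_form_power mevalZ; ring.
Qed.

Lemma diff_bideterminant_sum r (rn : (r < n)%N) (s : seq (k * 'rV[k]_n)) d L X :
  diff_bideterminant rn (\sum_(u <- s) u.1 *: linear_form u.2 ^+ d) L X =
  \sum_(u <- s) u.1 * (d%:R *
    bideterminant (rn : (1 + r <= n)%N) (linear_form u.2 ^+ d.-1) (col_mx u.2 L) X).
Proof.
under [RHS]eq_bigr => u _ do rewrite -diff_bideterminant_power mulr_sumr.
rewrite exchange_big /=; apply: eq_bigr => j _.
rewrite /bideterminant (raddf_sum (mderiv j)) /= (raddf_sum (meval _)) mulr_suml.
by apply: eq_bigr => u _ /=; rewrite mderivZ mevalZ mulrA.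
Qed.

Lemma diff_bideterminantX r (rn : (r < n)%N) (gam : 'X_{1..n}) (h : 'I_r -> 'I_n) X :
  diff_bideterminant rn 'X_[gam] (rowsub h 1%:M) X =
  \sum_j (gam j)%:R * \prod_c X c ord0 ^+ (gam - U_(j))%MM c *
    minor (rn : (1 + r <= n)%N) (rowsub (cons_rows j h) 1%:M) X.
Proof.
apply: eq_bigr => j _; rewrite /bideterminant mderivX mevalZ mevalX.
by rewrite -col_mx_delta.
Qed.

(** The unit vector of row [m] becomes the second column and the later columns move right;
    evaluating a larger minor here realizes contraction with row [m]. *)
Definition insert_column (m : 'I_n) (X : 'M[k]_n) : 'M[k]_n := \matrix_(r, c)
  if c == 0%N :> nat then X r ord0 else if c == 1%N :> nat then (r == m)%:R
  else X r (inord c.-1).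

(* Expansion along the inserted column. *)
Lemma minor_insert_column r (rn : (r.+1 < n)%N) m (h : 'I_r -> 'I_n) j X :
  (forall a, h a != m) ->
  minor (rn : (1 + r.+1 <= n)%N) (rowsub (cons_rows j (cons_rows m h)) 1%:M)
    (insert_column m X) =
  (j != m)%:R * minor (ltnW rn : (1 + r <= n)%N) (rowsub (cons_rows j h) 1%:M) X.
Proof.
move=> hm; rewrite /minor -!rowsubE.
set M := colsub _ _; have ME a b : M a b =
    insert_column m X (cons_rows j (cons_rows m h) a) (widen_ord (rn : (1 + r.+1 <= n)%N) b).
  by rewrite /M !mxE.
have [jm|jm] := eqVneq j m; rewrite ?mul0r ?mul1r.
  apply: (@determinant_alternate _ _ M ord0 (lift ord0 ord0)) => // b.
  by rewrite !ME cons_rows0 cons_rowsS cons_rows0 jm.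
pose c1 : 'I_r.+2 := lift ord0 ord0.
have col1 a : M a c1 = (cons_rows j (cons_rows m h) a == m)%:R by rewrite ME mxE.
rewrite (expand_det_col _ c1) (bigD1 c1) //= big1 ?addr0 => [|a ac]; last first.
  rewrite col1; case: (unliftP ord0 a) ac => [b ->|->]; rewrite ?cons_rows0 ?cons_rowsS.
    case: (unliftP ord0 b) => [c ->|->]; last by rewrite eqxx.
    by rewrite cons_rowsS (negPf (hm c)) mul0r.
  by rewrite (negPf jm) mul0r.
rewrite col1 cons_rowsS cons_rows0 eqxx mul1r /cofactor -signr_odd /= mul1r.
congr (\det _); apply/matrixP => a b; rewrite [LHS]mxE [LHS]mxE ME [RHS]mxE [RHS]mxE [LHS]mxE.
have -> : cons_rows j (cons_rows m h) (lift c1 a) = cons_rows j h a.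
  case: (unliftP ord0 a) => [c ->|->].
    rewrite (_ : lift c1 (lift ord0 c) = lift ord0 (lift ord0 c)); last exact: val_inj.
    by rewrite !cons_rowsS.
  rewrite (_ : lift c1 ord0 = ord0); last exact: val_inj.
  by rewrite !cons_rows0.
case: (unliftP ord0 b) => [c ->|->] /=.
  congr (X _ _); apply: val_inj; rewrite /= inordK //.
  by rewrite /bump /=; apply: (leq_ltn_trans _ (rn : (r.+1 < n)%N)); exact: (leq_trans (ltn_ord c) (leqnSn r)).
by congr (X _ _); apply: val_inj.
Qed.

End ConsRows.

Section Differential.
Variables (k : fieldType) (N p : nat).
Hypotheses (kinf : unbounded k) (pchar : p \in [pchar k]).
Local Notation n := N.+1.
Local Notation G := (GL k n).

Definition right_comb (Z : seq (k * G)) (f : G -> k) (g : G) : k :=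
  \sum_(u <- Z) u.1 * f (g * u.2)%g.

Lemma right_comb_lin Z (I : Type) (s : seq (k * I)) (b : I -> G -> k) f :
  (forall g, f g = \sum_(u <- s) u.1 * b u.2 g) ->
  forall g, right_comb Z f g = \sum_(u <- s) u.1 * right_comb Z (b u.2) g.
Proof.
move=> fE g; rewrite /right_comb; under eq_bigr => u _ do rewrite fE mulr_sumr.
rewrite exchange_big /=; apply: eq_bigr => v _.
by rewrite mulr_sumr; apply: eq_bigr => u _; rewrite mulrCA.
Qed.

Lemma hook_derivation i (iN : (i < N)%N) (ip : (i.+1 < p)%N) : exists Z : seq (k * G),
  forall y (L : 'M[k]_(i.+1, n)) g,
    right_comb Z (bid (ltnW iN) (linear_form y ^+ (p - i.+1)) L) g =
    (p - i.+1)%:R * bid iN (linear_form y ^+ (p - i.+2)) (col_mx y L : 'M_(i.+2, n)) g.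
Proof.
have [Z [uZ ZE]] := derivation_exists kinf pchar (iN : (i.+1 < n)%N) (ltn0Sn i) ip.
exists [seq (u.1, (w0 k N * to_GL u.2 * w0 k N)%g) | u <- Z] => y L g.
rewrite /right_comb big_map (subnS p i.+1).
apply: etrans (etrans (ZE y L (GL_mx (g * w0 k N)%g)) _); last first.
  by congr (_ * bideterminant _ _ _ _); apply: bool_irrelevance.
rewrite !big_seq; apply: eq_bigr => u uin; congr (_ * _); rewrite /bid.
rewrite !mulgA mulw0K (GL_mxM (g * w0 k N)%g) to_GLK ?uZ //.
by congr (bideterminant _ _ _ _); apply: bool_irrelevance.
Qed.

End Differential.

(** * Image and kernel of the differential *)

Section HookDifferential.
Variables (k : fieldType) (N p : nat).
Hypotheses (kinf : unbounded k) (pchar : p \in [pchar k]).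
Local Notation n := N.+1.
Local Notation G := (GL k n).

Section SocleGenerators.
Variables (i : nat) (iN : (i <= N)%N) (ip : (i < p)%N).
Let q := (p - i.+1)%N.

Lemma hook_socle_nabla (f : G -> k) : hook_socle p iN f -> hook_nabla p i f.
Proof.
move=> [s sE]; pose c (l : 'I_(size s)) := (nth (0, 1%g) s l).1.
pose t (l : 'I_(size s)) := (nth (0, 1%g) s l).2.
have -> : f = fun g => \sum_(l < size s) c l * hook_vector p iN (t l * g)%g.
  by apply/funext => g; rewrite sE (big_nth (0, 1%g)) big_mkord.
exact/hook_nabla_comb/hook_vector_nabla.
Qed.

Lemma hook_socle_lin (I : Type) (s : seq (k * I)) (b : I -> G -> k) (f : G -> k) :
  (forall u, hook_socle p iN (b u)) ->
  (forall g, f g = \sum_(u <- s) u.1 * b u.2 g) -> hook_socle p iN f.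
Proof. by move=> bS fE; apply: (lin_comb_trans bS); exists s. Qed.

(* By polarization the differential of a form of degree < p is a combination
   of the generators of the socle; in degree p only functions occur, and
   there the differential vanishes by Euler's identity. *)
Lemma diff_bideterminant_socle (gam : 'X_{1..n}) (h : 'I_i -> 'I_n) (iN' : (i < n)%N) :
  mdeg gam = q.+1 -> hook_socle p iN (fun g =>
    diff_bideterminant iN' 'X_[gam] (rowsub h 1%:M) (GL_mx (g * w0 k N)%g)).
Proof.
move=> dg; case: (posnP i) => [i0|i_gt0].
  apply: (eq_lin_comb _ (lin_comb0 _)) => g; set X := GL_mx _; clearbody X.
  rewrite diff_bideterminantX.
  have E j : minor (iN' : (1 + i <= n)%N) (rowsub (cons_rows j h) 1%:M) X = X j ord0.
    rewrite /minor -rowsubE.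
    move: h iN'; rewrite i0 => h iN'.
    by rewrite det_mx11 !mxE; congr (X _ _); [rewrite /cons_rows; case: unliftP => // -[] | apply: val_inj].
  under eq_bigr => j _ do rewrite E.
  have F j : (gam j)%:R * \prod_c X c ord0 ^+ (gam - U_(j))%MM c * X j ord0 =
      (gam j)%:R * \prod_c X c ord0 ^+ gam c.
    case: (posnP (gam j)) => [->|gj]; first by rewrite !mul0r.
    rewrite -mulrA; congr (_ * _); rewrite (bigD1 j) //= [RHS](bigD1 j) //= mulrAC.
    congr (_ * _).
      by rewrite -exprSr mnmBE mnm1E eqxx subn1 prednK.
    by apply: eq_bigr => c /negPf cj; rewrite mnmBE mnm1E eq_sym cj subn0.
  under eq_bigr => j _ do rewrite F.
  rewrite -mulr_suml -natr_sum -mdegE dg /q i0.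
  have -> : (p - 1).+1 = p by move: ip; rewrite i0; clear; lia.
  by rewrite (pcharf0 pchar) mul0r.
have lt : (mdeg gam < p)%N by rewrite dg /q; move: ip i_gt0; clear; lia.
have [s sE] := power_sum_monomial kinf pchar lt.
apply: (@hook_socle_lin _ [seq (u.1 * q.+1%:R, u.2) | u <- s]
  (fun y => bid iN (linear_form y ^+ q) (col_mx y (rowsub h 1%:M) : 'M_(1 + i, n)))).
  by move=> y; apply: hook_socle_bid.
move=> g; rewrite sE diff_bideterminant_sum big_map dg; apply: eq_bigr => u _.
rewrite /= mulrA /bid; congr (_ * bideterminant _ _ _ _); exact: bool_irrelevance.
Qed.

End SocleGenerators.

Section Differential.
Variables (i : nat) (iN : (i < N)%N) (ip : (i.+1 < p)%N).
Let iN0 : (i <= N)%N := ltnW iN.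
Let ip0 : (i < p)%N := ltnW ip.
Let q := (p - i.+1)%N.
Variable Z : seq (k * G).
Hypothesis ZE : forall y (L : 'M[k]_(i.+1, n)) g,
    right_comb Z (bid iN0 (linear_form y ^+ q) L) g =
    q%:R * bid iN (linear_form y ^+ (p - i.+2)) (col_mx y L : 'M_(i.+2, n)) g.
Let D := right_comb Z.

Lemma differential_socle (f : G -> k) : hook_nabla p i f -> hook_socle p iN (D f).
Proof.
move=> /(hook_nabla_power_span kinf pchar iN0 ip0)[s sE].
pose b (u : 'rV[k]_n * 'M[k]_(i.+1, n)) := bid iN0 (linear_form u.1 ^+ q) u.2.
apply: (hook_socle_lin (b := fun u => D (b u)) _ (right_comb_lin Z (b := b) sE)).
move=> [y L]; apply: (eq_lin_comb (f := fun g =>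
  q%:R * bid iN (linear_form y ^+ (p - i.+2)) (col_mx y L : 'M_(i.+2, n)) g)).
  by move=> g; rewrite -ZE.
by apply: lin_combZ; apply: hook_socle_bid.
Qed.

(** The linear form of [hook_vector] is already the first row of its minor, so the differential
    repeats a row. *)
Lemma differential_hook_vector g : D (hook_vector p iN0) g = 0.
Proof.
rewrite /D /hook_vector ZE /bid bideterminant_power /first_rows col_mx_delta /minor -rowsubE.
set M := colsub _ _.
suff -> : \det M = 0 by rewrite !mulr0.
apply: (@determinant_alternate _ _ M ord0 (lift ord0 ord0)) => // b.
rewrite /M [LHS]mxE [LHS]mxE [RHS]mxE [RHS]mxE cons_rows0 cons_rowsS.
by congr (GL_mx _ _ _); apply: val_inj.
Qed.

(** The minor uses rows 1 to [i.+1], so that prepending row 0 of the linear form gives exactly the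
    rows of the next highest weight vector. *)
Definition hook_preimage : G -> k := bid iN0 (linear_form (delta_mx 0 ord0) ^+ q)
  (rowsub (fun a : 'I_i.+1 => inord a.+1) 1%:M).

Lemma hook_preimage_nabla : hook_nabla p i hook_preimage.
Proof. exact: bid_power_nabla. Qed.

Lemma differential_preimage g : D hook_preimage g = q%:R * hook_vector p iN g.
Proof.
rewrite /D /hook_preimage ZE; congr (_ * bid _ _ _ _).
rewrite (col_mx_delta k ord0) /first_rows; congr (rowsub _ _); apply/funext => a.
apply: val_inj; case: (unliftP ord0 a) => [c ->|->]; last by rewrite cons_rows0.
rewrite cons_rowsS /= inordK //; exact: leq_trans (ltn_ord c) iN.
Qed.

Lemma differential_degree_neq0 : q%:R != 0 :> k.
Proof. by apply: (pchar_natr_neq0 pchar); rewrite /q; move: ip; clear; lia. Qed.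

Lemma differential_monomial (gam : 'X_{1..n}) (h : 'I_i.+1 -> 'I_n) g : mdeg gam = q ->
  D (bid iN0 'X_[gam] (rowsub h 1%:M)) g =
  diff_bideterminant (iN : (i.+1 < n)%N) 'X_[gam] (rowsub h 1%:M) (GL_mx (g * w0 k N)%g).
Proof.
move=> dg; have lt : (mdeg gam < p)%N by rewrite dg /q; move: ip; clear; lia.
have [s sE] := power_sum_monomial kinf pchar lt; rewrite dg in sE.
rewrite sE diff_bideterminant_sum.
have fE g' : bid iN0 'X_[gam] (rowsub h 1%:M) g' =
   \sum_(u <- s) u.1 * bid iN0 (linear_form u.2 ^+ q) (rowsub h 1%:M) g'.
  rewrite /bid /bideterminant sE (raddf_sum (meval _)) mulr_suml; apply: eq_bigr => u _.
  by rewrite /= mevalZ mulrA.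
rewrite -sE /D (right_comb_lin Z (b := fun y => bid iN0 (linear_form y ^+ q) _) fE); apply: eq_bigr => u _; rewrite ZE.
by rewrite (subnS p i.+1).
Qed.

(* Exactness of the complex at a weight alpha: if alpha_m is nonzero in k,
   contraction with x_m d/dx_m is a homotopy between alpha_m and 0. *)
Lemma weight_part_kernel alpha (f : G -> k) : weight_part p iN0 alpha f ->
  (forall g, D f g = 0) -> hook_socle p iN0 f.
Proof.
case=> Vf _ [g0 fg0] [A [_ dA AF]] Df0.
have [m Am] : exists m, (0 < A m)%N.
  apply/existsP; apply: contraTT (ip0) => /existsPn A0; rewrite -dA mdegE big1 // => j _.
  by apply/eqP; have := A0 j; rewrite lt0n negbK.
have [a [aE an0]] := AF m Am.
pose gam (rho : {ffun 'I_i -> 'I_N}) := [multinom (A r - hook_count m rho r)%N | r < n].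
pose h (rho : {ffun 'I_i -> 'I_N}) b := lift m (rho b).
have hrE (rho : {ffun 'I_i -> 'I_N}) : hook_rows m rho = cons_rows m (h rho) by [].
have hcm (rho : {ffun 'I_i -> 'I_N}) : hook_count m rho m = 1%N.
  rewrite /hook_count big_ord_recl /hook_rows unlift_none eqxx big1 // => b _.
  by rewrite liftK eq_sym (negPf (neq_lift _ _)).
have dgam (rho : {ffun 'I_i -> 'I_N}) : a rho != 0 -> mdeg (gam rho) = q.
  by move=> /an0[_ le]; apply: multinom_sub_deg.
(* If [p] divides the positive number [A m], the whole degree sits at [m]. Any second row of the
   minor would need a positive exponent elsewhere, so [i = 0] and the terms are of the shape in
   [hook_socle_bid]. *)
have [Am0|Amn0] := eqVneq ((A m)%:R : k) 0.
  have Ap : A m = p.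
    apply/eqP; rewrite eqn_leq -{1}dA mdegE (bigD1 m) //= leq_addr /=.
    by apply: dvdn_leq => //; rewrite (dvdn_pcharf pchar) Am0.
  have Aj j : j != m -> A j = 0%N.
    move=> jm; have := dA; rewrite mdegE (bigD1 m) //= Ap (bigD1 j) //=; clear; lia.
  apply: (eq_lin_comb (fun g => esym (aE g))); apply: lin_comb_sum => rho _ _.
  have [->|arho] := eqVneq (a rho) 0.
    by apply: (eq_lin_comb _ (lin_comb0 _)) => g; rewrite mul0r.
  apply: lin_combZ.
  apply: (eq_lin_comb _ (hook_socle_bid p iN0 (delta_mx 0 m) (rowsub (h rho) 1%:M))) => g.
  rewrite /bid col_mx_delta bideterminant_power bideterminantX hrE; congr (_ * _).
  rewrite -rowE mxE (bigD1 m) //= big1 ?mulr1 => [|j jm]; last first.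
    by rewrite mnmE (Aj j jm) sub0n.
  congr (_ ^+ _); rewrite mnmE hcm Ap.
  have [_ le] := an0 _ arho.
  suff -> : i = 0%N by [].
  case: (posnP i) => // i_gt0; pose b : 'I_i := Ordinal i_gt0.
  have := leq_trans (hook_count_ge m rho (lift ord0 b)) (le _).
  by rewrite hrE cons_rowsS Aj // eq_sym neq_lift.
pose H X := \sum_rho a rho *
   diff_bideterminant (iN : (i.+1 < n)%N) 'X_[gam rho] (rowsub (hook_rows m rho) 1%:M) X.
(* The identity is needed at [insert_column m X], which may be singular, hence the extension beyond
   invertible matrices. *)
have H0 X : H X = 0.
  move: X; apply: (polynomial_eq0_GL kinf).
    apply: polynomial_sum => rho; apply: polynomialM; first exact: polynomial_const.
    by apply: polynomial_sum => j; apply: polynomial_bideterminant.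
  move=> g; have <- := Df0 (g * w0 k N)%g.
  have fE g' : f g' = \sum_(u <- [seq (a rho, rho) | rho <- index_enum {ffun 'I_i -> 'I_N}])
      u.1 * bid iN0 'X_[gam u.2] (rowsub (hook_rows m u.2) 1%:M) g'.
    by rewrite big_map aE.
  rewrite /D (right_comb_lin Z
    (b := fun rho => bid iN0 'X_[gam rho] (rowsub (hook_rows m rho) 1%:M)) fE) big_map; apply: eq_bigr => rho _ /=.
  have [->|arho] := eqVneq (a rho) 0; first by rewrite !mul0r.
  by rewrite -/D differential_monomial ?dgam // mulw0K.
pose iNn : (i < n)%N := ltnW (iN : (i.+1 < n)%N).
have key g : (A m)%:R * f g = \sum_rho a rho *
   diff_bideterminant iNn 'X_[gam rho + U_(m)] (rowsub (h rho) 1%:M) (GL_mx (g * w0 k N)%g).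
  rewrite aE /bid; move: (GL_mx _) => X.
  (* In the differential of [x_m] times the monomial, the term [j = m] gives [A m] times the
     original function, and the terms [j != m] are those of this vanishing contraction. *)
  have e0 : X m ord0 * H (insert_column m X) = 0 by rewrite H0 mulr0.
  rewrite -[LHS]addr0 -[Y in _ + Y]e0 /H.
  rewrite !mulr_sumr -big_split /=; apply: eq_bigr => rho _.
  have [->|arho] := eqVneq (a rho) 0; first by rewrite !(mul0r, mulr0) addr0.
  have [_ le] := an0 _ arho.
  have gm : (gam rho m).+1 = A m by rewrite mnmE hcm subn1 prednK.
  rewrite mulrCA [Y in _ + Y]mulrCA -mulrDr; congr (_ * _).
  rewrite bideterminantX !diff_bideterminantX [in RHS](bigD1 m) //=; congr (_ + _).
    rewrite mnmDE mnm1E eqxx addn1 gm -[RHS]mulrA; congr (_ * (_ * _)); last first.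
      by congr minor; apply: bool_irrelevance.
    by apply: eq_bigr => c _; rewrite mnmBE mnmDE addnK.
  rewrite (bigD1 m) //= hrE minor_insert_column => [|b]; last by rewrite eq_sym neq_lift.
  rewrite eqxx mul0r mulr0 add0r mulr_sumr; apply: eq_bigr => j jm.
  rewrite minor_insert_column => [|b]; last by rewrite eq_sym neq_lift.
  rewrite jm mul1r mulrCA -!mulrA; congr (_ * _).
    by rewrite mnmDE mnm1E eq_sym (negPf jm) addn0.
  rewrite mulrCA mulrA; congr (_ * _).
  rewrite (bigD1 m) //= [RHS](bigD1 m) //= mulrA; congr (_ * _).
    by rewrite mxE -exprS !mnmBE mnmDE !mnm1E eqxx (negPf jm) !subn0 addn1.
  apply: eq_bigr => c /negPf cm; rewrite mxE !mnmBE mnmDE !mnm1E.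
  by rewrite [m == c]eq_sym cm addn0.
apply: (eq_lin_comb (f := fun g => (A m)%:R^-1 * ((A m)%:R * f g))) => [g|].
  by rewrite mulKf.
apply: lin_combZ; apply: (eq_lin_comb (fun g => esym (key g))); apply: lin_comb_sum => rho _ _.
have [->|arho] := eqVneq (a rho) 0.
  by apply: (eq_lin_comb _ (lin_comb0 _)) => g; rewrite mul0r.
apply: lin_combZ; apply: diff_bideterminant_socle => //.
by rewrite mdegD mdeg1 dgam // addn1.
Qed.

End Differential.
End HookDifferential.

(** * Composition factors *)

Section SkeletonDecomposition.
Variables (k : fieldType) (S T : Type).

Lemma det_border m (A : 'M[k]_m) (c : 'cV_m) (r : 'rV_m) (d : 'M_1) : A \in unitmx ->
  \det (block_mx A c r d) = \det A * (d - r *m invmx A *m c) ord0 ord0.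
Proof.
move=> uA; have : \det (block_mx A c r d *m block_mx 1%:M (- (invmx A *m c)) 0 1%:M) =
    \det (block_mx A 0 r (d - r *m invmx A *m c)).
  congr (\det _); rewrite mulmx_block !mulmx1 !mulmx0 !addr0 !mulmxN !mulmxA.
  by rewrite mulmxV // mul1mx addNr [X in block_mx _ _ _ X]addrC.
by rewrite det_mulmx det_ublock !det1 !mulr1 det_lblock det_mx11.
Qed.

(* A kernel B of finite rank is recovered from finitely many of its rows and
   columns: take a nonsingular minor of maximal size and border it. *)
Lemma skeleton_decomposition (J : finType) (B : S -> T -> k)
    (C : S -> J -> k) (E : J -> T -> k) :
  (forall x y, B x y = \sum_j C x j * E j y) ->
  exists m (s : 'I_m -> S) (t : 'I_m -> T) (M : 'M[k]_m),
    forall x y, B x y = \sum_b (\sum_a M b a * B (s a) y) * B x (t b).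
Proof.
move=> BE; pose Q m (s : 'I_m -> S) (t : 'I_m -> T) := \matrix_(a, b) B (s a) (t b).
pose P m := `[< exists s t, @Q m s t \in unitmx >].
have P0 : exists m, P m.
  exists 0%N; apply/asboolP.
  have e0 : forall X, 'I_0 -> X by move=> X [].
  by exists (e0 S), (e0 T); rewrite unitmxE det_mx00 unitr1.
have Pmax m : P m -> (m <= #|J|)%N.
  move/asboolP=> [s [t /mxrank_unit rQ]].
  pose C' : 'M[k]_(m, #|J|) := \matrix_(a, j) C (s a) (enum_val j).
  pose E' : 'M[k]_(#|J|, m) := \matrix_(j, b) E (enum_val j) (t b).
  have QE : Q m s t = C' *m E'.
    apply/matrixP => a b; rewrite !mxE BE big_enum_val.
    by apply: eq_bigr => j _; rewrite !mxE.
  by rewrite -rQ QE (leq_trans (mxrankM_maxl _ _)) // rank_leq_col.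
case: (ex_maxnP P0 Pmax) => m /asboolP[s [t uA]] max.
exists m, s, t, (invmx (Q m s t)) => x y.
set A := Q m s t in uA *.
pose c : 'cV[k]_m := \col_a B (s a) y; pose r : 'rV[k]_m := \row_b B x (t b).
have d0 : \det (block_mx A c r (const_mx (B x y) : 'M_1)) = 0.
  apply/eqP; apply: contraT => dn0.
  pose s' (a : 'I_(m + 1)) := if fintype.split a is inl a' then s a' else x.
  pose t' (b : 'I_(m + 1)) := if fintype.split b is inl b' then t b' else y.
  have : P (m + 1)%N.
    apply/asboolP; exists s', t'; rewrite unitmxE unitfE.
    suff -> : Q (m + 1)%N s' t' = block_mx A c r (const_mx (B x y)) by [].
    apply/matrixP => a b; rewrite !mxE /s' /t'.
    by case: (fintype.split a) => a'; rewrite !mxE; case: (fintype.split b) => b'; rewrite !mxE.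
  by move/max; rewrite addn1 ltnn.
move: d0; rewrite det_border // => /eqP; rewrite mulf_eq0.
rewrite unitmxE unitfE in uA; rewrite (negPf uA) /= mxE mxE [X in _ + X]mxE subr_eq0 => /eqP ->.
rewrite -mulmxA mxE; apply: eq_bigr => b _; rewrite mulrC [r _ _]mxE; congr (_ * _).
by rewrite mxE; apply: eq_bigr => a _; rewrite [c _ _]mxE.
Qed.

End SkeletonDecomposition.

Section Submodules.
Variables (k : fieldType) (n : nat) (V : gmodule k n) (U : submodule V).

Definition sub_val (x : gmodule_of_sub U) : V := sval x.
Definition sub_mk (x : V) (Ux : U x) : gmodule_of_sub U :=
  exist (fun x => sm_pred U x) x (asboolT Ux).

Lemma sub_valP (x : gmodule_of_sub U) : U (sub_val x).
Proof. by case: x => x /= /asboolP. Qed.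

Lemma sub_mkK x (Ux : U x) : sub_val (sub_mk Ux) = x.
Proof. by []. Qed.

Lemma sub_val_inj : injective sub_val.
Proof. exact: val_inj. Qed.

Lemma sub_val0 : sub_val 0 = 0.
Proof. by []. Qed.

Lemma sub_val_lin (a : k) (x y : gmodule_of_sub U) :
  sub_val (a *: x + y) = a *: sub_val x + sub_val y.
Proof. by []. Qed.

Lemma sub_val_gact g (x : gmodule_of_sub U) : sub_val (gact g x) = gact g (sub_val x).
Proof. by []. Qed.

Lemma sub_val_sum (I : Type) (r : seq I) (c : I -> k) (w : I -> gmodule_of_sub U) :
  sub_val (\sum_(i <- r) c i *: w i) = \sum_(i <- r) c i *: sub_val (w i).
Proof.
elim: r => [|i r IH]; first by rewrite !big_nil sub_val0.
by rewrite !big_cons sub_val_lin IH.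
Qed.

Lemma submodule_sum (I : Type) (r : seq I) (c : I -> k) (w : I -> V) :
  (forall i, U (w i)) -> U (\sum_(i <- r) c i *: w i).
Proof.
move=> Uw; elim: r => [|i r IH]; first by rewrite big_nil; apply: sm0.
by rewrite big_cons; apply: smP.
Qed.

End Submodules.

Section FunctionValues.
Variables (k : fieldType) (X : Type).

Lemma fun_lin (a : k) (F H : X -> k^o) x : (a *: F + H) x = a * F x + H x.
Proof. by []. Qed.

Lemma fun_sum (I : Type) (r : seq I) (c : I -> k) (F : I -> X -> k^o) x :
  (\sum_(i <- r) c i *: F i) x = \sum_(i <- r) c i * F i x.
Proof.
elim: r => [|i r IH]; first by rewrite !big_nil.
by rewrite !big_cons fun_lin IH.
Qed.

End FunctionValues.

(** * The simple module with hook highest weight, realized in functions on the group *)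

Section SimpleModule.
Variables (k : fieldType) (N p : nat).
Hypotheses (kinf : unbounded k) (pchar : p \in [pchar k]).
Local Notation n := N.+1.
Local Notation G := (GL k n).
Variables (j : nat) (jN : (j <= N)%N) (jp : (j < p)%N).
Let lam := hook_weight n p j.
Let v := hook_vector p jN : G -> k.

(** Used from both sides: as functions of [g] these span the simple module, while as functions of
    [x] they lie in the induced module, where the weight decomposition and the projector are
    available. *)
Definition simple_gen (x g : G) : k := v (g^-1 * x)%g.
Definition simple_set : left_regular k n -> Prop := fun F => lin_comb simple_gen F.

Lemma simple_set0 : simple_set 0.
Proof. exact: lin_comb0. Qed.

Lemma simple_setP (a : k) (F H : left_regular k n) :
  simple_set F -> simple_set H -> simple_set (a *: F + H).
Proof. by move=> FS HS; apply: (lin_combD (lin_combZ a FS) HS). Qed.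

Lemma simple_setG (h : G) (F : left_regular k n) : simple_set F -> simple_set (gact h F).
Proof.
move=> [s sE]; exists [seq (u.1, (h * u.2)%g) | u <- s] => g.
rewrite /= /fun_act sE big_map; apply: eq_bigr => u _.
by rewrite /simple_gen invgM invgK mulgA.
Qed.

Definition hook_simple : gmodule k n :=
  gmodule_of_sub (Submodule simple_set0 simple_setP simple_setG).

Lemma hook_simple_fun (F : hook_simple) : simple_set (sub_val F).
Proof. exact: (sub_valP F). Qed.

Definition to_simple (F : left_regular k n) (FS : simple_set F) : hook_simple :=
  @sub_mk _ _ _ (Submodule simple_set0 simple_setP simple_setG) F FS.

Definition simple_elt (x : G) : hook_simple := to_simple (lin_comb_gen simple_gen x).

Lemma hook_nabla_left (f : G -> k) h : hook_nabla p j f -> hook_nabla p j (fun g => f (h * g)%g).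
Proof.
move=> Vf; have := hook_nabla_comb (fun _ : 'I_1 => 1) (fun=> h) Vf.
by under eq_fun => g do rewrite big_ord1 mul1r.
Qed.

Lemma simple_gen_nabla g : hook_nabla p j (fun x => simple_gen x g).
Proof. by apply: hook_nabla_left; apply: hook_vector_nabla. Qed.

Lemma nabla_finite_rank (S : Type) (F : S -> G -> k) : (forall x, hook_nabla p j (F x)) ->
  exists C : S -> hook_index N p j -> k, forall x y, F x y = \sum_u C x u * hook_basis jN u y.
Proof.
move=> VF; have [C CE] := choice (fun x => hook_nabla_finite_span kinf jN jp (VF x)).
by exists C.
Qed.

Definition simple_ev (F : hook_simple) : G -> k := sub_val F.

Lemma simple_ev_inj (F H : hook_simple) : simple_ev F =1 simple_ev H -> F = H.
Proof. by move=> FH; apply/sub_val_inj/funext. Qed.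

Lemma simple_ev_sum (I : Type) (r : seq I) (c : I -> k) (w : I -> hook_simple) g :
  simple_ev (\sum_(i <- r) c i *: w i) g = \sum_(i <- r) c i * simple_ev (w i) g.
Proof. by rewrite /simple_ev sub_val_sum fun_sum. Qed.

Lemma simple_evZ a (F : hook_simple) g : simple_ev (a *: F) g = a * simple_ev F g.
Proof. by have := simple_ev_sum [:: F] (fun=> a) id g; rewrite !big_seq1. Qed.

Lemma simple_ev_gact h (F : hook_simple) g : simple_ev (gact h F) g = simple_ev F (h^-1 * g)%g.
Proof. by rewrite /simple_ev sub_val_gact. Qed.

Lemma simple_ev_elt x g : simple_ev (simple_elt x) g = simple_gen x g.
Proof. by []. Qed.

Lemma simple_ev_neq0 (F : hook_simple) : F <> 0 -> exists g, simple_ev F g <> 0.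
Proof.
move=> Fn0; apply: contrapT => nex; apply: Fn0; apply: simple_ev_inj => g.
rewrite [RHS]/(simple_ev _ _) /simple_ev sub_val0.
by apply: contrapT => Fg; apply: nex; exists g.
Qed.

Lemma gact_simple_elt (h x : G) : gact h (simple_elt x) = simple_elt (h * x)%g.
Proof.
apply: simple_ev_inj => g; rewrite simple_ev_gact !simple_ev_elt.
by rewrite /simple_gen invgM invgK mulgA.
Qed.

(** The two-variable function [simple_gen] has finite rank, and [skeleton_decomposition] writes each
    translate in finitely many [simple_elt] with coefficients that are values of [simple_gen], hence
    regular in the acting element. *)
Lemma hook_simple_rational : rational hook_simple.
Proof.
move=> F; have [s sE] : simple_set (simple_ev F) := hook_simple_fun F.
have [C CE] := nabla_finite_rank simple_gen_nabla.
have [m [x [t [M ME]]]] := skeleton_decomposition CE.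
exists m, (fun b => simple_elt (t b)), (fun b h => \sum_(u <- s) u.1 *
   (\sum_(a <- index_enum 'I_m) M b a * simple_gen (h * u.2)%g (x a))); split.
  move=> b; apply: (regular_sum s fst (f := fun u h =>
    \sum_(a <- index_enum 'I_m) M b a * simple_gen (h * u.2)%g (x a))) => u.
  apply: (regular_sum _ _ (f := fun a h => simple_gen (h * u.2)%g (x a))) => a.
  apply: (regular_right_translate u.2 (f := fun h => v ((x a)^-1 * h)%g)).
  exact: (regular_left_translate (x a)^-1%g (proj1 (hook_vector_nabla k jN jp))).
move=> h; apply: simple_ev_inj => g.
rewrite simple_ev_sum simple_ev_gact [simple_ev F _]sE.
under [RHS]eq_bigr => b _ do rewrite simple_ev_elt.
under [RHS]eq_bigr => b _ do rewrite mulr_suml.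
rewrite exchange_big /=; apply: eq_bigr => u _.
under [RHS]eq_bigr => b _ do rewrite -mulrA.
rewrite -mulr_sumr; congr (_ * _).
by rewrite -ME /simple_gen invgM invgK mulgA.
Qed.

(** After a translation [F] is nonzero at 1; the torus projector then sends it to that value times
    [simple_elt (w0 k N)], whose translates span everything. *)
Lemma hook_simple_generated (U : submodule hook_simple) (F : hook_simple) :
  U F -> F <> 0 -> forall H, U H.
Proof.
move=> UF Fn0.
have [g Fg] := simple_ev_neq0 Fn0.
pose F1 := gact g^-1%g F; have UF1 : U F1 by apply: smG.
have F11 : simple_ev F1 1%g <> 0 by rewrite simple_ev_gact invgK mulg1.
have [m [c [t [tt ct]]]] := hook_projector kinf jN jp.
have Uw : U (simple_elt (w0 k N)).
  have -> : simple_elt (w0 k N) =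
     (simple_ev F1 1%g)^-1 *: (\sum_(l <- index_enum 'I_m) c l *: gact (t l) F1) + 0.
    apply: simple_ev_inj => x; rewrite addr0 simple_evZ simple_ev_sum.
    have [s sE] : simple_set (simple_ev F1) := hook_simple_fun F1.
    have e : \sum_(l <- index_enum 'I_m) c l * simple_ev (gact (t l) F1) x =
        simple_ev F1 1%g * simple_gen (w0 k N) x.
      rewrite sE mulr_suml.
      transitivity (\sum_(u <- s) u.1 * \sum_(l < m) c l * simple_gen (t l * u.2)%g x).
        under [RHS]eq_bigr => u _ do rewrite mulr_sumr.
        rewrite exchange_big; apply: eq_bigr => l _.
        rewrite simple_ev_gact sE mulr_sumr.
        apply: eq_bigr => u _; rewrite mulrCA; congr (_ * (_ * _)).
        by rewrite /simple_gen invgM invgK mulgA.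
      apply: eq_bigr => u _; rewrite (ct _ (simple_gen_nabla x)).
      rewrite -[RHS]mulrA; congr (_ * _); rewrite mulrC; congr (_ * _).
      by rewrite /simple_gen invg1 mul1g.
    rewrite e mulKf //; exact/eqP.
  apply: smP; last exact: sm0.
  by apply: submodule_sum => l; apply: smG.
have Ux x : U (simple_elt x).
  have -> : simple_elt x = gact (x * (w0 k N)^-1)%g (simple_elt (w0 k N)).
    by rewrite gact_simple_elt mulgKV.
  exact: smG.
move=> H; have [s sE] : simple_set (simple_ev H) := hook_simple_fun H.
have -> : H = \sum_(u <- s) u.1 *: simple_elt u.2.
  by apply: simple_ev_inj => g'; rewrite simple_ev_sum sE.
exact: submodule_sum.
Qed.

Lemma simple_elt_w0_neq0 : simple_elt (w0 k N) <> 0.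
Proof.
move/(congr1 (fun F : hook_simple => simple_ev F 1%g)).
rewrite simple_ev_elt /simple_gen invg1 mul1g /v hook_vector_w0 /simple_ev sub_val0.
exact/eqP/oner_neq0.
Qed.

Lemma hook_simple_simple : simple hook_simple.
Proof.
split; first by exists (simple_elt (w0 k N)); apply: simple_elt_w0_neq0.
move=> U; have [[F [UF Fn0]]|U0] := pselect (exists F, U F /\ F <> 0).
  by right; apply: hook_simple_generated UF Fn0.
by left=> F UF; apply: contrapT => Fn0; apply: U0; exists F.
Qed.

Lemma hook_simple_highest : highest_weight hook_simple lam.
Proof.
split.
  exists (simple_elt (w0 k N)); split; first exact: simple_elt_w0_neq0.
  move=> t tt; apply: simple_ev_inj => g; rewrite gact_simple_elt simple_evZ !simple_ev_elt.
  exact: (hook_nabla_w0 (simple_gen_nabla g) tt).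
move=> mu F [Fn0 Fmu]; have [g Fg] := simple_ev_neq0 Fn0.
have [s sE] : simple_set (simple_ev F) := hook_simple_fun F.
have [W [fam [uW Wp _ fE]]] := hook_nabla_decomposition kinf jN jp (simple_gen_nabla g).
pose C a := \sum_(u <- s) u.1 * fam a u.2.
have key t : torus t -> character mu t * simple_ev F g = \sum_(a <- W) character a t * C a.
  move=> tt; rewrite -simple_evZ -Fmu // simple_ev_gact sE.
  under [RHS]eq_bigr => a _ do rewrite mulr_sumr.
  rewrite exchange_big /=; apply: eq_bigr => u _.
  have -> : simple_gen u.2 (t^-1 * g)%g = simple_gen (t * u.2)%g g.
    by rewrite /simple_gen invgM invgK mulgA.
  rewrite fE mulr_sumr !big_seq; apply: eq_bigr => a aW.
  by rewrite (weight_part_weight (Wp _ aW)) // mulrCA.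
(* Otherwise the projector onto [mu] kills the right side of [key] for all weights in [W] but
   preserves [simple_ev F g]. *)
have muW : mu \in W.
  apply: contrapT => muW; apply: Fg.
  have [m [c [t [tt ct]]]] := weight_projector kinf (mem_head mu W).
  have E : \sum_(l < m) c l * (character mu (t l) * simple_ev F g) = 0.
    under eq_bigr => l _ do rewrite key // mulr_sumr.
    rewrite exchange_big /= big_seq big1 // => a aW.
    under eq_bigr => l _ do rewrite mulrA.
    rewrite -mulr_suml ct ?inE ?aW ?orbT //.
    by case: eqP => [e|_]; [case: muW; rewrite -e | rewrite mul0r].
  move: E; under eq_bigr => l _ do rewrite mulrA.
  by rewrite -mulr_suml ct ?mem_head // eqxx mul1r.
have [_ _ [x fx] [A [AE dA AF]]] := Wp _ muW.
have [m Am] : exists m, (0 < A m)%N.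
  apply/existsP; apply: contraTT (jp) => /existsPn A0; rewrite -dA mdegE big1 // => l _.
  by apply/eqP; have := A0 l; rewrite lt0n negbK.
have [a [aE an0]] := AF m Am.
have [rho arho] : exists rho, a rho != 0.
  apply: contrapT => nex; case/eqP: fx; rewrite aE big1 // => rho _.
  have [->|arho] := eqVneq (a rho) 0; first by rewrite mul0r.
  by case: nex; exists rho.
have [rI le] := an0 _ arho.
apply: (hook_dominates jN (J := hook_rows m rho) jp AE dA (hook_rows_inj rI)) => b.
exact: leq_trans (hook_count_ge m rho b) (le _).
Qed.

Lemma hook_simple_is_simple_hw : is_simple_hw hook_simple lam.
Proof.
split; [exact: hook_simple_rational | exact: hook_simple_simple | exact: hook_simple_highest].
Qed.

End SimpleModule.

Section WeylModule.
Variables (k : fieldType) (N p : nat).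
Hypotheses (kinf : unbounded k) (pchar : p \in [pchar k]).
Local Notation n := N.+1.
Local Notation G := (GL k n).
Local Notation V i := (nabla k (dual_weight (hook_weight n p i))).
Local Notation Delta i := (weyl k (hook_weight n p i)).

Definition nabla_ev i (f : V i) : G -> k := sub_val f.

Lemma nabla_ev_nabla i (f : V i) : hook_nabla p i (nabla_ev f).
Proof. exact: (sub_valP f). Qed.

Definition to_nabla i (f : G -> k) (Vf : hook_nabla p i f) : V i :=
  @sub_mk _ _ _ (Submodule (@nabla_set0 k n _) (@nabla_setP k n _) (@nabla_setG k n _)) f Vf.

Lemma nabla_ev_inj i (f h : V i) : nabla_ev f =1 nabla_ev h -> f = h.
Proof. by move=> fh; apply/sub_val_inj/funext. Qed.

Lemma nabla_ev_sum i (I : Type) (r : seq I) (c : I -> k) (f : I -> V i) g :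
  nabla_ev (\sum_(u <- r) c u *: f u) g = \sum_(u <- r) c u * nabla_ev (f u) g.
Proof. by rewrite /nabla_ev sub_val_sum fun_sum. Qed.

Lemma nabla_ev_lin i (a : k) (f h : V i) g :
  nabla_ev (a *: f + h) g = a * nabla_ev f g + nabla_ev h g.
Proof. by rewrite /nabla_ev sub_val_lin. Qed.

Lemma nabla_ev_gact i h (f : V i) g : nabla_ev (gact h f) g = nabla_ev f (h^-1 * g)%g.
Proof. by rewrite /nabla_ev sub_val_gact. Qed.

Definition weyl_ev i (phi : Delta i) : V i -> k := sub_val phi.

Lemma weyl_ev_lin i (phi : Delta i) a f h : weyl_ev phi (a *: f + h) = a * weyl_ev phi f + weyl_ev phi h.
Proof. exact: (sub_valP phi). Qed.

Definition to_weyl i (phi : V i -> k^o) (lphi : linear phi) : Delta i :=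
  @sub_mk _ _ _ (Submodule (@dual_set0 _ _ (V i)) (@dual_setP _ _ (V i)) (@dual_setG _ _ (V i))) phi lphi.

Lemma weyl_ev_to i (phi : V i -> k^o) (lphi : linear phi) : weyl_ev (to_weyl lphi) = phi.
Proof. by []. Qed.

Lemma weyl_ev_inj i (phi psi : Delta i) : weyl_ev phi =1 weyl_ev psi -> phi = psi.
Proof. by move=> e; apply/sub_val_inj/funext. Qed.

Lemma weyl_ev_D i a (phi psi : Delta i) f :
  weyl_ev (a *: phi + psi) f = a * weyl_ev phi f + weyl_ev psi f.
Proof. by rewrite /weyl_ev sub_val_lin. Qed.

Lemma weyl_ev_gact i h (phi : Delta i) f : weyl_ev (gact h phi) f = weyl_ev phi (gact h^-1%g f).
Proof. by rewrite /weyl_ev sub_val_gact. Qed.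

Lemma weyl_ev_sum i (phi : Delta i) (I : Type) (r : seq I) (c : I -> k) (f : I -> V i) :
  weyl_ev phi (\sum_(u <- r) c u *: f u) = \sum_(u <- r) c u * weyl_ev phi (f u).
Proof.
have phi0 : weyl_ev phi 0 = 0.
  by have := weyl_ev_lin phi (-1) 0 0; rewrite scaler0 addr0 mulN1r addNr.
elim: r => [|u r IH]; first by rewrite !big_nil.
by rewrite !big_cons weyl_ev_lin IH.
Qed.

Lemma weyl_ev_comb i (phi : Delta i) (I : Type) (s : seq (k * I)) (b : I -> V i) (f : V i) :
  (forall g, nabla_ev f g = \sum_(u <- s) u.1 * nabla_ev (b u.2) g) ->
  weyl_ev phi f = \sum_(u <- s) u.1 * weyl_ev phi (b u.2).
Proof.
move=> fE; have -> : f = \sum_(u <- s) u.1 *: b u.2.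
  by apply: nabla_ev_inj => g; rewrite nabla_ev_sum fE.
exact: weyl_ev_sum.
Qed.

(** * Subquotients of the Weyl module attached to a right translation operator *)

Section Factor.
Variables (i j : nat) (jN : (j <= N)%N) (jp : (j < p)%N).
Variables (Z : seq (k * G)) (f0 : V i) (e : k).
Hypothesis Znabla : forall f, hook_nabla p i f -> hook_nabla p j (right_comb Z f).
Hypothesis Zf0 : forall g, right_comb Z (nabla_ev f0) g = e * hook_vector p jN g.
Hypothesis en0 : e != 0.
Variables W U : submodule (Delta i).
Hypothesis WE : forall phi, W phi <->
  (forall f, (forall g, right_comb Z (nabla_ev f) g = 0) -> weyl_ev phi f = 0).
Hypothesis UE : forall phi, U phi <-> W phi /\ forall g, weyl_ev phi (gact g f0) = 0.

Lemma right_comb_gact (f : V i) g x :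
  right_comb Z (nabla_ev (gact g f)) x = right_comb Z (nabla_ev f) (g^-1 * x)%g.
Proof. by apply: eq_bigr => u _; rewrite nabla_ev_gact mulgA. Qed.

Lemma right_combD (a : k) (f h : V i) x :
  right_comb Z (nabla_ev (a *: f + h)) x = a * right_comb Z (nabla_ev f) x + right_comb Z (nabla_ev h) x.
Proof.
rewrite /right_comb mulr_sumr -big_split; apply: eq_bigr => u _.
by rewrite nabla_ev_lin mulrDr mulrCA.
Qed.

(* Functionals killing the kernel of right_comb Z are combinations of
   evaluations of right_comb Z f, because this map has finite rank. *)
Lemma factor_evaluation (phi : Delta i) : W phi -> exists s : seq (k * G),
  forall f, weyl_ev phi f = \sum_(u <- s) u.1 * right_comb Z (nabla_ev f) u.2.
Proof.
move=> /WE phi0.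
have [C CE] := nabla_finite_rank kinf jN jp (fun f : V i => Znabla (nabla_ev_nabla f)).
have [m [x [t [M ME]]]] := skeleton_decomposition CE.
pose be b := \sum_a M b a * weyl_ev phi (x a).
exists [seq (be b, t b) | b <- index_enum 'I_m] => f.
(* A combination of the fixed elements [x a] with the same image as [f] under [right_comb Z]; [phi]
   cannot tell them apart, and its coefficients are linear in finitely many values of that image. *)
pose f' := \sum_(a <- index_enum 'I_m) (\sum_b M b a * right_comb Z (nabla_ev f) (t b)) *: x a.
have -> : weyl_ev phi f = weyl_ev phi f'.
  have : weyl_ev phi ((-1) *: f' + f) = 0.
    apply: phi0 => g; rewrite right_combD.
    suff -> : right_comb Z (nabla_ev f') g = right_comb Z (nabla_ev f) g by rewrite mulN1r addNr.
    rewrite {1}/right_comb; under eq_bigr => u _ do rewrite nabla_ev_sum mulr_sumr.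
    rewrite exchange_big [RHS]ME /=; under [RHS]eq_bigr => b _ do rewrite mulr_suml.
    rewrite [RHS]exchange_big /=; apply: eq_bigr => a _.
    under eq_bigr => u _ do rewrite mulrCA.
    rewrite -mulr_sumr mulr_suml; apply: eq_bigr => b _.
    by rewrite -[\sum_(u <- Z) _]/(right_comb Z (nabla_ev (x a)) g) mulrAC.
  by rewrite weyl_ev_lin mulN1r addrC => /eqP; rewrite subr_eq0 => /eqP.
rewrite weyl_ev_sum big_map /=.
under eq_bigr => a _ do rewrite mulr_suml.
rewrite exchange_big /=; apply: eq_bigr => b _.
by rewrite /be mulr_suml; apply: eq_bigr => a _; rewrite mulrAC.
Qed.

(** Right translations commute with the left action, so evaluating the image of [gact g f0] at [x]
    gives [e * simple_gen x g]; now [factor_evaluation] applies. *)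
Lemma factor_simple_set (phi : Delta i) : W phi ->
  simple_set p jN (fun g => weyl_ev phi (gact g f0)).
Proof.
move=> /factor_evaluation[s sE]; exists [seq (u.1 * e, u.2) | u <- s] => g.
rewrite sE big_map; apply: eq_bigr => u _.
by rewrite right_comb_gact Zf0 mulrA.
Qed.

Definition factor_map (phi : gmodule_of_sub W) : hook_simple k p jN :=
  to_simple (factor_simple_set (sub_valP phi)).

Lemma simple_ev_factor_map phi g :
  simple_ev (factor_map phi) g = weyl_ev (sub_val phi) (gact g f0).
Proof. by []. Qed.

(** For surjectivity, a combination of the [simple_gen x] is lifted to the same combination of
    evaluations at [x] after [right_comb Z], divided by [e]; such functionals kill the kernel of
    [right_comb Z]. *)
Lemma factor_quotient_iso : quotient_iso W U (hook_simple k p jN).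
Proof.
split; first by move=> phi /UE[].
exists factor_map; split.
- move=> a phi psi; apply: simple_ev_inj => g.
  have -> : a *: factor_map phi + factor_map psi =
     \sum_(u <- [:: (a, phi); (1, psi)]) u.1 *: factor_map u.2.
    by rewrite big_cons big_seq1 scale1r.
  rewrite simple_ev_sum big_cons big_seq1 !simple_ev_factor_map mul1r.
  by rewrite sub_val_lin weyl_ev_D.
- move=> g phi; apply: simple_ev_inj => x.
  by rewrite simple_ev_gact !simple_ev_factor_map sub_val_gact weyl_ev_gact gactM.
- move=> F; have [s sE] : simple_set p jN (simple_ev F) := hook_simple_fun F.
  pose phi : V i -> k^o := fun f => \sum_(u <- s) (u.1 * e^-1) * right_comb Z (nabla_ev f) u.2.
  have lphi : linear phi.
    move=> a f h; apply: (_ : phi (a *: f + h) = a * phi f + phi h); rewrite /phi mulr_sumr -big_split; apply: eq_bigr => u _.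
    by rewrite right_combD mulrDr mulrCA.
  have Wphi : W (to_weyl lphi).
    apply/WE => f f0'; rewrite weyl_ev_to /phi big1 // => u _.
    by rewrite f0' mulr0.
  exists (sub_mk Wphi).
  apply: simple_ev_inj => g; rewrite simple_ev_factor_map sub_mkK weyl_ev_to sE.
  apply: eq_bigr => u _.
  by rewrite right_comb_gact Zf0 -mulrA mulKf.
move=> phi; rewrite -[\val phi]/(sub_val phi); split=> [phi0|/UE[_ phi0]].
  apply/UE; split; first exact: sub_valP.
  move=> g; rewrite -simple_ev_factor_map phi0.
  by have := simple_evZ 0 (factor_map phi) g; rewrite scale0r mul0r.
apply: simple_ev_inj => g; rewrite simple_ev_factor_map phi0.
by have := simple_evZ 0 (factor_map phi) g; rewrite scale0r mul0r.
Qed.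

End Factor.
End WeylModule.

Lemma simple_quotient_iso (k : fieldType) n (X : gmodule k n) (W U : submodule X) (L : gmodule k n) :
  (forall x, W x) -> (forall x, U x -> x = 0) -> simple L -> quotient_iso W U L -> simple X.
Proof.
move=> Wall U0 [[l ln0] Lsimple] [_ [f [flin feq fsurj fker]]].
pose inW (x : X) : gmodule_of_sub W := exist (fun x => `[< W x >]) x (asboolT (Wall x)).
have f0 : f 0 = 0.
  by have := flin (-1) 0 0; rewrite scaleN1r oppr0 addr0 scaleN1r addNr.
have fD a x y : f (inW (a *: x + y)) = a *: f (inW x) + f (inW y).
  by rewrite -flin; congr f; apply: val_inj.
have fG g x : f (inW (gact g x)) = gact g (f (inW x)).
  by rewrite -feq; congr f; apply: val_inj.
have finj x : f (inW x) = 0 -> x = 0 by move/fker/U0.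
split.
  have [w fw] := fsurj l; exists (val w) => w0'; apply: ln0; rewrite -fw -f0; congr f.
  exact: val_inj.
move=> Y; pose fY := fun l => exists x, Y x /\ f (inW x) = l.
have fY0 : fY 0.
  by exists 0; split; [exact: sm0 | rewrite -f0; congr f; apply: val_inj].
have fYP a u v : fY u -> fY v -> fY (a *: u + v).
  move=> [x [Yx <-]] [y [Yy <-]]; exists (a *: x + y); split; first exact: smP.
  exact: fD.
have fYG g u : fY u -> fY (gact g u).
  by move=> [x [Yx <-]]; exists (gact g x); split; [exact: smG | exact: fG].
have [Y0|Yall] := Lsimple (Submodule fY0 fYP fYG).
  by left=> x Yx; apply: finj; apply: Y0; exists x.
right=> x; have [y [Yy fyx]] := Yall (f (inW x)).
suff -> : x = y by [].
apply/eqP; rewrite -subr_eq0; apply/eqP/finj.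
by rewrite addrC -scaleN1r fD fyx scaleN1r addNr.
Qed.

(** * When a function lies in the span of the translates of the highest weight vector *)

Section SocleCriteria.
Variables (k : fieldType) (N p : nat).
Hypotheses (kinf : unbounded k) (pchar : p \in [pchar k]).
Local Notation n := N.+1.
Local Notation G := (GL k n).

(** Reduction to weight vectors: each component of [f] is a combination of left torus translates of
    [f], hence is again killed by the operator. *)
Lemma hook_kernel i (iN : (i < N)%N) (ip : (i.+1 < p)%N) Z (f : G -> k) :
  (forall y (L : 'M[k]_(i.+1, n)) g,
    right_comb Z (bid (ltnW iN) (linear_form y ^+ (p - i.+1)) L) g =
    (p - i.+1)%:R * bid iN (linear_form y ^+ (p - i.+2)) (col_mx y L : 'M_(i.+2, n)) g) ->
  hook_nabla p i f -> (forall g, right_comb Z f g = 0) -> hook_socle p (ltnW iN) f.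
Proof.
move=> ZE Vf Zf; have [W [fam [_ Wp Wt fE]]] := hook_nabla_decomposition kinf (ltnW iN) (ltnW ip) Vf.
apply: (eq_lin_comb (fun g => esym (fE g))); apply: lin_comb_sum => a aW _.
apply: (weight_part_kernel kinf pchar ip ZE (Wp _ aW)) => g.
have [m [c [t [_ ct]]]] := Wt _ aW.
rewrite /right_comb; under eq_bigr => u _ do rewrite ct mulr_sumr.
rewrite exchange_big big1 // => l _ /=.
have := Zf (t l * g)%g; rewrite /right_comb => Zl.
under eq_bigr => u _ do rewrite mulrCA mulgA.
by rewrite -mulr_sumr Zl mulr0.
Qed.

Lemma minor_full (nn : (n <= n)%N) (L X : 'M[k]_n) : minor nn L X = \det L * \det X.
Proof.
rewrite /minor -det_mulmx; congr (\det _); apply/matrixP => a b; rewrite mxE.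
by congr (_ a _); apply: val_inj.
Qed.

(** If [i = p.-1], the linear form has exponent 0 and any row of [L] can play its part. If [i = N],
    the minor is [\det L] times a determinant, so [L] may be replaced, up to a scalar, by an
    invertible matrix with first row [y]. *)
Lemma hook_socle_top i (iN : (i <= N)%N) (ip : (i < p)%N) (f : G -> k) :
  i = N \/ i = p.-1 -> hook_nabla p i f -> hook_socle p iN f.
Proof.
move=> top /(hook_nabla_power_span kinf pchar iN ip); apply: lin_comb_trans => -[y L] /=.
have [i1|q0] := eqVneq (p - i.+1)%N 0%N.
  have := hook_socle_bid p iN (usubmx (L : 'M_(1 + i, n))) (dsubmx (L : 'M_(1 + i, n))).
  by rewrite vsubmxK i1 !expr0.
have iNE : i = N by case: top => // ie; move: q0 ip; rewrite ie; clear; lia.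
have [->|yn0] := eqVneq y 0.
  apply: (eq_lin_comb _ (lin_comb0 _)) => g.
  by rewrite /bid bideterminant_power mul0mx mxE expr0n (negPf q0) mul0r.
have fy : row_free y by rewrite /row_free rank_rV yn0.
have [h uh hE] := row_free_extension (ltn0Sn N) fy.
clear ip top q0; subst i; rewrite /bid.
pose L' := dsubmx (h : 'M_(1 + N, n)).
have hy : h = col_mx y L' :> 'M_(1 + N, n).
  rewrite -[LHS](vsubmxK (h : 'M_(1 + N, n))) -/L'; congr col_mx.
  by rewrite -hE; apply/matrixP => a b; rewrite !mxE; congr (h _ _); apply: val_inj.
apply: (eq_lin_comb _ (lin_combZ (\det L / \det h) (hook_socle_bid p iN y L'))) => g.
rewrite /bid -hy !bideterminant_power (minor_full iN L) [minor _ _ _](minor_full iN h).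
have hn0 : \det h != 0 by rewrite -unitfE -unitmxE.
by rewrite mulrCA; congr (_ * _); rewrite mulrA divfK.
Qed.

End SocleCriteria.

Section TrivialSubmodules.
Variables (k : fieldType) (n : nat) (X : gmodule k n).

Lemma gact0 g : gact g (0 : X) = 0.
Proof. by have := gact_linear g (-1) (0 : X) 0; rewrite scaleN1r oppr0 addr0 scaleN1r addNr. Qed.

Lemma zero_submoduleP (a : k) (u v : X) : u = 0 -> v = 0 -> a *: u + v = 0.
Proof. by move=> -> ->; rewrite scaler0 addr0. Qed.

Lemma zero_submoduleG g (v : X) : v = 0 -> gact g v = 0.
Proof. by move=> ->; apply: gact0. Qed.

Definition zero_submodule : submodule X :=
  Submodule (erefl : 0 = 0 :> X) zero_submoduleP zero_submoduleG.

Definition full_submodule : submodule X :=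
  @Submodule _ _ X (fun=> True) I (fun _ _ _ _ _ => I) (fun _ _ _ => I).

End TrivialSubmodules.

Section HookWeylModule.
Variables (k : fieldType) (N p : nat).
Hypotheses (kinf : unbounded k) (pchar : p \in [pchar k]).
Local Notation n := N.+1.
Local Notation G := (GL k n).
Local Notation V i := (nabla k (dual_weight (hook_weight n p i))).
Local Notation Delta i := (weyl k (hook_weight n p i)).
Variables (i : nat) (iN : (i <= N)%N) (ip : (i < p)%N).

Definition annihilator_set (f : V i) (phi : Delta i) : Prop :=
  forall g, weyl_ev phi (gact g f) = 0.

Lemma annihilator0 f : annihilator_set f 0.
Proof. by move=> g; rewrite /weyl_ev sub_val0. Qed.

Lemma annihilatorP f (a : k) phi psi :
  annihilator_set f phi -> annihilator_set f psi -> annihilator_set f (a *: phi + psi).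
Proof. by move=> pf qf g; rewrite weyl_ev_D pf qf mulr0 addr0. Qed.

Lemma annihilatorG f h phi : annihilator_set f phi -> annihilator_set f (gact h phi).
Proof. by move=> pf g; rewrite weyl_ev_gact -gactM. Qed.

Definition annihilator f : submodule (Delta i) :=
  Submodule (annihilator0 f) (@annihilatorP f) (@annihilatorG f).

Definition hook_elt : V i := to_nabla (hook_vector_nabla k iN ip).

Lemma annihilator_socle phi (f : V i) :
  annihilator hook_elt phi -> hook_socle p iN (nabla_ev f) -> weyl_ev phi f = 0.
Proof.
move=> phi0 [s sE]; rewrite (weyl_ev_comb phi (s := s) (b := fun u => gact u^-1%g hook_elt)).
  by rewrite big1 // => u _; rewrite phi0 mulr0.
by move=> g; rewrite sE; apply: eq_bigr => u _; rewrite nabla_ev_gact invgK.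
Qed.

Lemma weyl_top_quotient :
  quotient_iso (full_submodule (Delta i)) (annihilator hook_elt) (hook_simple k p iN).
Proof.
have Z1 (f : G -> k) : right_comb [:: (1, 1%g)] f = f.
  by apply/funext => g; rewrite /right_comb big_seq1 mul1r mulg1.
apply: (@factor_quotient_iso _ _ _ kinf i i iN ip [:: (1, 1%g)] hook_elt 1).
- by move=> f; rewrite Z1.
- by move=> g; rewrite Z1 mul1r.
- exact: oner_neq0.
- move=> phi; split=> // _ f; rewrite Z1 => f0.
  rewrite (weyl_ev_comb phi (s := [::]) (b := fun u : V i => u)) ?big_nil //.
  by move=> g; rewrite big_nil f0.
by move=> phi; split=> [phi0|[]].
Qed.

End HookWeylModule.

Section HookWeylBottom.
Variables (k : fieldType) (N p : nat).
Hypotheses (kinf : unbounded k) (pchar : p \in [pchar k]).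
Local Notation n := N.+1.
Local Notation G := (GL k n).
Local Notation V i := (nabla k (dual_weight (hook_weight n p i))).
Local Notation Delta i := (weyl k (hook_weight n p i)).

(** The factor construction with the differential. Its kernel is spanned by translates of the
    highest weight vector, so functionals killing the kernel are exactly those in the
    annihilator. *)
Lemma weyl_bottom_quotient i (iN : (i < N)%N) (ip : (i.+1 < p)%N) :
  quotient_iso (annihilator (hook_elt k (ltnW iN) (ltnW ip))) (zero_submodule (Delta i))
    (hook_simple k p iN).
Proof.
have [Z ZE] := hook_derivation kinf pchar iN ip.
pose f0 : V i := to_nabla (hook_preimage_nabla k iN ip).
have DV f := differential_socle kinf pchar ip ZE (f := f).
have Df0 := differential_preimage ZE.
have q0 := differential_degree_neq0 pchar ip.
have kerD phi : annihilator (hook_elt k (ltnW iN) (ltnW ip)) phi <->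
    forall f : V i, (forall g, right_comb Z (nabla_ev f) g = 0) -> weyl_ev phi f = 0.
  split=> [phi0 f Df|phi0 g].
    exact: annihilator_socle phi0 (hook_kernel kinf pchar ip ZE (nabla_ev_nabla f) Df).
  by apply: phi0 => x; rewrite right_comb_gact; apply: (differential_hook_vector ZE).
apply: (@factor_quotient_iso _ _ _ kinf i i.+1 iN ip Z f0 (p - i.+1)%:R) => //.
  by move=> f /DV; apply: hook_socle_nabla.
move=> phi; split=> [->|[/kerD phi0 phif0]].
  by split=> [|g]; [apply: sm0 | rewrite /weyl_ev sub_val0].
apply: weyl_ev_inj => f; rewrite [RHS]/weyl_ev sub_val0.
have [s sE] := DV _ (nabla_ev_nabla f).
(* The image of [f] is a combination of translates of the next highest weight vector; [f'] is the
   same combination of translates of the preimage [f0], rescaled, so [f - f'] lies in the kernel. *)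
pose f' := \sum_(u <- s) (u.1 * (p - i.+1)%:R^-1) *: gact u.2^-1%g f0.
have : weyl_ev phi ((-1) *: f' + f) = 0.
  apply: phi0 => g; rewrite right_combD mulN1r sE.
  rewrite (right_comb_lin Z (s := [seq (u.1 / (p - i.+1)%:R, u.2) | u <- s])
    (b := fun u => nabla_ev (gact u^-1%g f0))).
    rewrite big_map addrC -sumrB big1 // => u _.
    by rewrite right_comb_gact invgK Df0 -mulrA mulKf // subrr.
  by move=> x; rewrite big_map nabla_ev_sum.
rewrite weyl_ev_lin weyl_ev_sum big1 => [|u _]; last by rewrite phif0 mulr0.
by rewrite mulr0 add0r.
Qed.

End HookWeylBottom.

Local Open Scope classical_set_scope.

Theorem mainTheorem1 (k : fieldType) (p n : nat)
    (k_infinite : infinite_set [set: k]) (char_k : p \in [pchar k]%R)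
    (n_ge1 : (1 <= n)%N) :
  (forall i : nat, (i < minn n.-1 p.-1)%N ->
     composition_factors (weyl k (hook_weight n p i))
       [:: hook_weight n p i; hook_weight n p i.+1]) /\
  (forall i : nat, i = minn n.-1 p.-1 ->
     simple (weyl k (hook_weight n p i))).
Proof.
have kinf := unbounded_infinite k_infinite.
have p_gt0 := prime_gt0 (pcharf_prime char_k).
case: n n_ge1 => // N _; rewrite [N.+1.-1]/=; split=> i.
  rewrite leq_min => /andP[iN ip1]; have ip : (i.+1 < p)%N by rewrite -ltn_predRL.
  pose v := hook_elt k (ltnW iN) (ltnW ip).
  (* The series is listed from the bottom up, whence the transposed order of the weights; the full
     module enters as the default value of [nth]. *)
  exists [:: hook_weight N.+1 p i.+1; hook_weight N.+1 p i],
    (nth (full_submodule _) [:: zero_submodule _; annihilator v]).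
  split=> //; first exact/permPl/(perm_catC [:: _] [:: _]).
  case=> [|[|//]] _.
    exists (hook_simple k p iN); split; first exact: hook_simple_is_simple_hw.
    exact: weyl_bottom_quotient.
  exists (hook_simple k p (ltnW iN)); split; first exact: hook_simple_is_simple_hw (ltnW ip).
  exact: weyl_top_quotient.
move=> imin; have iN : (i <= N)%N by rewrite imin geq_minl.
have ip : (i < p)%N by rewrite -(prednK p_gt0) ltnS imin geq_minr.
have top : i = N \/ i = p.-1.
  by rewrite imin /minn; case: ifP => _; [left | right].
have [_ simp _] := hook_simple_is_simple_hw kinf iN ip.
(* At the end of the complex the translates of the highest weight vector span the induced module, so
   the annihilator is zero and the simple quotient is the whole Weyl module. *)
apply: simple_quotient_iso simp (weyl_top_quotient kinf iN ip) => // phi phi0.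
apply: weyl_ev_inj => f; rewrite [RHS]/weyl_ev sub_val0.
exact: annihilator_socle phi0 (hook_socle_top kinf char_k iN ip top (nabla_ev_nabla f)).
Qed.
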